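(* There exists an integer $N$ such that for every field $\mathbb{F}$ with $|\mathbb{F}|\ge N$ and every integer $n\ge 78$, we have the strict inequality $\mathrm{R}(\langle 2,2,4\rangle^{\otimes n})<\mathrm{R}(\langle 2,2,4\rangle)^n$.
   Context: For natural numbers $n_1,n_2,n_3$, the matrix multiplication tensor is the 3-tensor $\langle n_1,n_2,n_3\rangle=\sum_{i_1=1}^{n_1}\sum_{i_2=1}^{n_2}\sum_{i_3=1}^{n_3}(b_{i_1}\otimes b_{i_2})\otimes(b_{i_2}\otimes b_{i_3})\otimes(b_{i_3}\otimes b_{i_1})$ in $(\mathbb{F}^{n_1}\otimes\mathbb{F}^{n_2})\otimes(\mathbb{F}^{n_2}\otimes\mathbb{F}^{n_3})\otimes(\mathbb{F}^{n_3}\otimes\mathbb{F}^{n_1})$, where the $b_j$ are standard basis vectors and the three tensor factors are the three parenthesised spaces. The tensor rank $\mathrm{R}(t)$ of a $k$-tensor $t\in U_1\otimes\cdots\otimes U_k$ over $\mathbb{F}$ is the smallest $r$ such that $t$ is a sum of $r$ simple tensors $u_1\otimes\cdots\otimes u_k$. The tensor power $\langle 2,2,4\rangle^{\otimes n}$ is regarded as a $3n$-tensor (factors of different copies are not grouped). *)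

(* Defs.v *)
From HB Require Import structures.
From mathcomp Require Import all_boot all_order all_algebra.
From mathcomp Require Import boolp classical_sets functions cardinality.

Set Implicit Arguments.
Unset Strict Implicit.
Unset Printing Implicit Defensive.

Import GRing.Theory.
Local Open Scope ring_scope.

(* Tensors are given in coordinates.  For a finite type K of tensor factors   *)
(* and a family J : K -> finType of basis index sets, [tensor F J] is the     *)
(* tensor product over k : K of the spaces F^(J k).                           *)
Definition tensor (F : fieldType) (K : finType) (J : K -> finType) : Type :=
  {ffun {dffun forall k : K, J k} -> F}.

HB.instance Definition _ (F : fieldType) (K : finType) (J : K -> finType) :=
  GRing.Zmodule.on (@tensor F K J).

Definition simple_tensor (F : fieldType) (K : finType) (J : K -> finType)
    (u : forall k : K, {ffun J k -> F}) : tensor F J :=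
  [ffun x : {dffun forall k : K, J k} => \prod_(k : K) u k (x k)].

Definition sum_of_simple (F : fieldType) (K : finType) (J : K -> finType)
    (t : tensor F J) (r : nat) : Prop :=
  exists u : 'I_r -> forall k : K, {ffun J k -> F},
    t = \sum_(i < r) simple_tensor (u i).

(* The default value 0 is only reached when K is empty, where the only simple *)
(* tensor is 1; see [tensor_rankP] for nonempty K.                            *)
Definition tensor_rank (F : fieldType) (K : finType) (J : K -> finType)
    (t : tensor F J) : nat :=
  xget 0%N [set r | sum_of_simple t r /\
                    forall s, sum_of_simple t s -> (r <= s)%N].

Lemma sum_of_simple_ex (F : fieldType) (K : finType) (J : K -> finType)
  (k0 : K) (t : tensor F J) : exists r, sum_of_simple t r.
Proof.
pose u (y : {dffun forall k : K, J k}) (k : K) : {ffun J k -> F} :=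
  [ffun j => (if k == k0 then t y else 1) * (j == y k)%:R].
exists #|{dffun forall k : K, J k}|; exists (fun i => u (enum_val i)).
rewrite -(big_enum_val (fun y => simple_tensor (u y))) /=.
apply/ffunP => x; rewrite sum_ffunE (bigD1 x) //= big1 ?addr0 => [|y neq_yx].
  rewrite ffunE (bigD1 k0) //= ffunE !eqxx mulr1 big1 ?mulr1 // => k neq_k.
  by rewrite ffunE (negPf neq_k) eqxx mulr1.
have [k neq_k] : exists k, x k != y k.
  apply/existsP; rewrite -negb_forall; apply: contra neq_yx => /forallP eq_xy.
  by apply/eqP/ffunP => k; rewrite (eqP (eq_xy k)).
by rewrite ffunE (bigD1 k) //= ffunE (negPf neq_k) mulr0 mul0r.
Qed.

Lemma tensor_rankP (F : fieldType) (K : finType) (J : K -> finType)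
    (k0 : K) (t : tensor F J) :
  sum_of_simple t (tensor_rank t) /\
  forall s, sum_of_simple t s -> (tensor_rank t <= s)%N.
Proof.
have [r0 t_r0] := sum_of_simple_ex k0 t.
have ex_r : exists r, `[< sum_of_simple t r >] by exists r0; apply/asboolP.
have [r /asboolP t_r min_r] := ex_minnP ex_r.
apply: (@xgetPex _ 0%N [set r | sum_of_simple t r /\
  forall s, sum_of_simple t s -> (r <= s)%N]).
by exists r; split=> // s /asboolP; apply: min_r.
Qed.

(* The factors of the n copies stay separate: the n-th power of a tensor with *)
(* factors K has factors 'I_n * K, the pair (c, k) being factor k of copy c.  *)
Definition tensor_pow (F : fieldType) (K : finType) (J : K -> finType)
    (t : tensor F J) (n : nat) :
    tensor F (fun ck : 'I_n * K => J ck.2) :=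
  [ffun x : {dffun forall ck : 'I_n * K, J ck.2} =>
     \prod_(c < n) t [ffun k : K => x (c, k)]].

Definition basis_vec (F : fieldType) (n : nat) (i : 'I_n) : {ffun 'I_n -> F} :=
  [ffun j => (j == i)%:R].

(* F^m (x) F^n is identified with F^(m * n), as a single tensor factor. *)
Definition vec_tensor (F : fieldType) (m n : nat)
    (u : {ffun 'I_m -> F}) (v : {ffun 'I_n -> F}) :
    {ffun ('I_m * 'I_n)%type -> F} :=
  [ffun p => u p.1 * v p.2].

Definition mm_index (n1 n2 n3 : nat) (k : 'I_3) : finType :=
  match val k with
  | 0 => ('I_n1 * 'I_n2)%type
  | 1 => ('I_n2 * 'I_n3)%type
  | _ => ('I_n3 * 'I_n1)%type
  end.

Definition mm_factor (F : fieldType) (n1 n2 n3 : nat)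
    (i1 : 'I_n1) (i2 : 'I_n2) (i3 : 'I_n3) (k : 'I_3) :
    {ffun mm_index n1 n2 n3 k -> F} :=
  match val k as m return
    {ffun (match m return finType with
           | 0 => ('I_n1 * 'I_n2)%type
           | 1 => ('I_n2 * 'I_n3)%type
           | _ => ('I_n3 * 'I_n1)%type
           end) -> F}
  with
  | 0 => vec_tensor (basis_vec F i1) (basis_vec F i2)
  | 1 => vec_tensor (basis_vec F i2) (basis_vec F i3)
  | _ => vec_tensor (basis_vec F i3) (basis_vec F i1)
  end.

Definition matmul_tensor (F : fieldType) (n1 n2 n3 : nat) :
    tensor F (mm_index n1 n2 n3) :=
  \sum_(i1 < n1) \sum_(i2 < n2) \sum_(i3 < n3)
    simple_tensor (mm_factor F i1 i2 i3).

(* Main.v *)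
From HB Require Import structures.
Require Import Defs.
From mathcomp Require Import boolp classical_sets functions cardinality.
From mathcomp Require Import all_boot all_order all_algebra.
From mathcomp Require Import ring zify.

(** The strict inequality comes from the gap between the rank and the border
    rank of [<2,2,4>].

    Upper bound.  [matmul224_degeneration] writes [t + e * t1], for
    [t = <2,2,4>], a fixed tensor [t1] and every nonzero [e], as a sum of 13
    simple tensors.  The power [(t + e * t1)^n] has rank at most [13^n], and
    each of its entries is a polynomial of degree at most [n] in [e]; Lagrange
    interpolation at [n + 1] nonzero points of the field recovers its value
    [t^n] at [e = 0] as a combination of [n + 1] such powers.  Hence
    [R(t^n) <= (n + 1) * 13^n].  For [n = 78] this is less than [14^78], and it
    asks for 79 nonzero points, hence for 80 elements of the field.

    Lower bound.  Over every field [R(t) >= 14], that is, no decomposition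
    [sum_l <f_l, A> <g_l, x> <h_l, y> = <y, A x>] of the product of a 2 x 2 and
    a 2 x 4 matrix has 13 terms.  For products of a 2 x 2 and a 2 x n matrix,
    the forms [f_l] are points of the projective space of 2 x 2 matrices.  The
    singular matrices are a quadric, ruled by the lines [f b = 0] and the lines
    [f^T a = 0], whose tangent planes are [a^T f b = 0].  Restricting the
    decomposition to suitable inputs bounds the numbers of forms in tangent
    planes and on tangent lines ([plane_card], [tangent_card]).  This gives
    [r >= 3n + 1] ([rank_lower_bound]) and, when equality holds, very rigid
    configurations: a tangent line that is not on the quadric carries at most one
    form ([tangent_line_inj]), and for [n = 4] a line of the quadric carries no
    form or exactly two ([ruling_card2]).

    When [r = 3n + 1] there is moreover a rigidity of the other two factors.
    Normalize an invertible form [f_j] to the identity.  Then the spaces of the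
    [d (x) h_l], with [d] a traceless matrix orthogonal to [f_l] and [l] other
    than [j], form a direct sum, and uniqueness of coordinates in it yields
    linear equations on the 2 x 2 matrices [g_i h_k^T] ([orthogonality]).  For
    [f_k = 1], they force [g_i h_k^T = 0] as soon as the commutator of some
    invertible [f_j] with [f_i] is invertible ([commutator_vanish]).  Otherwise
    these [f_j] are triangular in an eigenbasis of [f_i], and if [g_i h_k^T] is
    nonzero at most one of them moves an eigenvector of [f_i] whose complementary
    eigenvalue is nonzero ([moving_unique]).  Too many forms are available for that when
    [f_i] is singular and [f_k] is not ([rank_one_vanish]), and when [i] and [k]
    are distinct and all forms are invertible ([all_invertible_vanish]); so
    [g_i h_k^T = 0] in these cases.  Either way the terms split into two nonempty
    sets [S] and [T] with [g_i h_k^T = 0] for [i] in [S] and [k] in [T].  The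
    decomposition then contains decompositions for [n1] and [n2] columns, with
    [n1 + n2 = n] and both positive, carried by [S] and [T].  These have at least
    [(3 n1 + 1) + (3 n2 + 1)] terms, more than [3n + 1] ([no_splitting]).

    Larger exponents.  For [n = 78 + m], [R(t^n) <= R(t^78) * R(t)^m], and
    [R(t^78) < 14^78 <= R(t)^78]. *)

Set Implicit Arguments.
Unset Strict Implicit.
Unset Printing Implicit Defensive.

Import GRing.Theory.
Local Open Scope ring_scope.

(** * Common kernels of finite families of vectors *)

Section Families.
Variables (F : fieldType) (I : finType).

(** The left kernel shared by the columns [c l] for [l] in [D], in the row space
    representation of subspaces. *)
Definition famker p (D : {set I}) (c : I -> 'cV[F]_p) : 'M[F]_p :=
  (\bigcap_(l in D) kermx (c l))%MS.

Lemma famkerP p m (D : {set I}) (c : I -> 'cV[F]_p) (u : 'M_(m, p)) :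
  reflect (forall l, l \in D -> u *m c l = 0) (u <= famker D c)%MS.
Proof.
apply: (iffP sub_bigcapmxP) => H l lD; first exact/sub_kermxP/H.
exact/sub_kermxP/H.
Qed.

Definition fammx p (D : {set I}) (c : I -> 'cV[F]_p) : 'M[F]_(p, #|D|) :=
  \matrix_(i, k) c (enum_val k) i 0.

Lemma mul_fammx p q (D : {set I}) (c : I -> 'cV[F]_p) (d : I -> 'cV[F]_q) :
  fammx D c *m (fammx D d)^T = \sum_(l in D) c l *m (d l)^T.
Proof.
apply/matrixP => i j; rewrite mxE summxE [RHS]big_enum_val /=.
by apply: eq_bigr => k _; rewrite !mxE big_ord1 !mxE.
Qed.

Lemma rank_fammx p (D : {set I}) (c : I -> 'cV[F]_p) :
  (p <= \rank (fammx D c) + \rank (famker D c))%N.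
Proof.
have : (kermx (fammx D c) <= famker D c)%MS.
  apply/famkerP => l lD; have /matrixP kc := mulmx_ker (fammx D c).
  apply/matrixP => i j; have := kc i (enum_rank_in lD l).
  rewrite !mxE => kci; rewrite -[RHS]kci; apply: eq_bigr => k _.
  by rewrite !mxE enum_rankK_in // [j]ord1.
by move/mxrankS; rewrite mxrank_ker; have := rank_leq_row (fammx D c); lia.
Qed.

Lemma famker_card p (D : {set I}) (c : I -> 'cV[F]_p) :
  (p <= #|D| + \rank (famker D c))%N.
Proof.
by have := rank_fammx D c; have := rank_leq_col (fammx D c); lia.
Qed.

(** Sylvester's rank inequality: the hypothesis says that the product of the
    matrices of the two families vanishes, so that their ranks sum to at most
    [#|D|]. *)
Lemma famker_card_orth p q (D : {set I}) (c : I -> 'cV[F]_p) (d : I -> 'cV[F]_q) :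
  (forall (u : 'rV_p) (w : 'rV_q),
      \sum_(l in D) (u *m c l) 0 0 * (w *m d l) 0 0 = 0) ->
  (p + q <= #|D| + \rank (famker D c) + \rank (famker D d))%N.
Proof.
move=> ortho; have : fammx D c *m (fammx D d)^T = 0.
  rewrite mul_fammx; apply/matrixP => i j; rewrite summxE mxE.
  rewrite -[RHS](ortho (delta_mx 0 i) (delta_mx 0 j)).
  by apply: eq_bigr => l _; rewrite -!rowE !mxE big_ord1 !mxE.
move=> /mulmx0_rank_max; rewrite mxrank_tr.
by have := rank_fammx D c; have := rank_fammx D d; lia.
Qed.

Lemma famker_rank_le p q (D : {set I}) (c : I -> 'cV[F]_p) (K : 'M[F]_(q, p)) :
  (forall u : 'rV_p, (forall l, l \in D -> u *m c l = 0) -> (u <= K)%MS) ->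
  (\rank (famker D c) <= \rank K)%N.
Proof.
move=> H; apply/mxrankS/row_subP => i; apply: H => l lD.
by move: (row_sub i (famker D c)) => /famkerP; apply.
Qed.

Lemma famker_rank0 p (D : {set I}) (c : I -> 'cV[F]_p) :
  (forall u : 'rV_p, (forall l, l \in D -> u *m c l = 0) -> u = 0) ->
  \rank (famker D c) = 0%N.
Proof.
move=> H; apply/eqP; rewrite -leqn0 -(mxrank0 F p p).
by apply: famker_rank_le => u /H ->; apply: sub0mx.
Qed.

(** The kernels of the families [D :\: C] all contain the kernel of [D], and are
    independent modulo it: a vector killed by [D :\: C] and in the sum of the
    other ones is killed by [C] as well. *)
Lemma famker_partition p (P : {set {set I}}) (D : {set I}) (c : I -> 'cV[F]_p) :
  partition P D ->
  (\sum_(C in P) \rank (famker (D :\: C) c) + \rank (famker D c) <=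
   p + #|P| * \rank (famker D c))%N.
Proof.
move=> partP; pose K C := famker (D :\: C) c.
have tiP : trivIset P by case/and3P: partP.
have step (s : seq {set I}) : uniq s -> {subset s <= P} ->
    (\sum_(C <- s) \rank (K C) + \rank (famker D c) <=
     \rank (\sum_(C <- s) K C + famker D c)%MS + size s * \rank (famker D c))%N.
  elim: s => [|C s IHs] /= => [_ _|/andP[CNs uniq_s] sP].
    by rewrite !big_nil /= adds0mx; lia.
  have CP : C \in P by apply: sP; rewrite mem_head.
  have {}sP : {subset s <= P} by move=> X Xs; apply: sP; rewrite in_cons Xs orbT.
  have {}IHs := IHs uniq_s sP; rewrite !big_cons -addsmxA.
  set X := (\sum_(C <- s) K C + famker D c)%MS in IHs *.
  have : (K C :&: X <= famker D c)%MS.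
    apply/famkerP => l lD; have [lC|lNC] := boolP (l \in C); last first.
      have /famkerP := capmxSl (K C) X; apply.
      by rewrite inE lNC.
    apply/sub_kermxP; apply: submx_trans (capmxSr _ _) _.
    rewrite /X addsmx_sub; apply/andP; split; last first.
      by apply/sub_kermxP; have /famkerP := submx_refl (famker D c); apply.
    rewrite big_seq; elim/big_rec: _ => [|C' Y C's sY]; first exact: sub0mx.
    rewrite addsmx_sub sY andbT; apply/sub_kermxP.
    have /famkerP := submx_refl (K C'); apply; rewrite inE lD andbT.
    have neq_C : C' != C by apply: contraNneq CNs => <-.
    rewrite eq_sym in neq_C.
    by rewrite (disjointFr (trivIsetP tiP C C' CP (sP _ C's) neq_C) lC).
  by move/mxrankS; have := mxrank_sum_cap (K C) X; lia.
have sP : {subset enum P <= P} by move=> C; rewrite mem_enum.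
rewrite -big_enum; apply: leq_trans (step _ (enum_uniq P) sP) _; rewrite -cardE.
by rewrite leq_add2r rank_leq_row.
Qed.
End Families.

(** * The trace pairing and bilinear forms in dimension two *)

Lemma ord2P (i : 'I_2) : {i = 0} + {i = 1}.
Proof. by case: i => [[|[|]]] // lt_i; [left|right]; apply: val_inj. Qed.

Lemma lift2 : lift ord0 ord0 = 1 :> 'I_2. Proof. exact: val_inj. Qed.

Lemma ord0_2 : ord0 = 0 :> 'I_2. Proof. exact: val_inj. Qed.

Section Dot.
Variable F : fieldType.

Definition dot m n (B C : 'M[F]_(m, n)) : F := \tr (B^T *m C).

Lemma dotE m n (B C : 'M[F]_(m, n)) : dot B C = \sum_i \sum_j B i j * C i j.
Proof.
rewrite /dot /mxtrace exchange_big /=; apply: eq_bigr => j _.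
by rewrite mxE; apply: eq_bigr => i _; rewrite mxE.
Qed.

Lemma dotC m n (B C : 'M[F]_(m, n)) : dot B C = dot C B.
Proof. by rewrite !dotE; under eq_bigr do under eq_bigr do rewrite mulrC. Qed.

Lemma dotDr m n (B C D : 'M[F]_(m, n)) : dot B (C + D) = dot B C + dot B D.
Proof. by rewrite /dot mulmxDr mxtraceD. Qed.

Lemma dotZr m n k (B C : 'M[F]_(m, n)) : dot B (k *: C) = k * dot B C.
Proof. by rewrite /dot -scalemxAr mxtraceZ. Qed.

Lemma dot0r m n (B : 'M[F]_(m, n)) : dot B 0 = 0.
Proof. by rewrite /dot mulmx0 mxtrace0. Qed.

Lemma dot_tr m n (B C : 'M[F]_(m, n)) : dot B^T C^T = dot B C.
Proof. by rewrite /dot trmxK mxtrace_mulC -mxtrace_tr trmx_mul trmxK. Qed.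

Lemma dot_nondeg m n (B : 'M[F]_(m, n)) : (forall C, dot C B = 0) -> B = 0.
Proof.
move=> H; apply/matrixP => i j; rewrite mxE -(H (delta_mx i j)) dotE.
rewrite (bigD1 i) //= [X in _ + X]big1 ?addr0; last first.
  by move=> k ne_k; apply: big1 => l _; rewrite mxE (negbTE ne_k) mul0r.
rewrite (bigD1 j) //= big1 ?addr0 ?mxE ?eqxx ?mul1r //.
by move=> k ne_k; rewrite mxE (negbTE ne_k) andbF mul0r.
Qed.

Lemma dot_rank1 m n (B : 'M[F]_(m, n)) (v : 'cV_m) (u : 'rV_n) :
  dot B (v *m u) = (u *m (B^T *m v)) 0 0.
Proof. by rewrite /dot mulmxA mxtrace_mulC /mxtrace big_ord1. Qed.

Definition bil m n (a : 'cV[F]_m) (B : 'M[F]_(m, n)) (b : 'cV[F]_n) : F :=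
  (a^T *m B *m b) 0 0.

Lemma bil_dot m n (a : 'cV[F]_m) (B : 'M[F]_(m, n)) (b : 'cV[F]_n) :
  bil a B b = dot B (a *m b^T).
Proof.
rewrite dot_rank1 /bil.
have -> : b^T *m (B^T *m a) = (a^T *m B *m b)^T by rewrite !trmx_mul trmxK.
by rewrite [RHS]mxE.
Qed.

(** The quarter turn: [perp b] spans the vectors orthogonal to [b]. *)
Definition perp (b : 'cV[F]_2) : 'cV[F]_2 :=
  \col_i (if i == 0 then - b 1 0 else b 0 0).

Lemma cv2P (z : 'cV[F]_2) : z 0 0 = 0 -> z 1 0 = 0 -> z = 0.
Proof.
move=> z0 z1; apply/colP => i; rewrite [RHS]mxE.
by case: (ord2P i) => ->.
Qed.

Lemma cv2_neq0 (z : 'cV[F]_2) : (z != 0) = (z 0 0 != 0) || (z 1 0 != 0).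
Proof.
rewrite -negb_and; congr (~~ _); apply/eqP/andP => [->|[/eqP z0 /eqP z1]].
  by rewrite !mxE.
exact: cv2P.
Qed.

Lemma bil2E (a : 'cV[F]_2) (B : 'M[F]_2) (b : 'cV[F]_2) :
  bil a B b = a 0 0 * B 0 0 * b 0 0 + a 0 0 * B 0 1 * b 1 0 +
              a 1 0 * B 1 0 * b 0 0 + a 1 0 * B 1 1 * b 1 0.
Proof.
rewrite /bil !mxE !big_ord_recl !big_ord0 !mxE !big_ord_recl !big_ord0 !mxE.
by rewrite lift2 ord0_2; ring.
Qed.

Lemma dot2E (A B : 'M[F]_2) :
  dot A B = A 0 0 * B 0 0 + A 0 1 * B 0 1 + A 1 0 * B 1 0 + A 1 1 * B 1 1.
Proof.
rewrite dotE !big_ord_recl !big_ord0.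
by rewrite lift2 ord0_2; ring.
Qed.

Lemma mul_cv2E m (B : 'M[F]_(m, 2)) (b : 'cV[F]_2) i :
  (B *m b) i 0 = B i 0 * b 0 0 + B i 1 * b 1 0.
Proof.
rewrite mxE !big_ord_recl !big_ord0 addr0.
by rewrite lift2 ord0_2.
Qed.

Lemma perpE0 (b : 'cV[F]_2) : perp b 0 0 = - b 1 0. Proof. by rewrite mxE. Qed.
Lemma perpE1 (b : 'cV[F]_2) : perp b 1 0 = b 0 0. Proof. by rewrite mxE. Qed.

Lemma perp_neq0 (b : 'cV[F]_2) : b != 0 -> perp b != 0.
Proof. by rewrite !cv2_neq0 perpE0 perpE1 oppr_eq0 orbC. Qed.

Lemma exists_dual (v : 'cV[F]_2) : v != 0 ->
  exists w : 'cV[F]_2, w 0 0 * v 0 0 + w 1 0 * v 1 0 = 1.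
Proof.
rewrite cv2_neq0 => /orP[nz|nz].
  by exists (\col_i (if i == 0 then (v 0 0)^-1 else 0)); rewrite !mxE /= mul0r addr0 mulVf.
by exists (\col_i (if i == 0 then 0 else (v 1 0)^-1)); rewrite !mxE /= mul0r add0r mulVf.
Qed.

End Dot.

(** * Decompositions of 2 x 2 by 2 x n products and tangent planes *)

(** A decomposition of the bilinear product of a 2 x 2 matrix [A] by a 2 x n
    matrix [x], read through the forms [y] on the result. *)
Definition mm_decomp (F : fieldType) (I : finType) n (f : I -> 'M[F]_2)
    (g h : I -> 'M[F]_(2, n)) : Prop :=
  forall A x y, \sum_l dot (f l) A * dot (g l) x * dot (h l) y = dot y (A *m x).

(** The cyclic and transposition symmetries of the tensor combine into one that
    keeps the factor [f] and exchanges [g] and [h]: every statement on [f b] and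
    [g] has a dual on [f^T a] and [h]. *)
Lemma mm_decomp_tr (F : fieldType) (I : finType) n (f : I -> 'M[F]_2)
    (g h : I -> 'M[F]_(2, n)) :
  mm_decomp f g h -> mm_decomp (fun l => (f l)^T) h g.
Proof.
move=> dec A x y.
have -> : dot y (A *m x) = dot x (A^T *m y).
  by rewrite /dot -mxtrace_tr !trmx_mul !trmxK mulmxA.
rewrite -dec; apply: eq_bigr => l _; rewrite mulrAC.
by rewrite -{1}[A]trmxK dot_tr.
Qed.

Section Decomposition.
Variables (F : fieldType) (I : finType) (n : nat).
Variables (f : I -> 'M[F]_2) (g h : I -> 'M[F]_(2, n)).
Hypothesis dec : mm_decomp f g h.

(** The vector of [dot (k l) (v *m u)] as a linear form in [u]; see [dot_slice]. *)
Definition slice (k : I -> 'M[F]_(2, n)) (v : 'cV[F]_2) (l : I) : 'cV[F]_n :=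
  (k l)^T *m v.

Lemma dot_slice k (v : 'cV[F]_2) (u : 'rV[F]_n) l :
  dot (k l) (v *m u) = (u *m slice k v l) 0 0.
Proof. by rewrite dot_rank1. Qed.

Lemma mx11_eq0 (M : 'M[F]_1) : M 0 0 = 0 -> M = 0.
Proof. by move=> M0; apply/matrixP => i j; rewrite !ord1 mxE. Qed.

Lemma rank1_eq0 (z : 'cV[F]_2) (u : 'rV[F]_n) : z != 0 -> z *m u = 0 -> u = 0.
Proof.
move=> nz_z /matrixP zu0; apply/rowP => j; rewrite mxE.
have E i : z i 0 * u 0 j = 0 by have := zu0 i j; rewrite mxE big_ord1 mxE.
move: nz_z; rewrite cv2_neq0 => /orP[] nz.
  by have /eqP := E 0; rewrite mulf_eq0 (negbTE nz) => /eqP.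
by have /eqP := E 1; rewrite mulf_eq0 (negbTE nz) => /eqP.
Qed.

Lemma mul_rank1 (z : 'cV[F]_2) (w v : 'cV[F]_2) (u : 'rV[F]_n) :
  (z *m w^T) *m (v *m u) = (w 0 0 * v 0 0 + w 1 0 * v 1 0) *: (z *m u).
Proof.
rewrite !mulmxA -[z *m _ *m v]mulmxA scalemxAl; congr (_ *m u).
have -> : w^T *m v = (w 0 0 * v 0 0 + w 1 0 * v 1 0)%:M.
  by apply/matrixP => i j; rewrite !ord1 mul_cv2E !mxE eqxx mulr1n.
by rewrite mul_mx_scalar.
Qed.

(** A linear family [Phi] of outputs to which only the terms of [D] contribute
    takes its values in a space spanned by [#|D|] vectors. *)
Lemma count_inj p (D : {set I}) (c : I -> 'cV[F]_p) (Phi : 'rV[F]_p -> 'M[F]_(2, n)) :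
  (forall l, l \notin D -> c l = 0) ->
  (forall w y, \sum_l (w *m c l) 0 0 * dot (h l) y = dot y (Phi w)) ->
  (forall w, Phi w = 0 -> w = 0) -> (p <= #|D|)%N.
Proof.
move=> cD0 PhiE Phi_inj; have := famker_card D c.
rewrite famker_rank0 ?addn0 // => u uD0; apply: Phi_inj; apply: dot_nondeg => y.
rewrite -PhiE big1 // => l _; have [lD|lND] := boolP (l \in D).
  by rewrite uD0 // mxE mul0r.
by rewrite cD0 // mulmx0 mxE mul0r.
Qed.

(** The forms outside of the plane [a^T f b = 0], which is tangent to the quadric
    of singular matrices at [perp a *m (perp b)^T]. *)
Definition off (a b : 'cV[F]_2) : {set I} := [set l | bil a (f l) b != 0].

(** The rows [u] such that no term of [D] sees the input [v *m u]. *)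
Definition Uker k (D : {set I}) (v : 'cV[F]_2) : 'M[F]_n := famker D (slice k v).

Lemma UkerP k (D : {set I}) v (u : 'rV_n) :
  reflect (forall l, l \in D -> dot (k l) (v *m u) = 0) (u <= Uker k D v)%MS.
Proof.
apply: (iffP (famkerP _ _ _)) => H l lD; first by rewrite dot_slice H // mxE.
by apply: mx11_eq0; rewrite -dot_slice H.
Qed.

(** Take [A = a *m b^T], which only sees the terms outside of the plane.  It kills
    [perp b *m u], and its image is orthogonal to [perp a *m w]: so the 2n
    coordinates of an input and the n coordinates of [w] are orthogonal families
    indexed by these terms, whose kernels are those of [g] and [h]. *)
Lemma plane_card (a b : 'cV[F]_2) : a != 0 -> b != 0 ->
  (3 * n <= #|off a b| + \rank (Uker g (off a b) (perp b))
                       + \rank (Uker h (off a b) (perp a)))%N.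
Proof.
move=> nz_a nz_b; set D := off a b; set v := perp b; set phi := perp a.
have [w bw1] := exists_dual nz_b; pose N := a *m b^T.
have ND0 l : l \notin D -> dot (f l) N = 0.
  by rewrite inE negbK bil_dot => /eqP.
have Nv (u : 'rV[F]_n) : N *m (v *m u) = 0.
  by rewrite /N mul_rank1 /v perpE0 perpE1 mulrN mulrC addNr scale0r.
have Nw (u : 'rV[F]_n) : N *m (w *m u) = a *m u.
  by rewrite /N mul_rank1 [b 0 0 * _]mulrC [b 1 0 * _]mulrC bw1 scale1r.
pose c l := col_mx (slice g v l) (slice g w l).
pose d l := dot (f l) N *: slice h phi l.
have cE l (u1 u2 : 'rV_n) : (row_mx u1 u2 *m c l) 0 0 = dot (g l) (v *m u1 + w *m u2).
  by rewrite mul_row_col mxE -!dot_slice dotDr.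
have sumD (P : I -> F) : \sum_(l in D) dot (f l) N * P l = \sum_l dot (f l) N * P l.
  rewrite [RHS](bigID (mem D)) /= [X in _ = _ + X]big1 ?addr0 // => l lND.
  by rewrite ND0 // mul0r.
have ortho (u : 'rV_(n + n)) (w' : 'rV_n) :
    \sum_(l in D) (u *m c l) 0 0 * (w' *m d l) 0 0 = 0.
  have := dec N (v *m lsubmx u + w *m rsubmx u) (phi *m w').
  rewrite mulmxDr Nv Nw add0r.
  have -> : dot (phi *m w') (a *m rsubmx u) = 0.
    rewrite /dot trmx_mul mulmxA -[_ *m phi^T *m a]mulmxA.
    have -> : phi^T *m a = 0.
      by apply: mx11_eq0; rewrite mul_cv2E !mxE /= mulNr mulrC addNr.
    by rewrite mulmx0 mul0mx mxtrace0.
  move=> E0; rewrite -[RHS]E0 [RHS](bigID (mem D)) /= [X in _ = _ + X]big1 ?addr0; last first.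
    by move=> l lND; rewrite ND0 // !mul0r.
  apply: eq_bigr => l _; rewrite -cE hsubmxK.
  have -> : (w' *m d l) 0 0 = dot (f l) N * dot (h l) (phi *m w').
    by rewrite dot_slice /d -scalemxAr mxE.
  by rewrite mulrCA mulrA.
have := famker_card_orth ortho.
have rc : (\rank (famker D c) <= \rank (Uker g D v))%N.
  have H : (famker D c <= row_mx (Uker g D v) 0)%MS.
    apply/row_subP => i; set u := row i _; rewrite -[u]hsubmxK.
    have uc l : l \in D -> dot (g l) (v *m lsubmx u + w *m rsubmx u) = 0.
      move=> lD; rewrite -cE hsubmxK.
      by have /famkerP -> := row_sub i (famker D c); rewrite ?mxE.
    have u2 : rsubmx u = 0.
      apply: (rank1_eq0 nz_a); rewrite -Nw; apply: dot_nondeg => y.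
      rewrite -[LHS]add0r -[X in X + _](dot0r y) -(Nv (lsubmx u)) -dotDr -mulmxDr.
      rewrite -dec big1 // => l _; have [lD|lND] := boolP (l \in D).
        by rewrite uc // mulr0 mul0r.
      by rewrite ND0 // !mul0r.
    have : (lsubmx u <= Uker g D v)%MS.
      by apply/UkerP => l lD; have := uc l lD; rewrite u2 mulmx0 addr0.
    by case/submxP => M ->; apply/submxP; exists M; rewrite mul_mx_row mulmx0 u2.
  apply: leq_trans (mxrankS H) _.
  have -> : row_mx (Uker g D v) 0 = Uker g D v *m row_mx 1%:M (0 : 'M_(n, n)).
    by rewrite mul_mx_row mulmx1 mulmx0.
  exact: mxrankM_maxl.
have rd : (\rank (famker D d) <= \rank (Uker h D phi))%N.
  apply: famker_rank_le => u ud; apply/famkerP => l lD.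
  have /eqP := ud l lD; rewrite /d -scalemxAr scaler_eq0 => /orP[|/eqP //].
  by move: lD; rewrite inE bil_dot => /negbTE ->.
lia.
Qed.

(** Otherwise [v *m u] would be a nonzero input with zero output. *)
Lemma annihilates_eq0 (A0 : 'M[F]_2) (v : 'cV[F]_2) (u : 'rV[F]_n) :
  A0 *m v != 0 -> (forall l, dot (f l) A0 * dot (g l) (v *m u) = 0) -> u = 0.
Proof.
move=> nz_A0v H; apply: (rank1_eq0 nz_A0v); apply: dot_nondeg => y.
by rewrite -mulmxA -dec big1 // => l _; rewrite H mul0r.
Qed.
End Decomposition.

Lemma bil_tr (F : fieldType) (a b : 'cV[F]_2) (B : 'M[F]_2) :
  bil b B^T a = bil a B b.
Proof. by rewrite !bil2E !mxE; ring. Qed.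

Lemma off_tr (F : fieldType) (I : finType) (f : I -> 'M[F]_2) a b :
  off (fun l => (f l)^T) b a = off f a b.
Proof. by apply/setP => l; rewrite !inE bil_tr. Qed.

Section Tangent.
Variables (F : fieldType) (I : finType) (n : nat).
Variables (f : I -> 'M[F]_2) (g h : I -> 'M[F]_(2, n)).
Hypothesis dec : mm_decomp f g h.

(** On the kernels of the terms outside of the plane, only the terms of the plane
    contribute; [perp a] and [perp b] being conjugate for [A0], the products of
    these inputs and outputs vanish, and [famker_card_orth] applies to the terms
    of the plane that do not vanish at [A0]. *)
Lemma tangent_card (a b : 'cV[F]_2) (A0 : 'M[F]_2) :
  a != 0 -> b != 0 -> A0 \in unitmx -> bil (perp a) A0 (perp b) = 0 ->
  (\rank (Uker g (off f a b) (perp b)) + \rank (Uker h (off f a b) (perp a)) <=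
   #|[set l | (l \notin off f a b) && (dot (f l) A0 != 0)%R]|)%N.
Proof.
move=> nz_a nz_b uA0 tangent; set v := perp b; set phi := perp a.
set K := Uker g _ v; set K' := Uker h _ phi; set D := [set l | _].
have nz_v : v != 0 by apply: perp_neq0.
have nz_phi : phi != 0 by apply: perp_neq0.
have nz_A0v : A0 *m v != 0.
  by apply: contra nz_v => /eqP A0v; rewrite -(mulKmx uA0 v) A0v mulmx0.
have nz_A0phi : A0^T *m phi != 0.
  rewrite -unitmx_tr in uA0.
  by apply: contra nz_phi => /eqP A0v; rewrite -(mulKmx uA0 phi) A0v mulmx0.
pose c l := row_base K *m slice g v l.
pose d l := dot (f l) A0 *: (row_base K' *m slice h phi l).
have cE (u : 'rV_(\rank K)) l : (u *m c l) 0 0 = dot (g l) (v *m (u *m row_base K)).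
  by rewrite dot_slice mulmxA.
have dE (u : 'rV_(\rank K')) l :
    (u *m d l) 0 0 = dot (f l) A0 * dot (h l) (phi *m (u *m row_base K')).
  by rewrite dot_slice /d -scalemxAr mxE mulmxA.
have offK (u : 'rV_(\rank K)) l : l \in off f a b -> (u *m c l) 0 0 = 0.
  move=> l_off; rewrite cE.
  have : (u *m row_base K <= K)%MS by rewrite (submx_trans (submxMl _ _)) ?eq_row_base.
  by move/UkerP; apply.
have offK' (u : 'rV_(\rank K')) l : l \in off f a b ->
    dot (h l) (phi *m (u *m row_base K')) = 0.
  move=> l_off.
  have : (u *m row_base K' <= K')%MS by rewrite (submx_trans (submxMl _ _)) ?eq_row_base.
  by move/UkerP; apply.
have notD l : l \notin D -> l \in off f a b \/ dot (f l) A0 = 0.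
  rewrite inE negb_and !negbK => /orP[->|/eqP ->]; by [left|right].
have ortho (u : 'rV_(\rank K)) (w : 'rV_(\rank K')) :
    \sum_(l in D) (u *m c l) 0 0 * (w *m d l) 0 0 = 0.
  have := dec A0 (v *m (u *m row_base K)) (phi *m (w *m row_base K')).
  have -> : dot (phi *m (w *m row_base K')) (A0 *m (v *m (u *m row_base K))) = 0.
    have /mx11_eq0 tg : (phi^T *m A0 *m v) 0 0 = 0 by exact: tangent.
    rewrite /dot trmx_mul -mulmxA [phi^T *m _]mulmxA [phi^T *m A0 *m _]mulmxA tg.
    by rewrite mul0mx mulmx0 mxtrace0.
  move=> E0; rewrite -[RHS]E0 [RHS](bigID (mem D)) /= [X in _ = _ + X]big1 ?addr0; last first.
    move=> l /notD[l_off|->]; last by rewrite !mul0r.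
    by rewrite -cE offK // mulr0 mul0r.
  by apply: eq_bigr => l _; rewrite dE cE mulrCA mulrA.
have := famker_card_orth ortho.
have inj_base m (M : 'M[F]_(m, n)) (u : 'rV_(\rank M)) : u *m row_base M = 0 -> u = 0.
  by move=> uM; apply: (row_free_inj (row_base_free M)); rewrite uM mul0mx.
rewrite (famker_rank0 (c := c)); last first.
  move=> u uc; apply: inj_base; apply: (annihilates_eq0 dec nz_A0v) => l.
  have [/uc|/notD[l_off|->]] := boolP (l \in D); last by rewrite mul0r.
    by rewrite -cE => ->; rewrite mxE mulr0.
  by rewrite -cE offK // mulr0.
rewrite (famker_rank0 (c := d)) ?addn0 //.
move=> u ud; apply: inj_base; apply: (annihilates_eq0 (mm_decomp_tr dec) nz_A0phi) => l.
rewrite dot_tr -dE.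
have [/ud ->|/notD[l_off|l0]] := boolP (l \in D); first by rewrite mxE.
  by rewrite dE offK' // mulr0.
by rewrite dE l0 mul0r.
Qed.

(** The forms of the plane [a^T f b = 0] that vanish at [A0] lie on a line through
    the point of tangency, and this line is not one of the two rulings since
    [A0] is invertible.  The kernels cancel between [plane_card] and
    [tangent_card]. *)
Lemma tangent_line_card (a b : 'cV[F]_2) (A0 : 'M[F]_2) :
  a != 0 -> b != 0 -> A0 \in unitmx -> bil (perp a) A0 (perp b) = 0 ->
  (3 * n + #|[set l | (bil a (f l) b == 0)%R && (dot (f l) A0 == 0)%R]| <= #|I|)%N.
Proof.
move=> nz_a nz_b uA0 tangent.
have := plane_card dec nz_a nz_b; have := tangent_card nz_a nz_b uA0 tangent.
set O := off f a b; set D := [set l | _]; set E := [set l | _].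
have : (#|O| + #|D| + #|E| = #|I|)%N.
  rewrite -(cardsC O) -addnA; congr (_ + _)%N.
  rewrite -(cardsID [set l | dot (f l) A0 == 0] (~: O)) addnC.
  by congr (_ + _)%N; apply: eq_card => l; rewrite !inE ?negbK // andbC.
lia.
Qed.
End Tangent.

(** * Tangent lines and the bound 3n + 1 *)

Section Plane.
Variable F : fieldType.
Implicit Types (a b c w v : 'cV[F]_2) (A B : 'M[F]_2).

Lemma det2E A : \det A = A 0 0 * A 1 1 - A 0 1 * A 1 0.
Proof.
rewrite (expand_det_row _ 0) !big_ord_recl big_ord0 addr0 /cofactor !det_mx11 !mxE /=.
rewrite !lift2 !ord0_2 /= expr0 expr1 mul1r mulN1r mulrN.
by congr (_ * A _ _ - _ * A _ _); apply: val_inj.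
Qed.

Lemma mul2_eq0 B b : B *m b = 0 ->
  B 0 0 * b 0 0 + B 0 1 * b 1 0 = 0 /\ B 1 0 * b 0 0 + B 1 1 * b 1 0 = 0.
Proof. by move=> /colP Bb; split; rewrite -mul_cv2E Bb mxE. Qed.

(** The excluded case is the one of a point of the tangent plane that is on exactly
    one of the two rulings through the point of tangency: the line that joins
    them is then contained in the quadric. *)
Lemma exists_tangent B a b : a != 0 -> b != 0 -> bil a B b = 0 ->
  (B *m b == 0) = (B^T *m a == 0) ->
  exists A, [/\ A \in unitmx, bil (perp a) A (perp b) = 0 & dot B A = 0].
Proof.
move=> nz_a nz_b aBb side.
have [w] := exists_dual (perp_neq0 nz_b); have [c] := exists_dual (perp_neq0 nz_a).
rewrite !perpE0 !perpE1 => ca wb.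
suff [s nz_s Bs] : exists2 s, s != 0 & s * bil a B w + bil c B b = 0.
  exists (s *: (a *m w^T) + c *m b^T); split.
  - rewrite unitmxE unitfE det2E !mxE !big_ord1 !mxE.
    suff -> : (s * (a 0 0 * w 0 0) + c 0 0 * b 0 0) * (s * (a 1 0 * w 1 0) + c 1 0 * b 1 0) -
      (s * (a 0 0 * w 1 0) + c 0 0 * b 1 0) * (s * (a 1 0 * w 0 0) + c 1 0 * b 0 0) =
      - s * (c 0 0 * - a 1 0 + c 1 0 * a 0 0) * (w 0 0 * - b 1 0 + w 1 0 * b 0 0).
      by rewrite ca wb !mulr1 oppr_eq0.
    by ring.
  - by rewrite bil2E !perpE0 !perpE1 !mxE !big_ord1 !mxE; ring.
  by rewrite dotDr dotZr -!bil_dot.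
have [Bb0|nBb0] := eqVneq (B *m b) 0.
  exists 1; rewrite ?oner_eq0 // mul1r.
  have /eqP/mul2_eq0[] : B^T *m a == 0 by rewrite -side Bb0.
  have [] := mul2_eq0 Bb0; rewrite !bil2E !mxE => b0 b1 a0 a1.
  have -> : 0 = w 0 0 * (B 0 0 * a 0 0 + B 1 0 * a 1 0) + w 1 0 * (B 0 1 * a 0 0 + B 1 1 * a 1 0)
     + c 0 0 * (B 0 0 * b 0 0 + B 0 1 * b 1 0) + c 1 0 * (B 1 0 * b 0 0 + B 1 1 * b 1 0).
    by rewrite a0 a1 b0 b1 !mulr0 !addr0.
  by ring.
have nz_cBb : bil c B b != 0.
  apply: contra nBb0 => /eqP cBb; apply/eqP/cv2P; rewrite mul_cv2E.
    rewrite -[LHS]mulr1 -ca.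
    have -> : (B 0 0 * b 0 0 + B 0 1 * b 1 0) * (c 0 0 * - a 1 0 + c 1 0 * a 0 0) =
      c 1 0 * bil a B b - a 1 0 * bil c B b by rewrite !bil2E; ring.
    by rewrite aBb cBb !mulr0 subr0.
  rewrite -[LHS]mulr1 -ca.
  have -> : (B 1 0 * b 0 0 + B 1 1 * b 1 0) * (c 0 0 * - a 1 0 + c 1 0 * a 0 0) =
    a 0 0 * bil c B b - c 0 0 * bil a B b by rewrite !bil2E; ring.
  by rewrite aBb cBb !mulr0 subr0.
have nz_aBw : bil a B w != 0.
  have : B^T *m a != 0 by rewrite -side.
  apply: contra => /eqP aBw; apply/eqP/cv2P; rewrite mul_cv2E !mxE.
    rewrite -[LHS]mulr1 -wb.
    have -> : (B 0 0 * a 0 0 + B 1 0 * a 1 0) * (w 0 0 * - b 1 0 + w 1 0 * b 0 0) =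
      w 1 0 * bil a B b - b 1 0 * bil a B w by rewrite !bil2E; ring.
    by rewrite aBb aBw !mulr0 subr0.
  rewrite -[LHS]mulr1 -wb.
  have -> : (B 0 1 * a 0 0 + B 1 1 * a 1 0) * (w 0 0 * - b 1 0 + w 1 0 * b 0 0) =
    b 0 0 * bil a B w - w 0 0 * bil a B b by rewrite !bil2E; ring.
  by rewrite aBb aBw !mulr0 subr0.
exists (- bil c B b / bil a B w); first by rewrite mulf_neq0 ?oppr_eq0 ?invr_eq0.
by rewrite mulfVK // addNr.
Qed.

Lemma det0_kernel B : \det B = 0 -> exists2 b : 'cV[F]_2, b != 0 & B *m b = 0.
Proof.
rewrite -det_tr => /eqP/det0P[u nz_u uB]; exists u^T.
  by apply: contra nz_u => /eqP uT; rewrite -[u]trmxK uT trmx0.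
by rewrite -[LHS]trmxK trmx_mul trmxK uB trmx0.
Qed.

Lemma det_neq0_inj B b : \det B != 0 -> B *m b = 0 -> b = 0.
Proof.
by rewrite -unitfE -unitmxE => uB Bb; rewrite -(mulKmx uB b) Bb mulmx0.
Qed.

Lemma cv2_exists_neq0 : exists b : 'cV[F]_2, b != 0.
Proof. by exists (const_mx 1); rewrite cv2_neq0 !mxE oner_eq0. Qed.

Lemma bil_perp B b : bil (perp (B *m b)) B b = 0.
Proof. by rewrite bil2E !perpE0 !perpE1 !mul_cv2E; ring. Qed.

(** Both conditions say that [B] is a multiple of [perp a *m (perp b)^T], the point
    of tangency. *)
Lemma tangent_dot0 B a b A : a != 0 -> b != 0 ->
  B *m b = 0 -> B^T *m a = 0 -> bil (perp a) A (perp b) = 0 -> dot B A = 0.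
Proof.
move=> nz_a nz_b /mul2_eq0[fib0 fib1] /mul2_eq0[].
have [w] := exists_dual (perp_neq0 nz_b); have [c] := exists_dual (perp_neq0 nz_a).
rewrite bil2E dot2E !perpE0 !perpE1 !mxE => ca wb fia0 fia1 tang.
rewrite -[LHS]mulr1 -ca -[LHS]mulr1 -wb.
transitivity (bil c B w * (- a 1 0 * A 0 0 * - b 1 0 + - a 1 0 * A 0 1 * b 0 0 +
    a 0 0 * A 1 0 * - b 1 0 + a 0 0 * A 1 1 * b 0 0) +
  (w 0 0 * - b 1 0 + w 1 0 * b 0 0) *
    ((B 0 0 * a 0 0 + B 1 0 * a 1 0) * (c 1 0 * A 0 0 - c 0 0 * A 1 0) +
     (B 0 1 * a 0 0 + B 1 1 * a 1 0) * (c 1 0 * A 0 1 - c 0 0 * A 1 1)) +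
  (c 0 0 * (B 0 0 * b 0 0 + B 0 1 * b 1 0) + c 1 0 * (B 1 0 * b 0 0 + B 1 1 * b 1 0)) *
    (- a 1 0 * (A 0 0 * w 1 0 - A 0 1 * w 0 0) + a 0 0 * (A 1 0 * w 1 0 - A 1 1 * w 0 0))).
  by rewrite bil2E; ring.
by rewrite tang fia0 fia1 fib0 fib1 !(mulr0, mul0r, addr0).
Qed.

(** A singular form is the point of tangency of its own tangent plane; an
    invertible one is on no line of the quadric, and any tangent plane through
    it will do. *)
Lemma exists_flag B : exists a b : 'cV[F]_2, [/\ a != 0, b != 0, bil a B b = 0 &
  (B *m b == 0) = (B^T *m a == 0)].
Proof.
have [dB|nz_dB] := eqVneq (\det B) 0.
  have [b nz_b Bb] := det0_kernel dB.
  have [|a nz_a Ba] := @det0_kernel B^T; first by rewrite det_tr.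
  exists a, b; split=> //; last by rewrite Bb Ba.
  by rewrite /bil -mulmxA Bb mulmx0 mxE.
have [b nz_b] := cv2_exists_neq0.
have nz_Bb : B *m b != 0 by apply: contra nz_b => /eqP/(det_neq0_inj nz_dB) ->.
exists (perp (B *m b)), b; split=> //; [exact: perp_neq0|exact: bil_perp|].
rewrite (negbTE nz_Bb); apply/esym/negbTE.
apply: contra (perp_neq0 nz_Bb) => /eqP H; apply/eqP.
by apply: (det_neq0_inj _ H); rewrite det_tr.
Qed.
End Plane.

Section Rank.
Variables (F : fieldType) (I : finType) (n : nat).
Variables (f : I -> 'M[F]_2) (g h : I -> 'M[F]_(2, n)).
Hypothesis dec : mm_decomp f g h.
Implicit Types (a b : 'cV[F]_2) (A : 'M[F]_2).

Definition on_line a b A : {set I} :=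
  [set l | (bil a (f l) b == 0) && (dot (f l) A == 0)].

(** A tangent line through one of the forms contributes at least one form to
    [tangent_line_card]. *)
Lemma rank_lower_bound : (0 < n)%N -> (3 * n < #|I|)%N.
Proof.
move=> n_gt0.
have [l|noI] := pickP (fun _ : I => true); last first.
  pose x : 'M[F]_(2, n) := const_mx 1.
  have x0 : x = 0.
    apply: dot_nondeg => y; have := dec 1%:M x y.
    by rewrite mul1mx => <-; rewrite big1 // => l; have := noI l.
  have /matrixP/(_ 0 (Ordinal n_gt0)) := x0.
  by rewrite !mxE => /eqP; rewrite oner_eq0.
move=> _; have [a [b [nz_a nz_b ab0 side]]] := exists_flag (f l).
have [A [uA tang fA]] := exists_tangent nz_a nz_b ab0 side.
have := tangent_line_card dec nz_a nz_b uA tang.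
have : l \in on_line a b A by rewrite inE ab0 fA !eqxx.
rewrite (cardD1 l) => -> ; lia.
Qed.

Hypothesis rankI : #|I| = (3 * n).+1.

(** When the rank is [3n + 1], [tangent_line_card] leaves at most one form on each
    tangent line. *)
Lemma tangent_line_inj a b A i j : a != 0 -> b != 0 -> A \in unitmx ->
  bil (perp a) A (perp b) = 0 -> bil a (f i) b = 0 -> dot (f i) A = 0 ->
  bil a (f j) b = 0 -> dot (f j) A = 0 -> i = j.
Proof.
move=> nz_a nz_b uA tang ai Ai aj Aj.
have := tangent_line_card dec nz_a nz_b uA tang; rewrite rankI.
have -> : (3 * n).+1 = (3 * n + 1)%N by rewrite addn1.
rewrite leq_add2l => /card_le1_eqP H.
by apply: H; rewrite !inE ?ai ?Ai ?aj ?Aj eqxx.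
Qed.

(** A form that is a multiple of [f j] is on all tangent lines through [f j]. *)
Lemma form_independent i j :
  (forall A, dot (f j) A = 0 -> dot (f i) A = 0) -> i = j.
Proof.
move=> prop_ij; have [a [b [nz_a nz_b ab0 side]]] := exists_flag (f j).
have [A [uA tang fA]] := exists_tangent nz_a nz_b ab0 side.
apply: (tangent_line_inj nz_a nz_b uA tang) => //; last exact: prop_ij.
by rewrite bil_dot prop_ij // -bil_dot.
Qed.

(** A form of the tangent plane at [f i], on neither of the two lines of the
    quadric through [f i], would be joined to [f i] by a tangent line. *)
Lemma tangent_plane_point a b i l : a != 0 -> b != 0 ->
  f i *m b = 0 -> (f i)^T *m a = 0 -> bil a (f l) b = 0 ->
  f l *m b = 0 \/ (f l)^T *m a = 0.
Proof.
move=> nz_a nz_b fib fia ab0.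
have [->|nb] := eqVneq (f l *m b) 0; first by left.
have [->|na] := eqVneq ((f l)^T *m a) 0; first by right.
have [|A [uA tang fA]] := exists_tangent nz_a nz_b ab0.
  by rewrite (negbTE na) (negbTE nb).
exfalso; move: nb; suff <- : i = l by rewrite fib eqxx.
apply: (tangent_line_inj nz_a nz_b uA tang) => //.
  by rewrite /bil -mulmxA fib mulmx0 mxE.
exact: (tangent_dot0 nz_a nz_b).
Qed.
End Rank.

(** * Counting the forms in a tangent plane *)

(** The forms on the line [f b = 0] of the quadric. *)
Definition ruling (F : fieldType) (I : finType) (f : I -> 'M[F]_2) (b : 'cV[F]_2) : {set I} :=
  [set l | f l *m b == 0].

Section Count.
Variables (F : fieldType) (I : finType) (n : nat).
Variables (f : I -> 'M[F]_2) (g h : I -> 'M[F]_(2, n)).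
Hypothesis dec : mm_decomp f g h.
Implicit Types (a b v w : 'cV[F]_2) (A : 'M[F]_2).

Lemma row_base_inj m (M : 'M[F]_(m, n)) (u : 'rV_(\rank M)) :
  u *m row_base M = 0 -> u = 0.
Proof. by move=> uM; apply: (row_free_inj (row_base_free M)); rewrite uM mul0mx. Qed.

(** The outputs [A v u], for [u] in [U], are linearly independent along a basis of
    [U] and only use the terms of [D]. *)
Lemma count_one A v (U : 'M[F]_n) (D : {set I}) : A *m v != 0 ->
  (forall l, l \notin D -> (forall u : 'rV_n, (u <= U)%MS -> dot (g l) (v *m u) = 0) \/
     dot (f l) A = 0) ->
  (\rank U <= #|D|)%N.
Proof.
move=> nz_Av HD; pose c l := dot (f l) A *: (row_base U *m slice g v l).
have cE (u : 'rV_(\rank U)) l :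
    (u *m c l) 0 0 = dot (f l) A * dot (g l) (v *m (u *m row_base U)).
  by rewrite dot_slice /c -scalemxAr mxE mulmxA.
apply: (@count_inj F I n h _ D c (fun u => A *m (v *m (u *m row_base U)))).
- move=> l /HD[gl|fl]; last by rewrite /c fl scale0r.
  rewrite /c; suff -> : row_base U *m slice g v l = 0 by rewrite scaler0.
  apply/row_matrixP => i; rewrite row_mul row0; apply: mx11_eq0.
  rewrite -dot_slice gl //.
  by rewrite (submx_trans (row_sub _ _)) ?eq_row_base.
- by move=> u y; rewrite -dec; apply: eq_bigr => l _; rewrite cE.
move=> u; rewrite mulmxA => Au0; apply: row_base_inj.
exact: (rank1_eq0 nz_Av).
Qed.

(** The same as [count_one] with two matrices, whose outputs [e_0 u] and [e_1 u']
    are independent. *)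
Lemma count_two (A0 A1 : 'M[F]_2) v (U : 'M[F]_n) (D : {set I}) :
  A0 *m v = delta_mx 0 0 -> A1 *m v = delta_mx 1 0 ->
  (forall l, l \notin D -> (forall u : 'rV_n, (u <= U)%MS -> dot (g l) (v *m u) = 0) \/
     dot (f l) A0 = 0 /\ dot (f l) A1 = 0) ->
  (2 * \rank U <= #|D|)%N.
Proof.
move=> A0v A1v HD; pose s l := row_base U *m slice g v l.
pose c l := col_mx (dot (f l) A0 *: s l) (dot (f l) A1 *: s l).
have cE (u : 'rV_(\rank U + \rank U)) l :
    (u *m c l) 0 0 = dot (f l) A0 * dot (g l) (v *m (lsubmx u *m row_base U))
      + dot (f l) A1 * dot (g l) (v *m (rsubmx u *m row_base U)).
  have -> : u *m c l = lsubmx u *m (dot (f l) A0 *: s l) + rsubmx u *m (dot (f l) A1 *: s l).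
    by rewrite -mul_row_col hsubmxK.
  by rewrite !dot_slice /s -!scalemxAr !mulmxA !mxE.
rewrite mul2n -addnn.
apply: (@count_inj F I n h _ D c (fun u => A0 *m (v *m (lsubmx u *m row_base U))
   + A1 *m (v *m (rsubmx u *m row_base U)))).
- move=> l /HD[gl|[fl0 fl1]]; last by rewrite /c fl0 fl1 !scale0r col_mx0.
  rewrite /c; suff -> : s l = 0 by rewrite !scaler0 col_mx0.
  apply/row_matrixP => i; rewrite row_mul row0; apply: mx11_eq0.
  rewrite -dot_slice gl //.
  by rewrite (submx_trans (row_sub _ _)) ?eq_row_base.
- move=> u y; rewrite dotDr -!dec -big_split; apply: eq_bigr => l _.
  by rewrite cE mulrDl.
move=> u; rewrite !mulmxA A0v A1v => u0.
have E (i : 'I_2) j : (delta_mx 0 0 : 'cV_2) i 0 * (lsubmx u *m row_base U) 0 j +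
   (delta_mx 1 0 : 'cV_2) i 0 * (rsubmx u *m row_base U) 0 j = 0.
  by move/matrixP/(_ i j) : u0; rewrite -!mulmxA !mxE !big_ord1 !mxE.
rewrite -[u]hsubmxK (_ : lsubmx u = 0) 1?(_ : rsubmx u = 0) ?row_mx0 //.
  apply: row_base_inj; apply/rowP => j; rewrite [RHS]mxE -(E 1 j) [X in X * _ + _]mxE.
  by rewrite [X in _ + X * _]mxE mul0r add0r mul1r.
apply: row_base_inj; apply/rowP => j; rewrite [RHS]mxE -(E 0 j) [X in X * _ + _]mxE.
by rewrite [X in _ + X * _]mxE mul0r addr0 mul1r.
Qed.

Lemma pair_rank1 b w (u : 'cV[F]_2) : w 0 0 * b 0 0 + w 1 0 * b 1 0 = 1 ->
  (u *m w^T) *m b = u.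
Proof.
move=> wb; rewrite -mulmxA.
have -> : w^T *m b = 1%:M by apply/matrixP => i j; rewrite !ord1 mul_cv2E !mxE wb.
by rewrite mulmx1.
Qed.

(** The matrices [e_i b^T] vanish on the line [f b = 0]. *)
Lemma ruling_compl_card b : b != 0 -> (2 * n <= #|~: ruling f b|)%N.
Proof.
move=> nz_b; have [w wb] := exists_dual nz_b.
have bw : b 0 0 * w 0 0 + b 1 0 * w 1 0 = 1 by rewrite -wb; ring.
rewrite -[n in (2 * n)%N](mxrank1 F).
apply: (@count_two (delta_mx 0 0 *m b^T) (delta_mx 1 0 *m b^T) w); rewrite ?pair_rank1 //.
move=> l; rewrite !inE negbK => /eqP fb; right.
by rewrite -!bil_dot /bil -!mulmxA fb !mulmx0 mxE.
Qed.

(** Inputs [perp b *m u] with [u] in the kernel are only seen by the forms of the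
    line. *)
Lemma ruling_Uker_card b : b != 0 ->
  (2 * \rank (Uker g (~: ruling f b) (perp b)) <= #|ruling f b|)%N.
Proof.
move=> nz_b; have [w wb] := exists_dual (perp_neq0 nz_b).
apply: (@count_two (delta_mx 0 0 *m w^T) (delta_mx 1 0 *m w^T) (perp b)); rewrite ?pair_rank1 //.
by move=> l lNR; left => u /UkerP; apply; rewrite inE.
Qed.

(** Correcting [e w^T] by a multiple of [c b^T], where [c^T f b = 1] for the form
    [f l1], makes it vanish at this form without changing its value at [perp b];
    this saves one term. *)
Lemma plane_Uker_card a b l1 : b != 0 -> f l1 *m b != 0 -> bil a (f l1) b = 0 ->
  (2 * \rank (Uker g (off f a b) (perp b)) < #|~: off f a b|)%N.
Proof.
move=> nz_b nz_fb afb; have [w wb] := exists_dual (perp_neq0 nz_b).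
have [c cfb] := exists_dual nz_fb.
have l1_on : l1 \in ~: off f a b by rewrite !inE afb eqxx.
rewrite (cardsD1 l1) l1_on add1n ltnS.
pose A (e : 'cV_2) := e *m w^T - bil e (f l1) w *: (c *m b^T).
have Av e : A e *m perp b = e.
  rewrite /A mulmxBl pair_rank1 // -scalemxAl -mulmxA.
  have -> : b^T *m perp b = 0.
    by apply: mx11_eq0; rewrite mul_cv2E !mxE /=; ring.
  by rewrite mulmx0 scaler0 subr0.
have Al1 e : dot (f l1) (A e) = 0.
  rewrite /A dotDr -scaleNr dotZr -!bil_dot.
  have -> : bil c (f l1) b = 1.
    by rewrite -cfb !mul_cv2E bil2E; ring.
  by rewrite mulr1 subrr.
apply: (@count_two (A (delta_mx 0 0)) (A (delta_mx 1 0)) (perp b)); rewrite ?Av //.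
move=> l; rewrite !inE negb_and !negbK => /orP[/eqP->|l_off]; first by right.
by left => u /UkerP; apply; rewrite inE.
Qed.

(** By [tangent_plane_point], the forms of the tangent plane at [f i] lie on the two
    lines of the quadric through it, and [a w^T] vanishes on the line [f^T a = 0],
    to which [f i] itself belongs. *)
Lemma tangent_plane_Uker_card a b i : #|I| = (3 * n).+1 -> a != 0 -> b != 0 ->
  f i *m b = 0 -> (f i)^T *m a = 0 ->
  (\rank (Uker g (off f a b) (perp b)) < #|ruling f b|)%N.
Proof.
move=> rankI nz_a nz_b fib fia; have [w wb] := exists_dual (perp_neq0 nz_b).
have iR : i \in ruling f b by rewrite inE fib.
rewrite (cardsD1 i) iR add1n ltnS.
have fa0 l : (f l)^T *m a = 0 -> dot (f l) (a *m w^T) = 0.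
  by move=> fa; rewrite -bil_dot -bil_tr /bil -mulmxA fa mulmx0 mxE.
apply: (@count_one (a *m w^T) (perp b)); first by rewrite pair_rank1.
move=> l; rewrite !inE negb_and negbK => /orP[/eqP->|nfb]; first by right; apply: fa0.
have [afb|nafb] := eqVneq (bil a (f l) b) 0.
  right; apply: fa0.
  by have [E|//] := tangent_plane_point dec rankI nz_a nz_b fib fia afb; rewrite E eqxx in nfb.
by left => u /UkerP; apply; rewrite inE.
Qed.
End Count.

Section Parity.
Variables (F : fieldType) (I : finType) (n : nat).
Variables (f : I -> 'M[F]_2) (g h : I -> 'M[F]_(2, n)).
Hypothesis dec : mm_decomp f g h.
Hypothesis rankI : #|I| = (3 * n).+1.
Implicit Types (a b v w : 'cV[F]_2) (A : 'M[F]_2).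

(** The two bounds of [plane_Uker_card], for the plane and its dual, meet the one of
    [plane_card]. *)
Lemma plane_parity a b l1 l2 : a != 0 -> b != 0 ->
  f l1 *m b != 0 -> bil a (f l1) b = 0 -> (f l2)^T *m a != 0 -> bil a (f l2) b = 0 ->
  #|~: off f a b| = (2 * \rank (Uker g (off f a b) (perp b))).+1.
Proof.
move=> nz_a nz_b fb afb fa afb2.
have c1 := plane_Uker_card dec nz_b fb afb.
have c2 := @plane_Uker_card _ _ _ _ _ _ (mm_decomp_tr dec) b a l2 nz_a fa.
rewrite off_tr bil_tr in c2; have {}c2 := c2 afb2.
have := plane_card dec nz_a nz_b; have := cardsC (off f a b).
by rewrite rankI; lia.
Qed.

Lemma plane_card_bound a b l2 : a != 0 -> b != 0 ->
  (f l2)^T *m a != 0 -> bil a (f l2) b = 0 ->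
  (#|~: off f a b| <= (2 * \rank (Uker g (off f a b) (perp b))).+1)%N.
Proof.
move=> nz_a nz_b fa afb2.
have c2 := @plane_Uker_card _ _ _ _ _ _ (mm_decomp_tr dec) b a l2 nz_a fa.
rewrite off_tr bil_tr in c2; have {}c2 := c2 afb2.
have := plane_card dec nz_a nz_b; have := cardsC (off f a b).
by rewrite rankI; lia.
Qed.
End Parity.

(** * The planes through a line of the quadric *)

Section Parallel.
Variable F : fieldType.
Implicit Types (a b c w v z : 'cV[F]_2) (A B : 'M[F]_2).

Lemma bilZl s a B b : bil (s *: a) B b = s * bil a B b.
Proof. by rewrite !bil2E !mxE; ring. Qed.

Lemma bil_mul a B b : bil a B b = a 0 0 * (B *m b) 0 0 + a 1 0 * (B *m b) 1 0.
Proof. by rewrite bil2E !mul_cv2E; ring. Qed.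

(** In dimension two, vectors orthogonal to the same nonzero vector are parallel. *)
Lemma orth_perp a z : a != 0 -> z != 0 -> a 0 0 * z 0 0 + a 1 0 * z 1 0 = 0 ->
  exists2 s, s != 0 & a = s *: perp z.
Proof.
move=> nz_a nz_z az; have [w] := exists_dual (perp_neq0 nz_z); rewrite perpE0 perpE1 => wz.
suff E : a = (w 0 0 * a 0 0 + w 1 0 * a 1 0) *: perp z.
  exists (w 0 0 * a 0 0 + w 1 0 * a 1 0) => //.
  by apply: contra nz_a => /eqP s0; rewrite E s0 scale0r.
apply/colP => i; rewrite !mxE; case: (ord2P i) => -> /=.
  rewrite -[LHS]mulr1 -wz -[LHS]subr0 -[X in _ - X](mulr0 (w 1 0)) -az; ring.
rewrite -[LHS]mulr1 -wz -[LHS]addr0 -[X in _ + X](mulr0 (w 0 0)) -az; ring.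
Qed.

Lemma class_rep a B B' b : a != 0 -> B *m b != 0 -> bil a B b = 0 ->
  (bil a B' b == 0) = (bil (perp (B *m b)) B' b == 0).
Proof.
move=> nz_a nz_Bb; rewrite bil_mul => /(orth_perp nz_a nz_Bb)[s nz_s ->].
by rewrite bilZl mulf_eq0 (negbTE nz_s).
Qed.

Lemma tr_mul_eq0 a B b w : w 0 0 * perp b 0 0 + w 1 0 * perp b 1 0 = 1 ->
  bil a B b = 0 -> bil a B w = 0 -> B^T *m a = 0.
Proof.
rewrite perpE0 perpE1 => wb; rewrite !bil2E => ab aw; apply: cv2P; rewrite mul_cv2E !mxE.
  rewrite -[LHS]mulr1 -wb.
  transitivity (w 1 0 * 0 - b 1 0 * 0 : F); last by rewrite !mulr0 subr0.
  by rewrite -{1}ab -aw; ring.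
rewrite -[LHS]mulr1 -wb.
transitivity (b 0 0 * 0 - w 0 0 * 0 : F); last by rewrite !mulr0 subr0.
by rewrite -{1}aw -ab; ring.
Qed.

Lemma mx_neq0_mul B : B != 0 -> exists b, B *m b != 0.
Proof.
move=> nzB; have [b|all0] := pickP (fun i : 'I_2 => B *m delta_mx i 0 != 0 :> 'cV_2).
  by move=> nz; exists (delta_mx b 0).
case/eqP: nzB; apply/matrixP => i j; rewrite mxE.
have /negbFE/eqP Bj := all0 j.
transitivity ((B *m delta_mx j 0 : 'cV_2) i 0); last by rewrite Bj mxE.
rewrite mxE.
rewrite (bigD1 j) //= big1 ?addr0 => [|k ne_k]; first by rewrite mxE !eqxx mulr1.
by rewrite mxE (negbTE ne_k) mulr0.
Qed.

Lemma tr_kernel_parallel B a a' : B != 0 -> a != 0 -> a' != 0 ->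
  B^T *m a = 0 -> B^T *m a' = 0 -> exists2 s, s != 0 & a = s *: a'.
Proof.
move=> nzB nza nza' Ba Ba'; have [b nz_Bb] := mx_neq0_mul nzB.
have orth c : B^T *m c = 0 -> c 0 0 * (B *m b) 0 0 + c 1 0 * (B *m b) 1 0 = 0.
  by move=> Bc; rewrite -bil_mul -bil_tr /bil -mulmxA Bc mulmx0 mxE.
have [s nzs ->] := orth_perp nza nz_Bb (orth _ Ba).
have [s' nzs' ->] := orth_perp nza' nz_Bb (orth _ Ba').
exists (s / s'); last by rewrite scalerA mulfVK.
by rewrite mulf_neq0 ?invr_eq0.
Qed.

Lemma tr_mulZ_eq0 B a s : s != 0 -> B^T *m (s *: a) = 0 -> B^T *m a = 0.
Proof. by move=> nzs /eqP; rewrite -scalemxAr scaler_eq0 (negbTE nzs) => /eqP. Qed.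
End Parallel.

Section Points.
Variables (F : fieldType) (I : finType) (n : nat).
Variables (f : I -> 'M[F]_2) (g h : I -> 'M[F]_(2, n)).
Hypothesis dec : mm_decomp f g h.
Hypothesis rankI : #|I| = (3 * n).+1.
Implicit Types (a b v w : 'cV[F]_2) (A : 'M[F]_2).

Lemma form_neq0 l : (0 < n)%N -> f l != 0.
Proof.
move=> n_gt0; apply/eqP => fl0; have : (1 < #|I|)%N by lia.
suff : (#|I| <= 1)%N by lia.
apply/card_le1_eqP => i j _ _.
have E k : l = k by apply: (form_independent dec rankI) => A _; rewrite fl0 dotC dot0r.
by rewrite -(E i) -(E j).
Qed.

(** Both forms are the point of tangency of the same plane, which is on its tangent
    lines. *)
Lemma rank_one_unique a b i j : a != 0 -> b != 0 ->
  f i *m b = 0 -> (f i)^T *m a = 0 -> f j *m b = 0 -> (f j)^T *m a = 0 -> i = j.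
Proof.
move=> nz_a nz_b fib fia fjb fja.
have [||A [uA tang _]] := @exists_tangent F 0 a b nz_a nz_b.
- by rewrite /bil mulmx0 mul0mx mxE.
- by rewrite trmx0 !mul0mx !eqxx.
apply: (tangent_line_inj dec rankI nz_a nz_b uA tang).
- by rewrite /bil -mulmxA fib mulmx0 mxE.
- exact: (tangent_dot0 nz_a nz_b).
- by rewrite /bil -mulmxA fjb mulmx0 mxE.
exact: (tangent_dot0 nz_a nz_b).
Qed.

Variable b : 'cV[F]_2.
Hypothesis nz_b : b != 0.
Let R := ruling f b.

(** The forms of the plane [a^T f b = 0] outside of the line [f b = 0]: the planes
    through this line are the tangent planes [a^T f b = 0] for varying [a]. *)
Definition pencil_class a : {set I} := ~: off f a b :\: ruling f b.
(** [f l *m b] and [f l' *m b] are parallel. *)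
Definition pencil_rel l l' := bil (perp (f l *m b)) (f l') b == 0.
Definition pencil := equivalence_partition pencil_rel (~: ruling f b).

Lemma on_ruling l a : l \in R -> bil a (f l) b = 0.
Proof. by rewrite inE => /eqP fb; rewrite /bil -mulmxA fb mulmx0 mxE. Qed.

Lemma off_classE a : ~: R :\: pencil_class a = off f a b.
Proof.
apply/setP => l; rewrite !inE; have [fb|_] := eqVneq (f l *m b) 0.
  by rewrite on_ruling ?eqxx // inE fb.
by rewrite andbT /= negbK.
Qed.

Lemma on_class_card a : #|~: off f a b| = (#|R| + #|pencil_class a|)%N.
Proof.
rewrite -(cardsID R (~: off f a b)); congr (_ + _)%N; apply: eq_card => l.
rewrite in_setI; have [lR|//] := boolP (l \in R); last by rewrite andbF.
by rewrite andbT !inE on_ruling ?eqxx.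
Qed.

Lemma pencilP : partition pencil (~: R).
Proof.
apply: equivalence_partitionP => x y z; rewrite !inE => nx ny nz.
split; first by rewrite /pencil_rel bil_perp.
by move=> /eqP E; apply: class_rep => //; apply: perp_neq0.
Qed.

Lemma pencil_classP C : C \in pencil ->
  exists l, [/\ f l *m b != 0, C = pencil_class (perp (f l *m b)) & l \in C].
Proof.
case/imsetP => l; rewrite !inE => lR ->; exists l; rewrite !inE /pencil_rel bil_perp eqxx lR.
split=> //; apply/setP => k; rewrite !inE.
by rewrite negbK /pencil_rel.
Qed.

Lemma pencil_classE C l a : C \in pencil -> l \in C -> a != 0 ->
  bil a (f l) b = 0 -> C = pencil_class a.
Proof.
move=> /pencil_classP[k [nzk -> _]] lC nza al.
have [lk nzl] : bil (perp (f k *m b)) (f l) b = 0 /\ f l *m b != 0.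
  by move: lC; rewrite !inE negbK => /andP[-> /eqP].
apply/setP => x; rewrite !inE !negbK; congr (_ && _).
by rewrite (class_rep _ nza nzl al) (class_rep _ (perp_neq0 nzk) nzl lk).
Qed.

(** An instance of [famker_partition]: the terms outside of a plane of the pencil
    are those of the line's complement without the class of this plane. *)
Lemma pencil_rank_sum :
  (\sum_(C in pencil) \rank (Uker g (~: R :\: C) (perp b)) + \rank (Uker g (~: R) (perp b)) <=
   n + #|pencil| * \rank (Uker g (~: R) (perp b)))%N.
Proof. exact: famker_partition pencilP. Qed.

Lemma pencil_parity C l2 a : C = pencil_class a -> C \in pencil -> a != 0 -> l2 \in R ->
  (f l2)^T *m a != 0 -> (#|R| + #|C|)%N = (2 * \rank (Uker g (~: R :\: C) (perp b))).+1.
Proof.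
move=> CE CP nza l2R fa; have [l [nzl _ lC]] := pencil_classP CP.
move: lC; rewrite CE !inE negbK => /andP[_ /eqP al].
by rewrite off_classE -on_class_card (plane_parity dec rankI nza nz_b nzl al fa) // on_ruling.
Qed.

(** By [rank_one_unique] only one form of the line is also on the line
    [f^T a = 0]. *)
Lemma ruling_has_moving a : (1 < #|R|)%N -> a != 0 ->
  exists2 l2, l2 \in R & (f l2)^T *m a != 0.
Proof.
move=> /card_gt1P[i [j [iR jR ne_ij]]] nza.
have [fi|] := eqVneq ((f i)^T *m a) 0; last by exists i.
have [fj|] := eqVneq ((f j)^T *m a) 0; last by exists j.
move: iR jR; rewrite !inE => /eqP iR /eqP jR.
by case/eqP: ne_ij; apply: (rank_one_unique nza nz_b).
Qed.

Lemma pencil_parity2 C : (1 < #|R|)%N -> C \in pencil ->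
  (#|R| + #|C|)%N = (2 * \rank (Uker g (~: R :\: C) (perp b))).+1.
Proof.
move=> R2 CP; have [l [nzl CE lC]] := pencil_classP CP.
have [l2 l2R fl2] := ruling_has_moving R2 (perp_neq0 nzl).
exact: pencil_parity CE CP (perp_neq0 nzl) l2R fl2.
Qed.

(** Each plane of the pencil has an odd number of forms, determined by its kernel
    dimension ([pencil_parity2]).  Summing over the pencil, [pencil_rank_sum]
    leaves no slack in [ruling_Uker_card]. *)
Lemma ruling_card_even : (1 < #|R|)%N ->
  [/\ ~~ odd #|R|, #|R| <= n.+1 & n < #|pencil|]%N.
Proof.
move=> R2; have cR := ruling_Uker_card dec nz_b; have cL := ruling_compl_card dec nz_b.
have sumC : (\sum_(C in pencil) (#|C| + #|R|) =
   \sum_(C in pencil) (2 * \rank (Uker g (~: R :\: C) (perp b)) + 1))%N.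
  by apply: eq_bigr => C CP; rewrite addnC pencil_parity2 // addn1.
have cI := cardsC (ruling f b).
move: sumC; rewrite !big_split /= -(card_partition pencilP) !sum_nat_const => sumC.
have := pencil_rank_sum; rewrite -/R in cR cL cI *.
set k := \rank (Uker g (~: R) (perp b)) in cR *.
set S := (\sum_(C in pencil) _)%N in sumC *; set t := #|pencil| in sumC *.
rewrite rankI in cI => sumS.
have t_gt0 : (0 < t)%N.
  rewrite lt0n cards_eq0; apply/eqP => P0; have /and3P[/eqP covR _ _] := pencilP.
  move: cL cI R2; rewrite -/R -covR P0 /cover big_set0 cards0; lia.
(* A strict inequality would give fewer than the 3n + 1 forms. *)
have kR : (2 * k = #|R|)%N by nia.
split; [by rewrite -kR; lia|lia|nia].
Qed.
End Points.

(** * Lines of the quadric for 13 terms *)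

Section Four.
Variables (F : fieldType) (I : finType).
Hypothesis rankI : #|I| = 13%N.
Implicit Types (f : I -> 'M[F]_2) (g h : I -> 'M[F]_(2, 4)) (a b v w : 'cV[F]_2).

Lemma pencil_classZ f a b s : s != 0 -> pencil_class f b (s *: a) = pencil_class f b a.
Proof.
by move=> nzs; apply/setP => l; rewrite !inE !negbK bilZl mulf_eq0 (negbTE nzs).
Qed.

Lemma det0_tr_kernel (B : 'M[F]_2) b : b != 0 -> B *m b = 0 ->
  exists2 a : 'cV[F]_2, a != 0 & B^T *m a = 0.
Proof.
move=> nzb Bb; apply: det0_kernel; rewrite det_tr; apply/eqP.
by apply: contraTT isT => nz; rewrite (det_neq0_inj nz Bb) eqxx in nzb.
Qed.

(** With a single form [f i] on the line, the planes that do not contain the other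
    line through [f i] have an even number of forms outside of the line, and
    [pencil_rank_sum] allows 8 of them in total.  At least four of the remaining
    forms are then on the other line through [f i], which makes five with [f i]
    and contradicts [ruling_card_even] for that line. *)
Lemma ruling_card_gt1 f g h b i : mm_decomp f g h -> b != 0 -> f i *m b = 0 ->
  (1 < #|ruling f b|)%N.
Proof.
move=> dec nzb fib; have iR : i \in ruling f b by rewrite inE fib.
rewrite ltnNge; apply/negP => R1; have {R1}cR : #|ruling f b| = 1%N.
  by apply/eqP; rewrite eqn_leq R1; apply/card_gt0P; exists i.
have nzfi : f i != 0 by apply: (form_neq0 dec rankI).
have [a nza fia] := det0_tr_kernel nzb fib.
set E := pencil_class f b a.
have kR : \rank (Uker g (~: ruling f b) (perp b)) = 0%N.
  by have := ruling_Uker_card dec nzb; rewrite cR; lia.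
have Ccard C : C \in pencil f b ->
    (#|C| <= 2 * \rank (Uker g (~: ruling f b :\: C) (perp b)) + (C == E) * #|E|)%N.
  move=> CP; have [->|neCE] := eqVneq C E; first by rewrite mul1n leq_addl.
  have [l [nzl CE _]] := pencil_classP CP; have nzp := perp_neq0 nzl.
  have /(pencil_parity dec rankI nzb CE CP nzp iR) : (f i)^T *m perp (f l *m b) != 0.
    apply: contra neCE => /eqP fip.
    have [s nzs E'] := tr_kernel_parallel nzfi nzp nza fip fia.
    by rewrite CE E' pencil_classZ.
  by rewrite cR; lia.
have sumE : (\sum_(C in pencil f b) (C == E) * #|E| <= #|E|)%N.
  have [EP|ENP] := boolP (E \in pencil f b).
    rewrite (bigD1 E) //= eqxx mul1n big1 ?addn0 // => C /andP[_ /negbTE ->].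
    by rewrite mul0n.
  by rewrite big1 // => C CP; case: eqP => [EC|]; rewrite ?mul0n // -EC CP in ENP.
have E4 : (4 <= #|E|)%N.
  have : (\sum_(C in pencil f b) #|C| <= \sum_(C in pencil f b)
      (2 * \rank (Uker g (~: ruling f b :\: C) (perp b)) + (C == E) * #|E|))%N.
    exact: leq_sum.
  rewrite -(card_partition (pencilP f b)) big_split /=.
  have := pencil_rank_sum f g b; rewrite kR; have := cardsC (ruling f b).
  under [X in _ -> _ -> (_ <= X + _)%N -> _]eq_bigr do rewrite mul2n -addnn.
  rewrite big_split /=; move: rankI.
  set S := (\sum_(C in _) \rank _)%N; set T := (\sum_(C in _) (_ * _))%N in sumE *.
  by rewrite cR muln0 !addn0 => -> cI S4 cL; lia.
have iR' : i \in ruling (fun l => (f l)^T) a by rewrite inE fia.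
have : (5 <= #|ruling (fun l => (f l)^T) a|)%N.
  rewrite (cardsD1 i) iR' add1n ltnS (leq_trans E4) //.
  apply/subset_leq_card/subsetP => l; rewrite !inE negbK => /andP[nzl /eqP al].
  have [fl0|->] := tangent_plane_point dec rankI nza nzb fib fia al.
    by rewrite fl0 eqxx in nzl.
  by rewrite eqxx andbT; apply: contra nzl => /eqP ->; rewrite fib.
move=> R5; have [] := ruling_card_even (mm_decomp_tr dec) rankI nza.
  by apply: leq_trans R5.
move=> ev le5 _; have e5 : #|ruling (fun l => (f l)^T) a| = 5%N.
  by apply/eqP; rewrite eqn_leq le5 R5.
by rewrite e5 in ev.
Qed.

(** With [w] independent of [b], the image of a form of the line is spanned by
    [f w], and the other line through it is given by [perp (f w)]. *)
Lemma ruling_kernel f g h b w : mm_decomp f g h -> b != 0 ->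
  w 0 0 * perp b 0 0 + w 1 0 * perp b 1 0 = 1 ->
  forall i, i \in ruling f b -> f i *m w != 0 /\ (f i)^T *m perp (f i *m w) = 0.
Proof.
move=> dec nzb wb i; rewrite inE => /eqP fib.
have bilb x : bil x (f i) b = 0 by rewrite /bil -mulmxA fib mulmx0 mxE.
split; last by apply: (tr_mul_eq0 wb); rewrite ?bilb ?bil_perp.
have nzf : (f i)^T != 0.
  apply: contra (form_neq0 dec rankI i isT) => /eqP f0.
  by rewrite -[f i]trmxK f0 trmx0.
have [x] := mx_neq0_mul nzf; apply: contra => /eqP fw; apply/eqP.
by apply: (tr_mul_eq0 wb); rewrite ?bilb // /bil -mulmxA fw mulmx0 mxE.
Qed.

(** The union of the two lines through [f i] lies in the tangent plane, whose number
    of forms is at most twice a kernel dimension plus one, and this dimension is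
    less than the number of forms on the second line. *)
Lemma crossing_card f g h a b i : mm_decomp f g h -> a != 0 -> b != 0 ->
  f i *m b = 0 -> (f i)^T *m a = 0 ->
  (#|ruling f b| < #|ruling (fun l => (f l)^T) a|.+1)%N.
Proof.
move=> dec nza nzb fib fia; set R := ruling f b; set R' := ruling _ a.
have onR : R :|: R' \subset ~: off f a b.
  apply/subsetP => l; rewrite !inE negbK => /orP[/eqP fb|/eqP fa].
    by rewrite /bil -mulmxA fb mulmx0 mxE.
  by rewrite -bil_tr /bil -mulmxA fa mulmx0 mxE.
have RR' : (#|R :&: R'| <= 1)%N.
  apply/card_le1_eqP => x y; rewrite !inE => /andP[/eqP xb /eqP xa] /andP[/eqP yb /eqP ya].
  exact: (rank_one_unique dec rankI nza nzb).
have dec' := mm_decomp_tr dec.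
have R'2 : (1 < #|R'|)%N by apply: (ruling_card_gt1 dec' nza fia).
have [j jR' fjb] := ruling_has_moving dec' rankI nza R'2 nzb.
have abj : bil b (f j)^T a = 0.
  by move: jR'; rewrite inE => /eqP fa; rewrite /bil -mulmxA fa mulmx0 mxE.
have fib' : ((f i)^T)^T *m b = 0 by rewrite trmxK.
have := plane_card_bound dec' rankI nzb nza fjb abj.
have := tangent_plane_Uker_card dec' rankI nzb nza fia fib'.
rewrite off_tr -/R'; have := subset_leq_card onR; rewrite cardsU; lia.
Qed.

(** By [ruling_card_even] the number is 2 or 4.  If it were 4, then by
    [crossing_card] the other lines through these four forms would carry four
    forms each; they are disjoint, and 16 exceeds 13. *)
Lemma ruling_card2 f g h b i : mm_decomp f g h -> b != 0 -> f i *m b = 0 ->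
  #|ruling f b| = 2%N.
Proof.
move=> dec nzb fib; have R2 := ruling_card_gt1 dec nzb fib.
have [ev le5 _] := ruling_card_even dec rankI nzb R2.
suff ne4 : #|ruling f b| <> 4%N.
  by move: R2 ev le5 ne4; case: #|_| => [|[|[|[|[|[|k]]]]]].
move=> cR; have [w wb] := exists_dual (perp_neq0 nzb).
pose a l := perp (f l *m w).
have aP l : l \in ruling f b -> [/\ a l != 0, f l *m b = 0 & (f l)^T *m a l = 0].
  move=> lR; have [nz ->] := ruling_kernel dec nzb wb lR; split=> //.
    exact: perp_neq0.
  by move: lR; rewrite inE => /eqP.
pose R' l := ruling (fun k => (f k)^T) (a l).
have cR' l : l \in ruling f b -> (4 <= #|R' l|)%N.
  by move=> /aP[nza flb fla]; have := crossing_card dec nza nzb flb fla; rewrite cR ltnS.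
have : (\sum_(l in ruling f b) 4 <= \sum_(l in ruling f b) #|R' l|)%N by apply: leq_sum.
rewrite sum_nat_const cR.
under [X in (_ <= X)%N -> _]eq_bigr do rewrite -sum1_card.
rewrite (exchange_big_dep predT) //=.
suff : (\sum_(k : I) \sum_(l in ruling f b | k \in R' l) 1 <= \sum_(k : I) 1)%N.
  by rewrite sum1_card cardT -cardE rankI => le13 le16; have := leq_trans le16 le13.
apply: leq_sum => k _; rewrite sum1dep_card; apply/card_le1_eqP => x y.
rewrite inE => /andP[/aP[nzx xb xa] kx]; rewrite inE => /andP[/aP[nzy yb ya] ky].
have [s nzs axy] : exists2 s, s != 0 & a x = s *: a y.
  apply: (@tr_kernel_parallel _ (f k)) => //; first exact: (form_neq0 dec rankI).
    by move: kx; rewrite inE => /eqP.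
  by move: ky; rewrite inE => /eqP.
apply: (rank_one_unique dec rankI nzx nzb) => //.
by rewrite axy -scalemxAr ya scaler0.
Qed.

(** Of the five or more planes through the line [f b = 0], at most three are the
    plane of [a] or a tangent plane at one of the two forms of the line.  The
    forms that another plane adds to the line are odd in number by
    [pencil_parity2], while the singular ones among them are on a single line of
    the other ruling, hence none or two by [ruling_card2]. *)
Lemma two_rank_two_terms f g h a b i : mm_decomp f g h -> a != 0 -> b != 0 ->
  f i *m b = 0 ->
  exists j1 j2, [/\ j1 != j2, \det (f j1) != 0, \det (f j2) != 0,
    bil a (f j1) b != 0 & bil a (f j2) b != 0].
Proof.
move=> dec nza nzb fib; have cR := ruling_card2 dec nzb fib.
have R2 : (1 < #|ruling f b|)%N by rewrite cR.
have [_ _ P5] := ruling_card_even dec rankI nzb R2.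
have [w wb] := exists_dual (perp_neq0 nzb).
pose a_ l := perp (f l *m w).
(* The plane of a, and the tangent planes at the forms of the line. *)
pose bad := pencil_class f b a |: [set pencil_class f b (a_ l) | l in ruling f b].
have bad3 : (#|bad| <= 3)%N.
  rewrite cardsU1; have := leq_imset_card (fun l => pencil_class f b (a_ l)) (mem (ruling f b)).
  by rewrite cR; case: (_ \notin _) => //= le2; rewrite ?add0n ?add1n ?ltnS // (leq_trans le2).
have good2 : (1 < #|pencil f b :\: bad|)%N.
  rewrite cardsD ltn_subRL (leq_trans _ P5) // ltnS addn1 ltnS.
  exact: leq_trans (subset_leq_card (subsetIr _ _)) bad3.
have good C : C \in pencil f b :\: bad ->
    exists2 j, j \in C & (\det (f j) != 0) && (bil a (f j) b != 0).
  rewrite in_setD => /andP[CNbad CP].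
  have [l [nzl CE lC]] := pencil_classP CP; set c := perp _ in CE.
  have nzc : c != 0 by apply: perp_neq0.
  have [j /andP[jC nzj]|all0] := pickP (fun j => (j \in C) && (\det (f j) != 0)).
    exists j => //; rewrite nzj; apply: contra CNbad => /eqP aj.
    by rewrite (pencil_classE CP jC nza aj) setU11.
  have odC := pencil_parity2 dec rankI nzb R2 CP.
  suff C' : C = ruling (fun k => (f k)^T) c.
    have : #|C| = 2%N.
      rewrite C'; apply: (ruling_card2 (mm_decomp_tr dec) nzc (i := l)).
      by move: lC; rewrite C' inE => /eqP.
    by move=> C2; move: odC; rewrite cR C2; lia.
  apply/setP => k; apply/idP/idP => [kC|].
    have [nzk ck] : f k *m b != 0 /\ bil c (f k) b = 0.
      by move: kC; rewrite CE !inE negbK => /andP[-> /eqP].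
    have dk0 : \det (f k) = 0 by apply/eqP; move/negbT: (all0 k); rewrite kC negbK.
    have [|x nzx xk] := @det0_kernel F (f k)^T; first by rewrite det_tr.
    have xb : bil x (f k) b = 0 by rewrite -bil_tr /bil -mulmxA xk mulmx0 mxE.
    have [s nzs xE] := orth_perp nzx nzk (etrans (esym (bil_mul _ _ _)) xb).
    have [s' nzs' cE] := orth_perp nzc nzk (etrans (esym (bil_mul _ _ _)) ck).
    rewrite inE cE -scalemxAr scaler_eq0 (negbTE nzs') /=; apply/eqP.
    by apply: (tr_mulZ_eq0 nzs); rewrite -xE.
  rewrite inE => /eqP ck; rewrite CE !inE negbK -bil_tr /bil -mulmxA ck mulmx0 mxE eqxx andbT.
  apply: contra CNbad => kb; have kR : k \in ruling f b by rewrite inE.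
  have [nzw kk] := ruling_kernel dec nzb wb kR.
  have [s nzs cE] := tr_kernel_parallel (form_neq0 dec rankI k isT) nzc (perp_neq0 nzw) ck kk.
  rewrite CE cE pencil_classZ //; apply/setU1r.
  exact: (imset_f (fun l => pencil_class f b (a_ l)) kR).
have /card_gt1P[C1 [C2 [C1g C2g neC]]] := good2.
have [j1 j1C /andP[d1 b1]] := good _ C1g; have [j2 j2C /andP[d2 b2]] := good _ C2g.
exists j1, j2; split=> //; apply: contra neC => /eqP j12.
have /and3P[_ /trivIsetP tiP _] := pencilP f b.
apply: contraTT j1C => neC; rewrite j12.
move: C1g C2g; rewrite !in_setD => /andP[_ C1P'] /andP[_ C2P'].
by rewrite (disjointFl (tiP _ _ C1P' C2P' neC) j2C).
Qed.
End Four.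

(** * Cross products and traceless matrices *)

Section Cross.
Variable F : fieldType.
Implicit Types (u v w d : 'rV[F]_3).

Lemma sum3 (V : nmodType) (P : 'I_3 -> V) : \sum_s P s = P 0 + P 1 + P 2.
Proof.
rewrite !big_ord_recl big_ord0 addr0 addrA.
by congr (P _ + P _ + P _); apply: val_inj.
Qed.

Lemma ord3P (s : 'I_3) : [\/ s = 0, s = 1 | s = 2].
Proof.
by case: s => [[|[|[|]]]] // lt_s; [constructor 1|constructor 2|constructor 3]; apply: val_inj.
Qed.

Definition row3 (x y z : F) : 'rV[F]_3 :=
  \row_s (if s == 0 then x else if s == 1 then y else z).

Lemma row3E x y z : (row3 x y z 0 0 = x) * (row3 x y z 0 1 = y) * (row3 x y z 0 2 = z).
Proof. by rewrite !mxE. Qed.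

Lemma rV3P u v : u 0 0 = v 0 0 -> u 0 1 = v 0 1 -> u 0 2 = v 0 2 -> u = v.
Proof. by move=> e0 e1 e2; apply/rowP => s; case: (ord3P s) => ->. Qed.

Definition cross u v : 'rV[F]_3 :=
  row3 (u 0 1 * v 0 2 - u 0 2 * v 0 1) (u 0 2 * v 0 0 - u 0 0 * v 0 2)
       (u 0 0 * v 0 1 - u 0 1 * v 0 0).

Lemma dot3E u v : dot u v = u 0 0 * v 0 0 + u 0 1 * v 0 1 + u 0 2 * v 0 2.
Proof. by rewrite dotE big_ord1 sum3. Qed.

Lemma cross_dot u v : dot (cross u v) u = 0.
Proof. by rewrite dot3E !row3E; ring. Qed.

Lemma cross0_sym u v : cross u v = 0 -> forall s t, u 0 s * v 0 t = u 0 t * v 0 s.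
Proof.
move=> /rowP uv.
have := uv 0; rewrite row3E mxE => /subr0_eq e0.
have := uv 1; rewrite row3E mxE => /subr0_eq e1.
have := uv 2; rewrite row3E mxE => /subr0_eq e2.
by move=> s t; case: (ord3P s) => ->; case: (ord3P t) => ->.
Qed.

(** A vanishing cross product means that the vectors are parallel. *)
Lemma cross0_orth u v w : u != 0 -> cross u v = 0 -> dot u w = 0 -> dot v w = 0.
Proof.
move=> nzu /cross0_sym uv uw.
have [s nzs|all0] := pickP (fun s => u 0 s != 0); last first.
  case/eqP: nzu; apply/rowP => s; rewrite [RHS]mxE.
  by have /negbFE/eqP := all0 s.
apply: (mulfI nzs); rewrite mulr0 dot3E !mulrDr !mulrA !(uv s).
rewrite ![_ * v 0 s]mulrC -!mulrA -!mulrDr.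
by move: uw; rewrite dot3E => ->; rewrite mulr0.
Qed.

Lemma cross0_of_orth u v : (forall d, dot d u = 0 -> dot d v = 0) -> cross u v = 0.
Proof.
move=> H; have E x y z : dot (cross u (row3 x y z)) v = 0 by apply/H/cross_dot.
apply: rV3P; rewrite row3E mxE.
- by have := E (-1) 0 0; rewrite dot3E !row3E => <-; ring.
- by have := E 0 (-1) 0; rewrite dot3E !row3E => <-; ring.
by have := E 0 0 (-1); rewrite dot3E !row3E => <-; ring.
Qed.

Lemma basis_of_rank m p k (M : 'M[F]_(m, p)) : \rank M = k ->
  exists B : 'M[F]_(k, p), row_free B /\ (B :=: M)%MS.
Proof.
move=> <-; exists (row_base M); split; first exact: row_base_free.
exact: eq_row_base.
Qed.

Lemma orth_basis u : u != 0 -> exists B : 'M[F]_(2, 3),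
  row_free B /\ forall d, (d <= B)%MS = (dot d u == 0).
Proof.
move=> nzu; have rk : \rank (kermx u^T) = 2%N by rewrite mxrank_ker mxrank_tr rank_rV nzu.
suff [B [fB eB]] : exists B : 'M[F]_(2, 3), row_free B /\ (B :=: kermx u^T)%MS.
  exists B; split=> // d; rewrite eB; apply/sub_kermxP/eqP => [E|E].
    by rewrite -dot_tr /dot trmxK E mxtrace0.
  by apply: mx11_eq0; rewrite -E -dot_tr /dot trmxK /mxtrace big_ord1.
exact: basis_of_rank.
Qed.
End Cross.

Section Trace0.
Variable F : fieldType.

Definition mx2 (x y z t : F) : 'M[F]_2 :=
  \matrix_(i, j) (if i == 0 then if j == 0 then x else y else if j == 0 then z else t).

Lemma mx2entries x y z t : (mx2 x y z t 0 0 = x) * (mx2 x y z t 0 1 = y) *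
  (mx2 x y z t 1 0 = z) * (mx2 x y z t 1 1 = t).
Proof. by rewrite !mxE. Qed.

(** The usual basis of the traceless matrices: two nilpotent matrices and a diagonal
    one. *)
Definition sl2 (s : 'I_3) : 'M[F]_2 :=
  if s == 0 then mx2 0 1 0 0 else if s == 1 then mx2 0 0 1 0 else mx2 1 0 0 (-1).

Lemma sl2E : (sl2 0 = mx2 0 1 0 0) * (sl2 1 = mx2 0 0 1 0) * (sl2 2 = mx2 1 0 0 (-1)).
Proof. by []. Qed.

Lemma mx2P (A B : 'M[F]_2) : A 0 0 = B 0 0 -> A 0 1 = B 0 1 -> A 1 0 = B 1 0 ->
  A 1 1 = B 1 1 -> A = B.
Proof.
by move=> e00 e01 e10 e11; apply/matrixP => i j; case: (ord2P i) => ->; case: (ord2P j) => ->.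
Qed.

Definition sl2coef (A : 'M[F]_2) : 'rV[F]_3 := row3 (A 0 1) (A 1 0) (A 0 0).

Lemma mxtrace2 (A : 'M[F]_2) : \tr A = A 0 0 + A 1 1.
Proof. by rewrite /mxtrace !big_ord_recl big_ord0 addr0 lift2 ord0_2. Qed.

Lemma traceless (A : 'M[F]_2) : \tr A = 0 -> A 1 1 = - A 0 0.
Proof. by rewrite mxtrace2 addrC => /eqP; rewrite addr_eq0 => /eqP. Qed.

Lemma sl2_sum (A : 'M[F]_2) : \tr A = 0 -> A = \sum_s sl2coef A 0 s *: sl2 s.
Proof.
move=> /traceless trA; by rewrite sum3 !row3E !sl2E; apply: mx2P; rewrite !mxE /= ?trA; ring.
Qed.

Lemma mulmx2E m (A : 'M[F]_2) (x : 'M[F]_(2, m)) i j :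
  (A *m x) i j = A i 0 * x 0 j + A i 1 * x 1 j.
Proof. by rewrite mxE !big_ord_recl big_ord0 addr0 lift2 ord0_2. Qed.

(** For traceless [A], [B A C - C A B] is a scalar matrix, alternating in the
    traceless matrices [B] and [C] and hence linear in their cross product; the
    scalar is a coordinate of [A]. *)
Lemma sl2_comm (A : 'M[F]_2) : \tr A = 0 ->
  [/\ sl2 1 *m A *m sl2 2 - sl2 2 *m A *m sl2 1 = (- sl2coef A 0 0)%:M,
      sl2 2 *m A *m sl2 0 - sl2 0 *m A *m sl2 2 = (- sl2coef A 0 1)%:M &
      sl2 0 *m A *m sl2 1 - sl2 1 *m A *m sl2 0 = (- sl2coef A 0 2)%:M].
Proof.
move=> /traceless trA; have sE (x : F) : x%:M = mx2 x 0 0 x :> 'M[F]_2 by apply: mx2P; rewrite !mxE /= ?mulr1n ?mulr0n.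
rewrite !row3E !sl2E !sE; split; apply: mx2P;
  rewrite [X in X = _]mxE [X in _ + X = _]mxE !mulmx2E !mx2entries ?trA; ring.
Qed.

(** The three pairs of distinct basis matrices give six relations between rows,
    which kill the six rows of [G] one after the other. *)
Lemma sl2_symmetric n (G : 'I_3 -> 'M[F]_(2, n)) :
  (forall s t, (sl2 t)^T *m G s = (sl2 s)^T *m G t) -> forall s, G s = 0.
Proof.
move=> sym; have E s t i j := congr1 (fun M : 'M[F]_(2, n) => M i j) (sym s t).
have T s i j : (sl2 s)^T i j = sl2 s j i by rewrite mxE.
have R s : (forall j, G s 0 j = 0) -> (forall j, G s 1 j = 0) -> G s = 0.
  by move=> r0 r1; apply/matrixP => i j; rewrite [RHS]mxE; case: (ord2P i) => ->.
have red s t i j : sl2 t 0 i * G s 0 j + sl2 t 1 i * G s 1 j =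
    sl2 s 0 i * G t 0 j + sl2 s 1 i * G t 1 j.
  by have := E s t i j; rewrite !mulmx2E !T.
have simp := (mul0r, mul1r, addr0, add0r, mulN1r).
have a j : G 0 1 j = 0 by have := red 0 1 0 j; rewrite !sl2E !mx2entries !simp.
have b j : G 1 0 j = 0 by have := red 0 1 1 j; rewrite !sl2E !mx2entries !simp.
have c j : G 0 0 j = 0 by have := red 0 2 0 j; rewrite !sl2E !mx2entries !simp.
have d j : G 2 0 j = 0.
  by have := red 0 2 1 j; rewrite !sl2E !mx2entries !simp a oppr0.
have e j : G 2 1 j = 0 by have := red 1 2 0 j; rewrite !sl2E !mx2entries !simp b.
have e' j : G 1 1 j = 0.
  by have := red 1 2 1 j; rewrite !sl2E !mx2entries !simp => /eqP; rewrite oppr_eq0 => /eqP.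
by move=> s; case: (ord3P s) => ->; apply: R.
Qed.
End Trace0.

(** * Orthogonality of the other two factors at an invertible form *)

(** A family of as many vectors as the dimension of the space they span is free. *)
Lemma famker_independent (F : fieldType) (T : finType) p (D : {set T}) (c : T -> 'cV[F]_p)
    (z : T -> F) :
  \rank (famker D c) = 0%N -> #|D| = p -> \sum_(x in D) z x *: c x = 0 ->
  forall x, x \in D -> z x = 0.
Proof.
move=> k0 cD sum0 x xD; have := rank_fammx D c; rewrite k0 addn0 => rkM.
have free : row_free (fammx D c)^T.
  rewrite /row_free mxrank_tr eqn_leq rank_leq_col /=.
  by apply: leq_trans rkM; rewrite cD.
pose y : 'rV[F]_#|D| := \row_k z (enum_val k).
have : y *m (fammx D c)^T = 0.
  apply/rowP => i; move/colP/(_ i): sum0; rewrite !mxE summxE big_enum_val /= => E.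
  rewrite -[RHS]E; apply: eq_bigr => k _; by rewrite !mxE.
rewrite -[RHS](mul0mx _ (fammx D c)^T) => /(row_free_inj free)/rowP/(_ (enum_rank_in xD x)).
by rewrite !mxE enum_rankK_in.
Qed.

Lemma mxvec_dot (F : fieldType) m n (A B : 'M[F]_(m, n)) :
  (mxvec A *m (mxvec B)^T) 0 0 = dot A B.
Proof.
rewrite mxE dotE pair_bigA (reindex _ (curry_mxvec_bij m n)) /=.
by apply: eq_bigr => -[i j] _; rewrite mxE !mxvecE.
Qed.

Section Orthogonality.
Variables (F : fieldType) (I : finType) (n : nat).
Variables (f : I -> 'M[F]_2) (g h : I -> 'M[F]_(2, n)).
Hypothesis dec : mm_decomp f g h.

Lemma dot_suml (T : finType) (P : pred T) m p (X : T -> 'M[F]_(m, p)) B :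
  dot B (\sum_(t | P t) X t) = \sum_(t | P t) dot B (X t).
Proof. by rewrite /dot mulmx_sumr raddf_sum. Qed.

Lemma mm_decomp_vec A (x : 'M[F]_(2, n)) :
  \sum_l (dot (f l) A * dot (g l) x) *: h l = A *m x.
Proof.
apply/eqP; rewrite -subr_eq0; apply/eqP/dot_nondeg => y.
rewrite dotDr -scaleN1r dotZr mulN1r -dec dot_suml; apply/eqP; rewrite subr_eq0; apply/eqP.
by apply: eq_bigr => l _; rewrite dotZr dotC [dot y _]dotC; congr (_ * _); rewrite dotC.
Qed.

Hypothesis rankI : #|I| = (3 * n).+1.
Hypothesis n_gt0 : (0 < n)%N.
Variable j : I.
Hypothesis fj1 : f j = 1%:M.

Let fb l : 'rV[F]_3 := \row_s dot (f l) (sl2 F s).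

Lemma dot_sl2 m (K : 'M[F]_2 -> 'M[F]_(2, m)) (u : 'M[F]_(2, m)) A : \tr A = 0 ->
  (forall X Y, K (X + Y) = K X + K Y) -> (forall a X, K (a *: X) = a *: K X) ->
  dot u (K A) = dot (\row_s dot u (K (sl2 F s))) (sl2coef A).
Proof.
move=> trA KD KZ; rewrite {1}(sl2_sum trA) sum3 !KD !KZ !dotDr !dotZr dot3E.
by congr (_ + _ + _); rewrite [RHS]mulrC; congr (_ * _); rewrite mxE.
Qed.

Lemma dot_fb l A : \tr A = 0 -> dot (f l) A = dot (fb l) (sl2coef A).
Proof. by move=> trA; rewrite (@dot_sl2 2 id). Qed.

Lemma fb_eq0 l : (fb l == 0) = (l == j).
Proof.
apply/eqP/eqP => [fl0|->].
  apply: (form_independent dec rankI) => A; rewrite {1}/dot fj1 trmx1 mul1mx => trA.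
  by rewrite dot_fb // fl0 dotC dot0r.
apply/rowP => s; rewrite !mxE /dot fj1 trmx1 mul1mx /mxtrace !big_ord_recl big_ord0 addr0.
by rewrite lift2 ord0_2 /sl2; case: ifP => _; [|case: ifP => _]; rewrite !mx2entries ?addr0 // subrr.
Qed.

(** Write [d (x) h] for the triple of matrices [d_s h].  For [l] other than [j], let
    [S_l] be the plane of the [d (x) h_l] with [d] orthogonal to the coordinates
    [fb l] of [f_l] on the traceless matrices.  The [S_l] span the whole space of
    triples: a functional [G] that vanishes on them satisfies the symmetry
    relation of [sl2_symmetric], by the decomposition identity.  There are [3n]
    planes in dimension [6n], so that their sum is direct.  Now [C] is orthogonal
    to [f_k], and the decomposition identity with [sl2_comm] expresses
    [- C (x) h_k] by the vectors [(fb l x mu l) (x) h_l], where [mu l] collects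
    the values of [g_l] at [C e_s h_k].  By uniqueness of the coordinates the
    component of index [i] is zero, so that [mu i] is parallel to [fb i] and is
    orthogonal to [B] as well. *)
Lemma orthogonality_unit i k (B C : 'M[F]_2) : i != j -> k != j -> i != k ->
  \tr B = 0 -> \tr C = 0 -> dot (f i) B = 0 -> dot (f k) C = 0 ->
  dot (g i) (C *m (B *m h k)) = 0.
Proof.
move=> ne_ij ne_kj ne_ik trB trC fiB fkC.
have /fin_all_exists[Bs BsP] : forall l, exists B' : 'M[F]_(2, 3), l != j ->
    row_free B' /\ forall d, (d <= B')%MS = (dot d (fb l) == 0).
  move=> l; have [->|ne_lj] := eqVneq l j; first by exists 0.
  by have [|B' HB'] := @orth_basis F (fb l); [rewrite fb_eq0|exists B'].
pose D := [set x : I * 'I_2 | x.1 != j].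
pose c (x : I * 'I_2) : 'cV[F]_(3 * (2 * n)) :=
  (mxvec ((row x.2 (Bs x.1))^T *m mxvec (h x.1)))^T.
have cardD : #|D| = (3 * (2 * n))%N.
  have -> : D = setX [set~ j] setT by apply/setP => -[l e]; rewrite !inE andbT.
  by rewrite cardsX cardsT card_ord cardsC1 rankI /=; lia.
have kerD : \rank (famker D c) = 0%N.
  apply: famker_rank0 => u uc; pose G : 'M[F]_(3, 2 * n) := vec_mx u.
  pose Gs s : 'M[F]_(2, n) := vec_mx (row s G).
  pose gam l : 'rV[F]_3 := \row_s dot (Gs s) (h l).
  have gamE l : (gam l)^T = G *m (mxvec (h l))^T.
    apply/colP => s; rewrite [LHS]mxE [LHS]mxE -mxvec_dot vec_mxK.
    by rewrite -row_mul mxE.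
  have sym l s t : l != j -> fb l 0 s * gam l 0 t = fb l 0 t * gam l 0 s.
    move=> ne_lj; have [freeB spanB] := BsP l ne_lj.
    apply: cross0_sym; apply: cross0_of_orth => d /eqP; rewrite -spanB => /submxP[y dE].
    have Bg : Bs l *m (gam l)^T = 0.
      apply/row_matrixP => e; rewrite row0 row_mul gamE mulmxA.
      have := uc (l, e); rewrite inE => /(_ ne_lj) /(congr1 trmx).
      by rewrite /c /= -[u]vec_mxK -/G trmx_mul trmxK mxvec_dotmul trmx0.
    have : d *m (gam l)^T = 0 by rewrite dE -mulmxA Bg mulmx0.
    by rewrite -dot_tr /dot trmxK => ->; rewrite mxtrace0.
  have G0 : forall s, Gs s = 0.
    apply: sl2_symmetric => s t; apply/eqP; rewrite -subr_eq0; apply/eqP/dot_nondeg => x.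
    have tot s' t' : dot x ((sl2 F t')^T *m Gs s') = \sum_l fb l 0 t' * gam l 0 s' * dot (g l) x.
      have -> : dot x ((sl2 F t')^T *m Gs s') = dot (Gs s') (sl2 F t' *m x).
        by rewrite /dot -mxtrace_tr !trmx_mul !trmxK mulmxA.
      rewrite -mm_decomp_vec dot_suml; apply: eq_bigr => l _.
      by rewrite dotZr !mxE mulrAC.
    rewrite dotDr -scaleN1r dotZr mulN1r !tot; apply/eqP; rewrite subr_eq0; apply/eqP.
    apply: eq_bigr => l _; congr (_ * _).
    have [->|ne_lj] := eqVneq l j; last exact: sym.
    have /eqP fbj : fb j == 0 by rewrite fb_eq0.
    by rewrite fbj ![(0 : 'rV_3) _ _]mxE !mul0r.
  rewrite -[u]vec_mxK -/G (_ : G = 0) ?linear0 //.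
  apply/row_matrixP => s; rewrite row0 -[row s G]vec_mxK.
  by rewrite -/(Gs s) G0 linear0.
pose cC := sl2coef C.
pose mu l : 'rV[F]_3 := \row_s dot (g l) (C *m (sl2 F s *m h k)).
pose d l := cross (fb l) (mu l) + (l == k)%:R *: cC.
have d_orth l : l != j -> (d l <= Bs l)%MS.
  move=> ne_lj; have [_ ->] := BsP l ne_lj; rewrite dotC dotDr dotC cross_dot add0r.
  have [->|_] := eqVneq l k; last by rewrite scale0r dot0r.
  by rewrite scale1r -dot_fb // fkC.
have sum_fm t s : \sum_l (fb l 0 t * mu l 0 s) *: h l = (sl2 F t *m C *m sl2 F s) *m h k.
  by rewrite -!mulmxA -mm_decomp_vec; apply: eq_bigr => l _; rewrite !mxE.
have d_sum s : \sum_(l | l != j) d l 0 s *: h l = 0.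
  have fbj : fb j = 0 by apply/eqP; rewrite fb_eq0.
  have dj : d j 0 s = 0.
    rewrite /d eq_sym (negbTE ne_kj) scale0r addr0 fbj /cross.
    by rewrite mxE; case: ifP => _; [|case: ifP => _]; rewrite !mxE !mul0r subrr.
  have : \sum_(l | l != j) d l 0 s *: h l = \sum_l d l 0 s *: h l.
    by rewrite [RHS](bigD1 j) //= dj scale0r add0r.
  move=> ->; have dE l : d l 0 s *: h l =
      cross (fb l) (mu l) 0 s *: h l + ((l == k)%:R * cC 0 s) *: h l.
    by rewrite -scalerDl; congr (_ *: _); rewrite /d !mxE.
  under eq_bigr do rewrite dE.
  rewrite big_split /= [X in _ + X](bigD1 k) //= eqxx mul1r [X in _ + (_ + X)]big1; last first.
    by move=> l /negbTE ->; rewrite mul0r scale0r.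
  rewrite addr0.
  have crossE a b a' b' :
      \sum_l (fb l 0 a * mu l 0 b - fb l 0 a' * mu l 0 b') *: h l =
      (sl2 F a *m C *m sl2 F b - sl2 F a' *m C *m sl2 F b') *m h k.
    rewrite mulmxBl -!sum_fm -sumrB; apply: eq_bigr => l _; exact: scalerBl.
  have [S0 S1 S2] := sl2_comm trC.
  suff -> : \sum_l cross (fb l) (mu l) 0 s *: h l = - cC 0 s *: h k.
    by rewrite -scalerDl addNr scale0r.
  case: (ord3P s) => ->; under eq_bigr do rewrite row3E;
    by rewrite crossE ?S0 ?S1 ?S2 mul_scalar_mx.
pose ys l := d l *m pinvmx (Bs l).
have dE l : l != j -> d l = ys l *m Bs l by move=> ne_lj; rewrite mulmxKpV ?d_orth.
have sum0 : \sum_(x in D) ys x.1 0 x.2 *: c x = 0.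
  have -> : \sum_(x in D) ys x.1 0 x.2 *: c x =
      \sum_(l | l != j) \sum_e ys l 0 e *: c (l, e).
    by rewrite pair_big /=; apply: eq_big => [[l e]|[l e]] //; rewrite inE andbT.
  have inner l : l != j -> \sum_e ys l 0 e *: c (l, e) = (mxvec ((d l)^T *m mxvec (h l)))^T.
    move=> ne_lj; rewrite (dE l) // mulmx_sum_row !linear_sum mulmx_suml !linear_sum.
    by apply: eq_bigr => e _; rewrite !linearZ /= -scalemxAl !linearZ.
  rewrite (eq_bigr _ inner) -!linear_sum /=.
  rewrite (_ : \sum_(l | l != j) _ = 0) ?linear0 ?trmx0 //.
  apply/row_matrixP => s; rewrite row0 linear_sum.
  transitivity (mxvec (\sum_(l | l != j) d l 0 s *: h l)); last by rewrite d_sum linear0.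
  rewrite linear_sum; apply: eq_bigr => l _; rewrite /= linearZ /= row_mul.
  apply/rowP => q; by rewrite mxE big_ord1 !mxE.
have di : d i = 0.
  rewrite dE // (_ : ys i = 0) ?mul0mx //; apply/rowP => e; rewrite [RHS]mxE.
  by apply: (famker_independent kerD cardD sum0 (x := (i, e))); rewrite inE.
have crossi : cross (fb i) (mu i) = 0.
  by rewrite -[RHS]di /d (negbTE ne_ik) scale0r addr0.
rewrite (@dot_sl2 n (fun X => C *m (X *m h k))) //.
- apply: (cross0_orth _ crossi); first by rewrite fb_eq0.
  by rewrite -dot_fb.
- by move=> X Y /=; rewrite mulmxDl mulmxDr.
by move=> a X /=; rewrite -scalemxAl -scalemxAr.
Qed.
End Orthogonality.

(** * Changes of basis and non-commuting forms *)

Section BaseChange.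
Variables (F : fieldType) (I : finType) (n : nat).
Variables (f : I -> 'M[F]_2) (g h : I -> 'M[F]_(2, n)).
Hypothesis dec : mm_decomp f g h.

Lemma dot_mull m p q (X : 'M[F]_(p, m)) (B : 'M[F]_(m, q)) C :
  dot (X *m B) C = dot B (X^T *m C).
Proof. by rewrite /dot trmx_mul mulmxA. Qed.

Lemma dot_mulr m p q (B : 'M[F]_(m, p)) (X : 'M[F]_(p, q)) C :
  dot (B *m X) C = dot B (C *m X^T).
Proof. by rewrite /dot trmx_mul -mulmxA mxtrace_mulC mulmxA. Qed.

(** The change of basis [A -> P^T A Q^T] for the matrix, with the compensating
    changes for the input and the output. *)
Lemma mm_decomp_base (P Q : 'M[F]_2) : P \in unitmx -> Q \in unitmx ->
  mm_decomp (fun l => P *m f l *m Q) (fun l => invmx Q *m g l) (fun l => (invmx P)^T *m h l).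
Proof.
move=> uP uQ A x y.
transitivity (dot (invmx P *m y) ((P^T *m A *m Q^T) *m ((invmx Q)^T *m x))).
  rewrite -dec; apply: eq_bigr => l _.
  by rewrite dot_mulr !dot_mull trmxK mulmxA.
rewrite dot_mull !mulmxA -trmx_mul mulmxV // trmx1 mul1mx.
by rewrite -[_ *m Q^T *m _]mulmxA -trmx_mul mulVmx // trmx1 mulmx1.
Qed.

Lemma dot_mulmx_tr (u v : 'M[F]_(2, n)) (Y : 'M[F]_2) : dot u (Y *m v) = dot Y (u *m v^T).
Proof. by rewrite dotC dot_mulr dotC dotC. Qed.
End BaseChange.

Section Orthogonality.
Variables (F : fieldType) (I : finType) (n : nat).
Variables (f : I -> 'M[F]_2) (g h : I -> 'M[F]_(2, n)).
Hypothesis dec : mm_decomp f g h.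
Hypothesis rankI : #|I| = (3 * n).+1.
Hypothesis n_gt0 : (0 < n)%N.

(** The change of basis that takes [f j] to the identity reduces this to
    [orthogonality_unit]; the statement is written as an equation on the 2 x 2
    matrix [g_i h_k^T]. *)
Lemma orthogonality i j k (B C : 'M[F]_2) : i != j -> k != j -> i != k -> f j \in unitmx ->
  dot (f j) B = 0 -> dot (f i) B = 0 -> dot (f j) C = 0 -> dot (f k) C = 0 ->
  let J := (f j)^T in dot (J *m C *m J *m B *m J) (g i *m (h k)^T) = 0.
Proof.
move=> ne_ij ne_kj ne_ik uj jB iB jC kC J.
have uQ : invmx (f j) \in unitmx by rewrite unitmx_inv.
have dec' := mm_decomp_base dec (unitmx1 _ _) uQ.
have fj1 : 1%:M *m f j *m invmx (f j) = 1%:M by rewrite mul1mx mulmxV.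
have JQ : J *m (invmx (f j))^T = 1%:M by rewrite -trmx_mul mulVmx // trmx1.
have red l X : dot (f l) X = 0 -> dot (1%:M *m f l *m invmx (f j)) (X *m J) = 0.
  by rewrite mul1mx dot_mulr -mulmxA JQ mulmx1.
have trX X : dot (f j) X = 0 -> \tr (X *m J) = 0 by rewrite mxtrace_mulC.
have H := orthogonality_unit dec' rankI n_gt0 fj1 ne_ij ne_kj ne_ik
  (trX _ jB) (trX _ jC) (red _ _ iB) (red _ _ kC).
rewrite invmxK dot_mull -/J invmx1 trmx1 mul1mx in H.
by rewrite -dot_mulmx_tr -[RHS]H !mulmxA.
Qed.

End Orthogonality.

Section Mx2.
Variable F : fieldType.

Lemma mx2_eta (A : 'M[F]_2) : A = mx2 (A 0 0) (A 0 1) (A 1 0) (A 1 1).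
Proof. by apply: mx2P; rewrite mx2entries. Qed.

Lemma mx2_mul (a b c d x y z t : F) : mx2 a b c d *m mx2 x y z t =
  mx2 (a * x + b * z) (a * y + b * t) (c * x + d * z) (c * y + d * t).
Proof. by apply: mx2P; rewrite mulmx2E !mx2entries. Qed.

Lemma mx2_add (a b c d x y z t : F) :
  mx2 a b c d + mx2 x y z t = mx2 (a + x) (b + y) (c + z) (d + t).
Proof. by apply: mx2P; rewrite mxE !mx2entries. Qed.

Lemma mx2_opp (a b c d : F) : - mx2 a b c d = mx2 (- a) (- b) (- c) (- d).
Proof. by apply: mx2P; rewrite mxE !mx2entries. Qed.

Lemma mx2_tr (a b c d : F) : (mx2 a b c d)^T = mx2 a c b d.
Proof. by apply: mx2P; rewrite mxE !mx2entries. Qed.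

Lemma mx2_scalar (x : F) : x%:M = mx2 x 0 0 x.
Proof. by apply: mx2P; rewrite !mxE /= ?mulr1n ?mulr0n. Qed.

Lemma mx2_scale (k a b c d : F) : k *: mx2 a b c d = mx2 (k * a) (k * b) (k * c) (k * d).
Proof. by apply: mx2P; rewrite mxE !mx2entries. Qed.

Lemma mx2_trace (a b c d : F) : \tr (mx2 a b c d) = a + d.
Proof. by rewrite mxtrace2 !mx2entries. Qed.

Lemma mx2_det (a b c d : F) : \det (mx2 a b c d) = a * d - b * c.
Proof. by rewrite det2E !mx2entries. Qed.

Lemma mx2_dot (a b c d x y z t : F) :
  dot (mx2 a b c d) (mx2 x y z t) = a * x + b * y + c * z + d * t.
Proof. by rewrite dot2E !mx2entries. Qed.

Definition mx2_simp := (mx2_mul, mx2_add, mx2_opp, mx2_tr, mx2_scalar, mx2_scale,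
  mx2_trace, mx2_det, mx2_dot).

(** An instance of [J Z J = tr (J Z) J - det J adj Z], where [adj Z = - Z] for a
    traceless [Z]. *)
Lemma mulmx_sandwich (J Z : 'M[F]_2) : \tr Z = 0 -> dot J^T Z = 0 ->
  J *m Z *m J = \det J *: Z.
Proof.
move=> /traceless zt JZ; transitivity (dot J^T Z *: J + \det J *: Z); last by rewrite JZ scale0r add0r.
rewrite (mx2_eta J) (mx2_eta Z) zt !mx2_simp; congr mx2; ring.
Qed.

Lemma mulmx_traceless (Z : 'M[F]_2) : \tr Z = 0 -> Z *m Z = - \det Z *: 1%:M.
Proof.
by move=> /traceless zt; rewrite (mx2_eta Z) zt !mx2_simp; congr mx2; ring.
Qed.

(** The adjugate. *)
Definition adj2 (J : 'M[F]_2) := mx2 (J 1 1) (- J 0 1) (- J 1 0) (J 0 0).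

Lemma mul_adj2 (J : 'M[F]_2) : adj2 J *m J = \det J *: 1%:M.
Proof. by rewrite /adj2 (mx2_eta J) !mx2entries !mx2_simp; congr mx2; ring. Qed.

Lemma commutator_dots (J D : 'M[F]_2) : let Z := J *m D - D *m J in
  [/\ \tr Z = 0, dot J^T Z = 0, dot D^T Z = 0, dot J^T (J *m Z) = 0 & \tr (J *m Z) = 0].
Proof.
by rewrite /= (mx2_eta J) (mx2_eta D); split; rewrite !mx2_simp; ring.
Qed.

Lemma commutator_adj_dots (J D : 'M[F]_2) : let Z := J *m D - D *m J in
  dot J^T (Z *m D *m adj2 J) = 0 /\ dot D^T (Z *m D *m adj2 J) = 0.
Proof.
by rewrite /= /adj2 (mx2_eta J) (mx2_eta D) !mx2entries; split; rewrite !mx2_simp; ring.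
Qed.

Lemma row3Z (k x y z : F) : k *: row3 x y z = row3 (k * x) (k * y) (k * z).
Proof. by apply: rV3P; rewrite mxE !row3E. Qed.

Lemma row3B (x y z x' y' z' : F) :
  row3 x y z - row3 x' y' z' = row3 (x - x') (y - y') (z - z').
Proof. by apply: rV3P; rewrite mxE [X in _ + X = _]mxE !row3E. Qed.

(** The matrices [1], [D], [J] and [J D] are linearly independent when [J] and [D]
    have no common eigenvector, even over an extension of the field; the
    determinant of their coordinates is [det (J D - D J)] up to sign. *)
Lemma commutator_span (J D w : 'M[F]_2) : \det (J *m D - D *m J) != 0 ->
  dot 1%:M w = 0 -> dot D w = 0 -> dot J w = 0 -> dot (J *m D) w = 0 -> w = 0.
Proof.
rewrite (mx2_eta J) (mx2_eta D) (mx2_eta w).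
move: (J 0 0) (J 0 1) (J 1 0) (J 1 1) => j0 j1 j2 j3.
move: (D 0 0) (D 0 1) (D 1 0) (D 1 1) => d0 d1 d2 d3.
move: (w 0 0) (w 0 1) (w 1 0) (w 1 1) => x y z t; rewrite !mx2_simp => nzZ xt.
have -> : t = - x by apply/eqP; rewrite -addr_eq0 addrC -[X in _ == X]xt; apply/eqP; ring.
move=> Dw Jw JDw; pose W := row3 x y z; pose u := row3 (d0 - d3) d1 d2.
pose v := row3 (j0 - j3) j1 j2.
pose m := row3 (j0 * d0 + j1 * d2 - (j2 * d1 + j3 * d3)) (j0 * d1 + j1 * d3) (j2 * d0 + j3 * d2).
have uW : dot W u = 0 by rewrite dot3E !row3E -[RHS]Dw; ring.
have vW : dot W v = 0 by rewrite dot3E !row3E -[RHS]Jw; ring.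
have mW : dot W m = 0 by rewrite dot3E !row3E -[RHS]JDw; ring.
have [W0|nzW] := eqVneq W 0.
  have := row3E x y z; rewrite -/W W0 !mxE => -[[<- <-] <-]; rewrite oppr0.
  by apply: mx2P; rewrite !mx2entries mxE.
have cW : cross W (cross u v) = 0.
  have -> : cross W (cross u v) = dot W v *: u - dot W u *: v.
    by rewrite !dot3E /cross !row3E /W /u /v !row3Z row3B; congr row3; ring.
  by rewrite uW vW !scale0r subr0.
case/eqP: nzZ; have := cross0_orth nzW cW mW; rewrite dot3E !row3E => E.
rewrite -[RHS]E; ring.
Qed.

End Mx2.

Section Vanishing.
Variables (F : fieldType) (I : finType) (n : nat).
Variables (f : I -> 'M[F]_2) (g h : I -> 'M[F]_(2, n)).
Hypothesis dec : mm_decomp f g h.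
Hypothesis rankI : #|I| = (3 * n).+1.
Hypothesis n_gt0 : (0 < n)%N.

Lemma dotZl (k : F) m p (B C : 'M[F]_(m, p)) : dot (k *: B) C = k * dot B C.
Proof. by rewrite dotC dotZr dotC. Qed.

Lemma dotDl m p (B C D : 'M[F]_(m, p)) : dot (B + C) D = dot B D + dot C D.
Proof. by rewrite dotC dotDr !(dotC D). Qed.

(** The commutator [Z] and [Z D adj J] are admissible choices of [B], while [Z] and
    [J Z] are admissible choices of [C]: the four products [J C J B J] are
    nonzero multiples of [J], [J^2], [D] and [J D], by [mulmx_sandwich] and since
    [Z^2] is scalar. *)
Lemma commutator_vanish i j k : i != j -> k != j -> i != k ->
  f k = 1%:M -> f j \in unitmx ->
  \det ((f j)^T *m (f i)^T - (f i)^T *m (f j)^T) != 0 -> g i *m (h k)^T = 0.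
Proof.
move=> ne_ij ne_kj ne_ik fk1 uj; set J := (f j)^T; set D := (f i)^T; set Z := _ - _ => nzZ.
have [trZ JZ DZ JJZ trJZ] := commutator_dots J D.
have [JB DB] := commutator_adj_dots J D; rewrite -/Z in trZ JZ DZ JJZ trJZ JB DB.
have nzJ : \det J != 0 by rewrite det_tr -unitfE -unitmxE.
have orth B C : dot J^T B = 0 -> dot D^T B = 0 -> dot J^T C = 0 -> \tr C = 0 ->
    dot (J *m C *m J *m B *m J) (g i *m (h k)^T) = 0.
  rewrite !trmxK => jB iB jC trC; apply: orthogonality => //.
  by rewrite /dot fk1 trmx1 mul1mx.
set w := g i *m _ in orth *.
have JZJ := mulmx_sandwich trZ JZ; have ZZ := mulmx_traceless trZ.
have wJ : dot J w = 0.
  have := orth Z Z JZ DZ JZ trZ.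
  rewrite JZJ -!scalemxAl ZZ -!scalemxAl mul1mx !dotZl => /eqP.
  by rewrite !mulf_eq0 oppr_eq0 (negbTE nzJ) (negbTE nzZ) => /eqP.
have wJJ : dot (J *m J) w = 0.
  have := orth Z (J *m Z) JZ DZ JJZ trJZ.
  have -> : J *m (J *m Z) *m J *m Z *m J = J *m (J *m Z *m J) *m (Z *m J) by rewrite !mulmxA.
  rewrite JZJ -scalemxAr -scalemxAl; have -> : J *m Z *m (Z *m J) = J *m (Z *m Z) *m J.
    by rewrite !mulmxA.
  rewrite ZZ -scalemxAr mulmx1 -scalemxAl !dotZl => /eqP.
  by rewrite !mulf_eq0 oppr_eq0 (negbTE nzJ) (negbTE nzZ) => /eqP.
have w1 : dot 1%:M w = 0.
  have E : \det J *: 1%:M = \tr J *: J - J *m J :> 'M[F]_2.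
    by rewrite (mx2_eta J) !mx2_simp; congr mx2; ring.
  apply: (mulfI nzJ); rewrite mulr0 -dotZl E dotDl dotZl wJ -scaleN1r dotZl wJJ.
  by rewrite !mulr0 addr0.
have adjJ := mul_adj2 J.
have wD : dot D w = 0.
  have := orth _ Z JB DB JZ trZ; rewrite JZJ.
  have -> : \det J *: Z *m (Z *m D *m adj2 J) *m J = \det J *: (Z *m Z *m D *m (adj2 J *m J)).
    by rewrite -!scalemxAl !mulmxA.
  rewrite adjJ ZZ -scalemxAr mulmx1 -scalemxAl mul1mx !dotZl => /eqP.
  by rewrite !mulf_eq0 oppr_eq0 (negbTE nzJ) (negbTE nzZ) => /eqP.
have wJD : dot (J *m D) w = 0.
  have := orth _ (J *m Z) JB DB JJZ trJZ.
  have -> : J *m (J *m Z) *m J *m (Z *m D *m adj2 J) *m J =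
      J *m (J *m Z *m J) *m (Z *m D *m (adj2 J *m J)) by rewrite !mulmxA.
  rewrite adjJ JZJ -!scalemxAr -!scalemxAl mulmx1.
  have -> : J *m Z *m (Z *m D) = J *m (Z *m Z) *m D by rewrite !mulmxA.
  rewrite ZZ -scalemxAr mulmx1 -scalemxAl !dotZl => /eqP.
  by rewrite !mulf_eq0 oppr_eq0 (negbTE nzJ) (negbTE nzZ) => /eqP.
exact: (commutator_span nzZ).
Qed.
End Vanishing.

(** * Triangular forms *)

Lemma scale_mxE (F : fieldType) m n (k : F) (A : 'M[F]_(m, n)) i j :
  (k *: A) i j = k * A i j.
Proof. exact: mxE. Qed.

Section Eigen.
Variable F : fieldType.
Implicit Types (M : 'M[F]_2) (b c v : 'cV[F]_2).

Definition col2 (x y : F) : 'cV[F]_2 := \col_i (if i == 0 then x else y).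

Lemma col2E x y : (col2 x y 0 0 = x) * (col2 x y 1 0 = y).
Proof. by rewrite !mxE. Qed.

Lemma cv2_eq v b : v 0 0 = b 0 0 -> v 1 0 = b 1 0 -> v = b.
Proof. by move=> e0 e1; apply/colP => i; case: (ord2P i) => ->. Qed.

Lemma eigen_entries M v l : M *m v = l *: v ->
  M 0 0 * v 0 0 + M 0 1 * v 1 0 = l * v 0 0 /\ M 1 0 * v 0 0 + M 1 1 * v 1 0 = l * v 1 0.
Proof.
by move=> /colP E; have := E 0; have := E 1; rewrite !scale_mxE !mul_cv2E.
Qed.

Lemma sub_scalar_entries M l : M - l%:M = mx2 (M 0 0 - l) (M 0 1) (M 1 0) (M 1 1 - l).
Proof. by rewrite {1}(mx2_eta M) !mx2_simp; congr mx2; ring. Qed.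

Lemma eigen_kernel M v l : M *m v = l *: v -> (M - l%:M) *m v = 0.
Proof. by rewrite mulmxBl mul_scalar_mx => ->; rewrite subrr. Qed.

Lemma eigen_det M v l : v != 0 -> M *m v = l *: v -> \det M = l * (\tr M - l).
Proof.
move=> nzv /eigen_kernel Mv; have dl : \det (M - l%:M) = 0.
  by apply: contraNeq nzv => nzd; apply/eqP; apply: (det_neq0_inj nzd).
apply/eqP; rewrite -subr_eq0; apply/eqP; rewrite -[RHS]dl sub_scalar_entries.
by rewrite mx2_det det2E mxtrace2; ring.
Qed.

Lemma other_eigenvector M v l : v != 0 -> M *m v = l *: v ->
  exists2 c : 'cV[F]_2, c != 0 & M *m c = (\tr M - l) *: c.
Proof.
move=> nzv Mv; have dM := eigen_det nzv Mv; pose m := \tr M - l.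
have [|c nzc Mc] := @det0_kernel F (M - m%:M); last first.
  exists c => //; apply/eqP; rewrite -subr_eq0 -mul_scalar_mx -mulmxBl; exact/eqP.
apply/eqP; rewrite -subr_eq0; apply/eqP.
transitivity (\det M - l * (\tr M - l)); last by rewrite dM subrr.
by rewrite sub_scalar_entries mx2_det det2E /m mxtrace2; ring.
Qed.

Lemma eigenvectors_independent M b c l m : b != 0 -> c != 0 -> l != m ->
  M *m b = l *: b -> M *m c = m *: c -> b 0 0 * c 1 0 - c 0 0 * b 1 0 != 0.
Proof.
move=> nzb nzc ne_lm Mb Mc; apply: contra ne_lm => /eqP d0.
have [s nzs cE] : exists2 s, s != 0 & perp c = s *: perp b.
  by apply: orth_perp => //; [exact: perp_neq0|rewrite perpE0 perpE1 -[RHS]oppr0 -d0; ring].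
have {}cE : c = s *: b.
  move/colP: cE => cE; have := cE 0; have := cE 1.
  rewrite !scale_mxE !perpE0 !perpE1 mulrN => c0 /oppr_inj c1.
  by apply: cv2_eq; rewrite mxE.
rewrite -subr_eq0; apply: contraNT nzc => ne_lm.
have : (l - m) *: c = 0 by rewrite scalerBl -Mc cE -scalemxAr Mb scalerA [l * s]mulrC -scalerA subrr.
by move/eqP; rewrite scaler_eq0 (negbTE ne_lm).
Qed.

Lemma diagonalize M b c l m : b 0 0 * c 1 0 - c 0 0 * b 1 0 != 0 ->
  M *m b = l *: b -> M *m c = m *: c ->
  let S := mx2 (b 0 0) (c 0 0) (b 1 0) (c 1 0) in
  S \in unitmx /\ invmx S *m M *m S = mx2 l 0 0 m.
Proof.
move=> nzd Mb Mc S; have uS : S \in unitmx by rewrite unitmxE unitfE mx2_det.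
split=> //; rewrite -mulmxA -[RHS](mulKmx uS); congr (_ *m _).
have [b0 b1] := eigen_entries Mb; have [c0 c1] := eigen_entries Mc.
rewrite (mx2_eta M) /S !mx2_simp; congr mx2; rewrite ?b0 ?b1 ?c0 ?c1; ring.
Qed.
End Eigen.

Section Vanishing.
Variables (F : fieldType) (I : finType) (n : nat).
Variables (f : I -> 'M[F]_2) (g h : I -> 'M[F]_(2, n)).
Hypothesis dec : mm_decomp f g h.
Hypothesis rankI : #|I| = (3 * n).+1.
Hypothesis n_gt0 : (0 < n)%N.
Variables (i k : I).
Hypothesis fk1 : f k = 1%:M.
Hypothesis ne_ik : i != k.

(** Otherwise the line from the identity [f k] to [f i] contains the nilpotent
    matrix [f i - l], where it is tangent to the quadric. *)
Lemma distinct_eigenvalues l (v : 'cV[F]_2) : v != 0 -> f i *m v = l *: v ->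
  \tr (f i) - l != l.
Proof.
move=> nzv fiv; apply: contra ne_ik => /eqP tr2.
have nza := perp_neq0 nzv; pose N := f i - l%:M.
have Nv : N *m v = 0 by apply: eigen_kernel.
have Na : N^T *m perp v = 0.
  have [e0 e1] := mul2_eq0 Nv; move: e0 e1.
  rewrite /N sub_scalar_entries !mx2_simp !mx2entries => e0 e1.
  have t1 : f i 1 1 - l = - (f i 0 0 - l).
    by apply/eqP; rewrite -subr_eq0 -{2}tr2 mxtrace2; apply/eqP; ring.
  apply: cv2P; rewrite mul_cv2E !mx2entries perpE0 perpE1.
    by rewrite -[RHS]e1 t1; ring.
  by rewrite -[RHS]oppr0 -[in RHS]e0 t1; ring.
have [||A [uA tang oneA]] := @exists_tangent F 1%:M (perp v) v nza nzv.
- by rewrite bil2E !perpE0 !perpE1 !mxE /= ?mulr1n ?mulr0n; ring.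
- by rewrite trmx1 !mul1mx (negbTE nzv) (negbTE nza).
have NA := tangent_dot0 nza nzv Nv Na tang.
have fiE : f i = N + l *: 1%:M by rewrite scalemx1 /N subrK.
apply/eqP; apply: (tangent_line_inj dec rankI nza nzv uA tang).
- by rewrite /bil -mulmxA fiv -scalemxAr mxE mul_cv2E !mxE /=; ring.
- by rewrite fiE dotDl dotZl NA oneA mulr0 addr0.
- by rewrite fk1 bil2E !perpE0 !perpE1 !mxE /= ?mulr1n ?mulr0n; ring.
by rewrite fk1.
Qed.
End Vanishing.

Section Triangular.
Variables (F : fieldType) (I : finType) (n : nat).
Variables (f : I -> 'M[F]_2) (g h : I -> 'M[F]_(2, n)).
Hypothesis dec : mm_decomp f g h.
Hypothesis rankI : #|I| = (3 * n).+1.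
Hypothesis n_gt0 : (0 < n)%N.
Variables (i k : I) (a1 a2 : F).
Hypothesis fk1 : f k = 1%:M.
Hypothesis fi : f i = mx2 a1 0 0 a2.
Hypothesis ne_a : a1 != a2.
Let w := g i *m (h k)^T.
Hypothesis nzw : w != 0.

(** If the upper right entry were nonzero, the commutator with [f i] would be
    invertible, against [commutator_vanish].  For triangular [f j] the equations
    of [orthogonality] are explicit.  The coefficients on the left-hand sides are
    nonzero, since otherwise [f j] would be on a tangent line with [f k] or
    [f i], unless [a1] or [a2] is zero and the claim is clear.  Hence the entry
    [w 0 1] determines [w]. *)
Lemma lower_entries j : \det (f j) != 0 -> f j 1 0 != 0 ->
  [/\ f j 0 1 = 0, w 0 1 != 0, (f j 1 1 - f j 0 0) * w 1 1 = - f j 1 0 * w 0 1 &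
      (f j 1 1 * a1 - f j 0 0 * a2) * w 0 0 = f j 1 0 * a2 * w 0 1].
Proof.
move=> nzd nzq.
have ne_ik : i != k.
  apply: contra ne_a => /eqP ik; have := fi; rewrite ik fk1 mx2_scalar => /matrixP E.
  by have := E 0 0; have := E 1 1; rewrite !mx2entries => <- <-.
have ne_ij : i != j by apply: contra nzq => /eqP <-; rewrite fi mx2entries.
have ne_kj : k != j by apply: contra nzq => /eqP <-; rewrite fk1 mxE.
have uj : f j \in unitmx by rewrite unitmxE unitfE.
have p0 : f j 0 1 = 0.
  apply: contraNeq nzw => nzp; apply/eqP.
  apply: (commutator_vanish dec rankI n_gt0 ne_ij ne_kj ne_ik fk1 uj).
  rewrite fi {1 2}(mx2_eta (f j)) !mx2_simp.
  have -> : forall x y p q : F, (x * a1 + q * 0 - (a1 * x + 0 * p)) * (p * 0 + y * a2 - (0 * q + a2 * y))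
     - (x * 0 + q * a2 - (a1 * q + 0 * y)) * (p * a1 + y * 0 - (0 * x + a2 * p)) =
     p * q * (a1 - a2) ^+ 2 by move=> x y p q; ring.
  by rewrite !mulf_neq0 // subr_eq0.
have fjE : f j = mx2 (f j 0 0) 0 (f j 1 0) (f j 1 1) by rewrite -p0 -mx2_eta.
move: nzd nzq fjE; set x := f j 0 0; set q := f j 1 0; set y := f j 1 1 => nzd nzq fjE.
have := nzd; rewrite {1}fjE mx2_det mul0r subr0 mulf_eq0 negb_or => /andP[nzx nzy].
set c := y - x; set b := y * a1 - x * a2.
have nzc : c != 0.
  have e2 : col2 0 1 != 0 :> 'cV[F]_2 by rewrite cv2_neq0 !col2E oner_eq0 orbT.
  have fje : f j *m col2 0 1 = y *: col2 0 1.
    rewrite fjE; apply: cv2_eq; rewrite mul_cv2E [RHS]mxE !mx2entries !col2E; ring.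
  have ne_jk : j != k by rewrite eq_sym.
  have := distinct_eigenvalues dec rankI fk1 ne_jk e2 fje.
  rewrite {1}fjE mx2_trace addrK; apply: contra => /eqP c0.
  by rewrite eq_sym -subr_eq0 -/c c0.
have nzb : b != 0.
  have [a10|nza1] := eqVneq a1 0.
    by rewrite /b a10 mulr0 sub0r oppr_eq0 mulf_neq0 // eq_sym -a10.
  have [a20|nza2] := eqVneq a2 0; first by rewrite /b a20 mulr0 subr0 mulf_neq0.
  apply: contra ne_ij => /eqP b0; apply/eqP.
  have nz0 : col2 1 0 != 0 :> 'cV[F]_2 by rewrite cv2_neq0 !col2E oner_eq0.
  have nz1 : col2 0 1 != 0 :> 'cV[F]_2 by rewrite cv2_neq0 !col2E oner_eq0 orbT.
  apply: (tangent_line_inj dec rankI (A := mx2 a2 0 0 (- a1)) nz0 nz1).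
  - by rewrite unitmxE unitfE mx2_det mul0r subr0 mulrN oppr_eq0 mulf_neq0.
  - by rewrite bil2E !perpE0 !perpE1 !mx2entries !col2E; ring.
  - by rewrite bil2E fi !mx2entries !col2E; ring.
  - by rewrite fi mx2_dot; ring.
  - by rewrite bil2E fjE !mx2entries !col2E; ring.
  by rewrite fjE mx2_dot; transitivity (- b); [rewrite /b; ring|rewrite b0 oppr0].
have orth B C : dot (f j) B = 0 -> dot (f i) B = 0 -> dot (f j) C = 0 -> \tr C = 0 ->
    dot ((f j)^T *m C *m (f j)^T *m B *m (f j)^T) w = 0.
  move=> jB iB jC trC; apply: orthogonality => //.
  by rewrite /dot fk1 trmx1 mul1mx.
pose B0 := mx2 (q * a2) 0 b (- (q * a1)); pose C0 := mx2 q 0 c (- q).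
pose E12 : 'M[F]_2 := mx2 0 1 0 0.
have B0j : dot (f j) B0 = 0 by rewrite fjE mx2_dot /b; ring.
have B0i : dot (f i) B0 = 0 by rewrite fi mx2_dot; ring.
have C0j : dot (f j) C0 = 0 by rewrite fjE mx2_dot /c; ring.
have C0t : \tr C0 = 0 by rewrite mx2_trace subrr.
have Ej : dot (f j) E12 = 0 by rewrite fjE mx2_dot; ring.
have Ei : dot (f i) E12 = 0 by rewrite fi mx2_dot; ring.
have Et : \tr E12 = 0 by rewrite mx2_trace addr0.
(* The pairs (E12, C0), (B0, E12) and (B0, C0) give one equation each; the pair
   (E12, E12) gives nothing. *)
have e1 : c * w 1 1 = - q * w 0 1.
  have := orth _ _ Ej Ei C0j C0t; rewrite fjE (mx2_eta w) !mx2_simp !mx2entries => E.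
  apply/eqP; rewrite -subr_eq0; apply/eqP; have nzxyy : x * y * y != 0 by rewrite !mulf_neq0.
  by apply: (mulfI nzxyy); rewrite mulr0 -[RHS]E /c; ring.
have e2 : b * w 0 0 = q * a2 * w 0 1.
  have := orth _ _ B0j B0i Ej Et; rewrite fjE (mx2_eta w) !mx2_simp !mx2entries => E.
  apply/eqP; rewrite -subr_eq0; apply/eqP; have nzxyy : x * y * x != 0 by rewrite !mulf_neq0.
  by apply: (mulfI nzxyy); rewrite mulr0 -[RHS]E /b; ring.
have e3 : x * y * (a1 - a2) * w 1 0 = q * a2 * (x * w 0 0 + q * w 0 1 + y * w 1 1).
  have := orth _ _ B0j B0i C0j C0t; rewrite fjE (mx2_eta w) !mx2_simp !mx2entries => E.
  apply/eqP; rewrite -subr_eq0; apply/eqP; have nzxyq : - (x * y * q) != 0 by rewrite oppr_eq0 !mulf_neq0.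
  by apply: (mulfI nzxyq); rewrite mulr0 -[RHS]E /b /c; ring.
split=> //; apply: contra nzw => /eqP w01; apply/eqP.
have w11 : w 1 1 = 0 by apply: (mulfI nzc); rewrite e1 w01 !mulr0.
have w00 : w 0 0 = 0 by apply: (mulfI nzb); rewrite e2 w01 !mulr0.
have w10 : w 1 0 = 0.
  have nz : x * y * (a1 - a2) != 0 by rewrite !mulf_neq0 // subr_eq0.
  by apply: (mulfI nz); rewrite e3 w00 w01 w11 !mulr0 !addr0 mulr0.
by apply: mx2P; rewrite [RHS]mxE.
Qed.

(** By [lower_entries] the ratios of the entries of [w] determine the entries of
    the form up to a scalar, and [form_independent] applies. *)
Lemma strictly_lower_unique j1 j2 : a2 != 0 ->
  \det (f j1) != 0 -> f j1 1 0 != 0 -> \det (f j2) != 0 -> f j2 1 0 != 0 -> j1 = j2.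
Proof.
move=> nza2 d1 q1 d2 q2.
have [p1 w01 c1 b1] := lower_entries d1 q1; have [p2 _ c2 b2] := lower_entries d2 q2.
have nza : a1 - a2 != 0 by rewrite subr_eq0.
have w11 : w 1 1 != 0.
  apply: contra w01 => /eqP w0; move/eqP: c1; rewrite w0 mulr0 eq_sym mulf_eq0 oppr_eq0.
  by rewrite (negbTE q1).
have w00 : w 0 0 != 0.
  apply: contra w01 => /eqP w0; move/eqP: b1; rewrite w0 mulr0 eq_sym !mulf_eq0.
  by rewrite (negbTE q1) (negbTE nza2).
set x1 := f j1 0 0 in c1 b1; set y1 := f j1 1 1 in c1 b1; set r1 := f j1 1 0 in c1 b1 q1.
set x2 := f j2 0 0 in c2 b2; set y2 := f j2 1 1 in c2 b2; set r2 := f j2 1 0 in c2 b2 q2.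
have cc : r1 * (y2 - x2) = r2 * (y1 - x1).
  apply: (mulIf w11); rewrite -!mulrA c1 c2; ring.
have bb : r1 * (y2 * a1 - x2 * a2) = r2 * (y1 * a1 - x1 * a2).
  apply: (mulIf w00); rewrite -!mulrA b1 b2; ring.
have yy : r1 * y2 = r2 * y1.
  apply: (mulIf nza).
  transitivity (r1 * (y2 * a1 - x2 * a2) - a2 * (r1 * (y2 - x2))); first by ring.
  by rewrite bb cc; ring.
have xx : r1 * x2 = r2 * x1.
  transitivity (r1 * y2 - r1 * (y2 - x2)); first by ring.
  by rewrite yy cc; ring.
apply: (form_independent dec rankI) => A A2; apply: (mulfI q2); rewrite mulr0.
transitivity (r1 * dot (f j2) A); last by rewrite A2 mulr0.
rewrite !dot2E p1 p2 -/x1 -/y1 -/r1 -/x2 -/y2 -/r2 !mulrDr !mulrA xx yy; ring.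
Qed.
End Triangular.

(** * Vanishing of the products of the other two factors *)

Section Unit.
Variables (F : fieldType) (I : finType) (n : nat).
Variables (f : I -> 'M[F]_2) (g h : I -> 'M[F]_(2, n)).
Hypothesis dec : mm_decomp f g h.
Hypothesis rankI : #|I| = (3 * n).+1.
Hypothesis n_gt0 : (0 < n)%N.

(** The [2n] coordinates of the input can be recovered from the output, to which
    only the counted terms contribute. *)
Lemma invertible_card (A : 'M[F]_2) : A \in unitmx ->
  (2 * n <= #|[set l | dot (f l) A != 0%R]|)%N.
Proof.
move=> uA; pose c l : 'cV[F]_(2 * n) := dot (f l) A *: (mxvec (g l))^T.
apply: (@count_inj F I n h _ _ c (fun u => A *m vec_mx u)).
- by move=> l; rewrite inE negbK /c => /eqP ->; rewrite scale0r.
- move=> u y; rewrite -dec; apply: eq_bigr => l _; congr (_ * _).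
  by rewrite /c -scalemxAr scale_mxE; congr (_ * _); rewrite dotC -mxvec_dot vec_mxK.
by move=> u Au; rewrite -[u]vec_mxK -[vec_mx u](mulKmx uA) Au mulmx0 linear0.
Qed.

Variables (i k : I).
Hypothesis fk1 : f k = 1%:M.
Hypothesis ne_ik : i != k.
Hypothesis nzw : g i *m (h k)^T != 0.

(** In a basis of eigenvectors of [f i] that starts with [b], the forms that move
    the line of [b] are those with a nonzero lower left entry, and
    [strictly_lower_unique] applies. *)
Lemma moving_unique b l j1 j2 : b != 0 -> f i *m b = l *: b -> \tr (f i) - l != 0 ->
  \det (f j1) != 0 -> bil (perp b) (f j1) b != 0 ->
  \det (f j2) != 0 -> bil (perp b) (f j2) b != 0 -> j1 = j2.
Proof.
move=> nzb fib nzm d1 b1 d2 b2.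
have ne_lm : l != \tr (f i) - l.
  by rewrite eq_sym; apply: (distinct_eigenvalues dec rankI fk1 ne_ik nzb fib).
have [c nzc fic] := other_eigenvector nzb fib.
have nzS := eigenvectors_independent nzb nzc ne_lm fib fic.
have [uS fS] := diagonalize nzS fib fic.
set S := mx2 _ _ _ _ in uS fS.
have uS' : invmx S \in unitmx by rewrite unitmx_inv.
have dec' := mm_decomp_base dec uS' uS.
have fk1' : invmx S *m f k *m S = 1%:M by rewrite fk1 mulmx1 mulVmx.
have nzw' : (invmx S *m g i) *m ((invmx (invmx S))^T *m h k)^T != 0.
  apply: contra nzw => /eqP w0; apply/eqP.
  have : S *m (invmx S *m g i *m ((invmx (invmx S))^T *m h k)^T) *m invmx S = 0.
    by rewrite w0 mulmx0 mul0mx.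
  by rewrite trmx_mul trmxK invmxK !mulmxA mulmxV // mul1mx -mulmxA mulmxV // mulmx1.
have Sb : S *m col2 1 0 = b.
  by apply: cv2_eq; rewrite mul_cv2E !mx2entries !col2E; ring.
have low j : bil (perp b) (f j) b != 0 -> (invmx S *m f j *m S) 1 0 != 0.
  apply: contra => /eqP q0; set f' := _ *m S in q0.
  have fjb : f j *m b = f' 0 0 *: b.
    have -> : f j *m b = S *m (f' *m col2 1 0).
      by rewrite /f' -!mulmxA Sb mulKVmx.
    have -> : f' 0 0 *: b = S *m (f' 0 0 *: col2 1 0) by rewrite -scalemxAr Sb.
    congr (_ *m _).
    by apply: cv2_eq; rewrite mul_cv2E scale_mxE !col2E ?q0; ring.
  by rewrite /bil -mulmxA fjb -scalemxAr mxE mul_cv2E !mxE /=; apply/eqP; ring.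
have det j : \det (f j) != 0 -> \det (invmx S *m f j *m S) != 0.
  by rewrite -!unitfE -!unitmxE => uj; rewrite !unitmx_mul uS' uj.
exact: (strictly_lower_unique dec' rankI n_gt0 fk1' fS ne_lm nzw' nzm
  (det _ d1) (low _ b1) (det _ d2) (low _ b2)).
Qed.

(** A traceless [Y] orthogonal to [M] satisfies [Y M = adj M Y], so that [M] acts on
    the kernel line of [Y]. *)
Lemma eigenvector_of_commutator (M N : 'M[F]_2) : M *m N - N *m M != 0 ->
  \det (M *m N - N *m M) = 0 -> exists2 v : 'cV[F]_2, v != 0 & exists l, M *m v = l *: v.
Proof.
set Y := _ - _ => nzY dY; have [v nzv Yv] := det0_kernel dY; exists v => //.
have YM : Y *m M = (\tr M *: 1%:M - M) *m Y.
  by rewrite /Y (mx2_eta M) (mx2_eta N) !mx2_simp; congr mx2; ring.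
have YMv : Y *m (M *m v) = 0 by rewrite mulmxA YM -mulmxA Yv mulmx0.
have [->|nzMv] := eqVneq (M *m v) 0; first by exists 0; rewrite scale0r.
have nzYT : Y^T != 0 by apply: contra nzY => /eqP YT; rewrite -[Y]trmxK YT trmx0.
have [||s _ ->] := tr_kernel_parallel nzYT nzMv nzv; rewrite ?trmxK //.
by exists s.
Qed.

(** First, [f i] has an eigenvector.  This is clear when its upper right entry is
    zero.  Otherwise a commutator with [f i] provides an invertible matrix at which
    all forms that commute with [f i] vanish; by [invertible_card] some form does
    not commute with [f i], and [eigenvector_of_commutator] applies to it by
    [commutator_vanish].  Now at most one form moves each of the two eigenvectors
    of [f i], by [moving_unique], while at least [2n] forms do not vanish at an
    invertible matrix orthogonal to all those that fix both. *)
Lemma all_invertible_vanish_unit : (1 < n)%N -> (forall l, \det (f l) != 0) -> False.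
Proof.
move=> n_gt1 det.
have [v nzv [l fiv]] : exists2 v : 'cV[F]_2, v != 0 & exists l, f i *m v = l *: v.
  have [p0|nzp] := eqVneq (f i 0 1) 0.
    exists (col2 0 1); first by rewrite cv2_neq0 !col2E oner_eq0 orbT.
    exists (f i 1 1); apply: cv2_eq; rewrite mul_cv2E scale_mxE !col2E ?p0; ring.
  (* This matrix is traceless and orthogonal to f i, and its determinant is minus
     the square of the upper right entry of f i. *)
  pose A0 := mx2 0 1 0 0 *m (f i)^T - (f i)^T *m mx2 0 1 0 0.
  have uA0 : A0 \in unitmx.
    rewrite unitmxE unitfE /A0 (mx2_eta (f i)) !mx2_simp.
    apply: contra nzp => /eqP E; rewrite -sqrf_eq0; apply/eqP.
    by rewrite -[RHS]oppr0 -[in RHS]E; ring.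
  have [j] : exists j, j \in [set l | dot (f l) A0 != 0].
    by apply/card_gt0P; apply: leq_trans (invertible_card uA0); lia.
  rewrite inE => nzjA; have nzY : f i *m f j - f j *m f i != 0.
    apply: contra nzjA => /eqP Y0.
    have -> : dot (f j) A0 = - (f i *m f j - f j *m f i) 0 1.
      by rewrite /A0 (mx2_eta (f i)) (mx2_eta (f j)) !mx2_simp mx2entries; ring.
    by rewrite Y0 mxE oppr0.
  apply: (eigenvector_of_commutator nzY); apply: contraNeq nzw => nzd; apply/eqP.
  apply: (commutator_vanish dec rankI n_gt0 (j := j)) => //.
  - by apply: contra nzY => /eqP <-; rewrite subrr.
  - by apply: contra nzY => /eqP <-; rewrite fk1 mulmx1 mul1mx subrr.
  - by rewrite unitmxE unitfE.
  by rewrite -!trmx_mul -linearB /= det_tr.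
have dM := eigen_det nzv fiv; have := det i; rewrite dM mulf_eq0 negb_or => /andP[nzl nzm].
have ne_lm : l != \tr (f i) - l.
  by rewrite eq_sym; apply: (distinct_eigenvalues dec rankI fk1 ne_ik nzv fiv).
have [c nzc fic] := other_eigenvector nzv fiv.
have nzS := eigenvectors_independent nzv nzc ne_lm fiv fic.
(* Its pairing with a form adds up the amounts by which the form moves the two
   eigenvectors v and c. *)
pose A0 := perp v *m v^T + perp c *m c^T.
have uA0 : A0 \in unitmx.
  rewrite unitmxE unitfE det2E /A0 !mxE !big_ord1 !mxE /=.
  set a := _ - _ in nzS; have -> : forall x, x = a ^+ 2 -> x != 0 by move=> x ->; rewrite sqrf_eq0.
    by [].
  by rewrite /a; ring.
pose M b := [set l | bil (perp b) (f l) b != 0].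
have M1 b m : b != 0 -> f i *m b = m *: b -> \tr (f i) - m != 0 -> (#|M b| <= 1)%N.
  move=> nzb fib nzm'; apply/card_le1_eqP => x y; rewrite !inE => bx by_.
  exact: (moving_unique nzb fib nzm').
have := M1 _ _ nzv fiv nzm.
have /(M1 _ _ nzc fic) : \tr (f i) - (\tr (f i) - l) != 0 by rewrite opprB addrC subrK.
have : [set l | dot (f l) A0 != 0] \subset M v :|: M c.
  apply/subsetP => j; rewrite !inE /A0 dotDr -!bil_dot -negb_and.
  by apply: contra => /andP[/eqP -> /eqP ->]; rewrite addr0.
move=> /subset_leq_card; have := invertible_card uA0; rewrite cardsU.
move: (#|[set l | _]|) => X; lia.
Qed.
End Unit.

Section Vanish.
Variables (F : fieldType) (I : finType).

(** A change of basis normalizes an invertible form without affecting [h]. *)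
Lemma unit_form n (f : I -> 'M[F]_2) (g h : I -> 'M[F]_(2, n)) k :
  mm_decomp f g h -> f k \in unitmx -> exists f' : I -> 'M[F]_2, exists g' : I -> 'M[F]_(2, n),
  [/\ mm_decomp f' g' h, f' k = 1%:M, forall l, (\det (f' l) == 0) = (\det (f l) == 0) &
      forall i, (g' i *m (h k)^T == 0) = (g i *m (h k)^T == 0)].
Proof.
move=> dec uk; have uQ : invmx (f k) \in unitmx by rewrite unitmx_inv.
exists (fun l => f l *m invmx (f k)), (fun l => f k *m g l); split.
- have := mm_decomp_base dec (unitmx1 _ _) uQ => dec' A x y; rewrite -dec'.
  by apply: eq_bigr => l _; rewrite mul1mx invmxK invmx1 trmx1 mul1mx.
- exact: mulmxV.
- move=> l; rewrite det_mulmx mulf_eq0 [X in _ || X](negbTE _) ?orbF //.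
  by rewrite -unitfE -unitmxE.
move=> i; rewrite -mulmxA; apply/eqP/eqP => [E|->]; last by rewrite mulmx0.
by rewrite -[LHS](mulKmx uk) E mulmx0.
Qed.

Lemma all_invertible_vanish n (f : I -> 'M[F]_2) (g h : I -> 'M[F]_(2, n)) i k :
  mm_decomp f g h -> #|I| = (3 * n).+1 -> (1 < n)%N -> i != k ->
  (forall l, \det (f l) != 0) -> g i *m (h k)^T = 0.
Proof.
move=> dec rankI n_gt1 ne_ik det.
have uk : f k \in unitmx by rewrite unitmxE unitfE.
have [f' [g' [dec' fk1 det' w']]] := unit_form dec uk.
apply/eqP; rewrite -w'; apply: contraT => nzw; exfalso.
apply: (all_invertible_vanish_unit dec' rankI _ fk1 ne_ik nzw) => //; first exact: ltnW.
by move=> l; rewrite det'.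
Qed.

(** The kernel of [f i] is an eigenvector, and [two_rank_two_terms] gives two forms
    that move it: [moving_unique] forbids this. *)
Lemma rank_one_vanish (f : I -> 'M[F]_2) (g h : I -> 'M[F]_(2, 4)) i k :
  mm_decomp f g h -> #|I| = 13%N -> \det (f i) = 0 -> \det (f k) != 0 ->
  g i *m (h k)^T = 0.
Proof.
move=> dec rankI di dk; have uk : f k \in unitmx by rewrite unitmxE unitfE.
have [f' [g' [dec' fk1 det' w']]] := unit_form dec uk.
apply/eqP; rewrite -w'; apply: contraT => nzw.
have ne_ik : i != k by apply: contra dk => /eqP <-; rewrite di.
have [|b nzb fib] := @det0_kernel F (f' i); first by apply/eqP; rewrite det' di.
have [j1 [j2 [ne_j d1 d2 b1 b2]]] := two_rank_two_terms rankI dec' (perp_neq0 nzb) nzb fib.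
have fib0 : f' i *m b = 0 *: b by rewrite scale0r.
have nzt := distinct_eigenvalues dec' (n := 4) rankI fk1 ne_ik nzb fib0.
case/eqP: ne_j.
exact: (moving_unique dec' (n := 4) rankI _ fk1 ne_ik nzw nzb fib0 nzt d1 b1 d2 b2).
Qed.
End Vanish.

(** * Splitting a decomposition *)

Section Splitting.
Variables (F : fieldType) (I : finType).
Implicit Types (f : I -> 'M[F]_2).

Lemma rank_lower_bound_in n f (g h : I -> 'M[F]_(2, n)) (S : {set I}) : (0 < n)%N ->
  (forall A x y, \sum_(l in S) dot (f l) A * dot (g l) x * dot (h l) y = dot y (A *m x)) ->
  (3 * n < #|S|)%N.
Proof.
move=> n_gt0 dec; rewrite -[#|S|]card_ord.
apply: (rank_lower_bound (f := fun s : 'I_#|S| => f (enum_val s))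
  (g := fun s => g (enum_val s)) (h := fun s => h (enum_val s))) => // A x y.
by rewrite -dec [RHS]big_enum_val.
Qed.

(** A term with a zero factor could be dropped, against [rank_lower_bound_in]. *)
Lemma factors_neq0 n f (g h : I -> 'M[F]_(2, n)) i : mm_decomp f g h -> (0 < n)%N ->
  #|I| = (3 * n).+1 -> (g i != 0) && (h i != 0).
Proof.
move=> dec n_gt0 rankI; rewrite -negb_or; apply/negP => gh0.
suff : (3 * n < #|[set~ i]|)%N by rewrite cardsC1 rankI ltnn.
apply: (rank_lower_bound_in (f := f) (g := g) (h := h)) => // A x y.
rewrite -dec [RHS](bigD1 i) //= [X in X + _](_ : _ = 0) ?add0r.
  by apply: eq_bigl => l; rewrite !inE.
by case/orP: gh0 => /eqP ->; rewrite [X in _ * X]dotC ?[dot 0 _]dotC dot0r ?mulr0 ?mul0r.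
Qed.

(** Let [K] be the space of rows orthogonal to all rows of the [h m] for [m] outside
    of [S]; it contains the rows of the [g l] for [l] in [S].  Outputs read in
    [K] only use the terms of [S], and inputs orthogonal to [K] only use the
    other ones.  Both restrictions are decompositions, for [dim K] and for
    [n - dim K] columns, and [factors_neq0] excludes that one of these dimensions
    is zero. *)
Lemma no_splitting n f (g h : I -> 'M[F]_(2, n)) (S : {set I}) i k :
  mm_decomp f g h -> (0 < n)%N -> #|I| = (3 * n).+1 -> i \in S -> k \notin S ->
  (forall l m, l \in S -> m \notin S -> g l *m (h m)^T = 0) -> False.
Proof.
move=> dec n_gt0 rankI iS kS gh0.
pose K : 'M[F]_n := (\bigcap_(m | m \notin S) kermx (h m)^T)%MS.
have gK l : l \in S -> (g l <= K)%MS.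
  by move=> lS; apply/sub_bigcapmxP => m mS; apply/sub_kermxP; apply: gh0.
have Kh m : m \notin S -> K *m (h m)^T = 0.
  by move=> mS; apply/sub_kermxP; apply: (@bigcapmx_inf _ _ m) => //.
have K_gt0 : (0 < \rank K)%N.
  rewrite lt0n mxrank_eq0; apply/eqP => K0; have /andP[/eqP gi0 _] := factors_neq0 i dec n_gt0 rankI.
  by apply: gi0; apply/eqP; rewrite -submx0 -K0 gK.
have K_lt : (\rank K < n)%N.
  rewrite ltn_neqAle rank_leq_row andbT; apply/negP => fullK.
  have /andP[_ /eqP hk0] := factors_neq0 k dec n_gt0 rankI; apply: hk0.
  have uK : K \in unitmx by rewrite -row_full_unit.
  by rewrite -[h k]trmxK -[(h k)^T](mulKmx uK) Kh // mulmx0 trmx0.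
have [B KB] := row_freeP (row_base_free K).
have rb0 m : m \notin S -> row_base K *m (h m)^T = 0.
  move=> mS; have /submxP[M ->] : (row_base K <= K)%MS by rewrite eq_row_base.
  by rewrite -mulmxA Kh // mulmx0.
have S_card : (3 * \rank K < #|S|)%N.
  apply: (rank_lower_bound_in (f := f) (g := fun l => g l *m B)
    (h := fun l => h l *m (row_base K)^T)) => // A x y.
  transitivity (dot (y *m row_base K) (A *m (x *m B^T))); last first.
    by rewrite dot_mulr -!mulmxA -trmx_mul KB trmx1 mulmx1.
  rewrite -dec [RHS](bigID (mem S)) /= [X in _ = _ + X]big1 ?addr0 => [|m mS].
    by apply: eq_bigr => l _; rewrite !dot_mulr trmxK.
  rewrite [X in _ * X](_ : _ = 0) ?mulr0 // -[row_base K]trmxK -dot_mulr.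
  by rewrite -[h m]trmxK -trmx_mul rb0 // trmx0 dotC dot0r.
have [C [freeC eqC]] := basis_of_rank (erefl (\rank (kermx K^T))).
have [E CE] := row_freeP freeC.
have KC : K *m C^T = 0.
  apply: (can_inj (@trmxK _ _ _)); rewrite trmx_mul trmxK trmx0; apply/sub_kermxP.
  by rewrite eqC.
have rankC : \rank (kermx K^T) = (n - \rank K)%N by rewrite mxrank_ker mxrank_tr.
have T_card : (3 * \rank (kermx K^T) < #|~: S|)%N.
  apply: (rank_lower_bound_in (f := f) (g := fun l => g l *m C^T)
    (h := fun l => h l *m E)) => [|A x y]; first by rewrite rankC subn_gt0.
  transitivity (dot (y *m E^T) (A *m (x *m C))); last first.
    by rewrite dot_mulr trmxK -!mulmxA CE mulmx1.
  rewrite -dec [RHS](bigID (mem S)) /= [X in _ = X + _]big1 ?add0r => [|m mS].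
    apply: eq_big => l; first by rewrite inE.
    by move=> _; rewrite !dot_mulr trmxK.
  rewrite [dot (g m) _](_ : _ = 0) ?mulr0 ?mul0r // -[C]trmxK -dot_mulr.
  by have /submxP[M ->] := gK m mS; rewrite -mulmxA KC mulmx0 dotC dot0r.
by have := cardsC S; rewrite rankI; lia.
Qed.
End Splitting.

Lemma no_decomposition_13 (F : fieldType) (I : finType) (f : I -> 'M[F]_2)
    (g h : I -> 'M[F]_(2, 4)) : mm_decomp f g h -> #|I| = 13%N -> False.
Proof.
move=> dec rankI; pose S := [set l | \det (f l) == 0].
have [i iS|S0] := pickP (mem S); last first.
  have det l : \det (f l) != 0 by apply/negP => dl; have := S0 l; rewrite /= inE dl.
  have /card_gt1P[i [k [_ _ ne_ik]]] : (1 < #|I|)%N by rewrite rankI.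
  apply: (no_splitting (S := [set i]) (i := i) (k := k) dec isT rankI).
  - exact: set11.
  - by rewrite inE eq_sym.
  move=> l m; rewrite !inE => /eqP -> ne_mi.
  by apply: (all_invertible_vanish dec (n := 4) rankI) => //; rewrite eq_sym.
have di : \det (f i) = 0 by move: iS; rewrite !inE => /eqP.
have [b nzb fib] := det0_kernel di.
have [k [_ [_ dk _ _ _]]] := two_rank_two_terms rankI dec nzb nzb fib.
apply: (no_splitting (S := S) (i := i) (k := k) dec isT rankI iS); first by rewrite inE.
by move=> l m; rewrite !inE => /eqP dl dm; apply: (rank_one_vanish dec).
Qed.

(** * Tensor powers, interpolation and degenerations *)

Lemma sum_of_simple_fin (F : fieldType) (K : finType) (J : K -> finType)
    (t : tensor F J) (L : finType) (u : L -> forall k : K, {ffun J k -> F}) :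
  t = \sum_(l : L) simple_tensor (u l) -> sum_of_simple t #|L|.
Proof.
move=> ->; exists (fun i => u (enum_val i)).
by rewrite -(big_enum_val (fun l => simple_tensor (u l))).
Qed.

Lemma tensor_powE (F : fieldType) (K : finType) (J : K -> finType)
    (t : tensor F J) n (x : {dffun forall ck : 'I_n * K, J ck.2}) :
  tensor_pow t n x = \prod_(c < n) t [ffun k : K => x (c, k)].
Proof. by rewrite ffunE. Qed.

Lemma simple_tensorE (F : fieldType) (K : finType) (J : K -> finType)
    (u : forall k : K, {ffun J k -> F}) (x : {dffun forall k : K, J k}) :
  simple_tensor u x = \prod_(k : K) u k (x k).
Proof. by rewrite ffunE. Qed.

Lemma sum_of_simpleE (F : fieldType) (K : finType) (J : K -> finType)
    (t : tensor F J) r :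
  sum_of_simple t r <->
  exists u : 'I_r -> forall k : K, {ffun J k -> F},
    forall x : {dffun forall k : K, J k}, t x = \sum_(l < r) \prod_k u l k (x k).
Proof.
split=> -[u Hu]; exists u.
  by move=> x; rewrite Hu sum_ffunE; apply: eq_bigr => l _; rewrite simple_tensorE.
by apply/ffunP => x; rewrite Hu sum_ffunE; apply: eq_bigr => l _; rewrite simple_tensorE.
Qed.

Lemma prod_pairE (R : comNzRingType) (I L : finType) (G : I * L -> R) :
  \prod_(p : I * L) G p = \prod_i \prod_l G (i, l).
Proof. by rewrite pair_big; apply: eq_bigr => -[]. Qed.

Lemma sum_of_simple_pow_add (F : fieldType) (K : finType) (J : K -> finType)
    (t : tensor F J) m n r s :
  sum_of_simple (tensor_pow t m) r -> sum_of_simple (tensor_pow t n) s ->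
  sum_of_simple (tensor_pow t (m + n)) (r * s).
Proof.
move=> /sum_of_simpleE[u Hu] /sum_of_simpleE[v Hv].
pose w (l : 'I_r * 'I_s) (ck : 'I_(m + n) * K) : {ffun J ck.2 -> F} :=
  match fintype.split ck.1 with
  | inl c => (u l.1 (c, ck.2) : {ffun J ck.2 -> F})
  | inr c => (v l.2 (c, ck.2) : {ffun J ck.2 -> F})
  end.
rewrite -[(r * s)%N](_ : #|{: 'I_r * 'I_s}| = _)%N; last first.
  by rewrite card_prod !card_ord.
apply: (@sum_of_simple_fin _ _ _ _ _ w); apply/ffunP => x.
rewrite tensor_powE big_split_ord /= sum_ffunE.
pose xl : {dffun forall ck : 'I_m * K, J ck.2} := [ffun ck => x (lshift n ck.1, ck.2)].
pose xr : {dffun forall ck : 'I_n * K, J ck.2} := [ffun ck => x (rshift m ck.1, ck.2)].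
have -> : \prod_(i < m) t [ffun k => x (lshift n i, k)] = tensor_pow t m xl.
  rewrite tensor_powE; apply: eq_bigr => i _; congr (t _).
  by apply/ffunP => k; rewrite !ffunE.
have -> : \prod_(i < n) t [ffun k => x (rshift m i, k)] = tensor_pow t n xr.
  rewrite tensor_powE; apply: eq_bigr => i _; congr (t _).
  by apply/ffunP => k; rewrite !ffunE.
rewrite Hu Hv big_distrlr /= pair_big /=; apply: eq_bigr => -[l1 l2] _ /=.
rewrite simple_tensorE.
rewrite (prod_pairE (fun ck => w (l1, l2) ck (x ck))) big_split_ord /=; congr (_ * _).
  rewrite (prod_pairE (fun ck => u l1 ck (xl ck))); apply: eq_bigr => c _; apply: eq_bigr => k _; rewrite /w /= ffunE.
  case: splitP => j /= eq_j; last by have := ltn_ord c; rewrite eq_j; lia.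
  by have -> : j = c by apply: val_inj.
rewrite (prod_pairE (fun ck => v l2 ck (xr ck))); apply: eq_bigr => c _; apply: eq_bigr => k _; rewrite /w /= ffunE.
case: splitP => j /= eq_j; first by have := ltn_ord j; rewrite -eq_j; lia.
by have -> : j = c by apply: val_inj; apply/eqP; rewrite -(eqn_add2l m) eq_j.
Qed.

(** The weights solve a Vandermonde system. *)
Lemma interpolation_at_0 (F : fieldType) (M : nat) (e : 'I_M -> F) :
  injective e ->
  exists c : 'I_M -> F, forall p : {poly F}, (size p <= M)%N ->
    p.[0] = \sum_(j < M) c j * p.[e j].
Proof.
move=> e_inj; pose V := Vandermonde M (\row_j e j).
have V_unit : V \in unitmx.
  rewrite unitmxE det_Vandermonde unitfE.
  apply/prodf_neq0 => i _; apply/prodf_neq0 => j lt_ij.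
  rewrite !mxE subr_eq0; apply/eqP => /e_inj eq_ji.
  by rewrite eq_ji ltnn in lt_ij.
pose c := invmx V *m \col_(i < M) ((i == 0%N :> nat)%:R : F).
have Vc : forall i : 'I_M, \sum_(j < M) e j ^+ i * c j 0 = (i == 0%N :> nat)%:R.
  move=> i; have /matrixP/(_ i 0) := mulKVmx V_unit (\col_(i < M) ((i == 0%N :> nat)%:R : F)).
  by rewrite mxE [RHS]mxE => <-; apply: eq_bigr => j _; rewrite !mxE.
exists (fun j => c j 0) => p sz_p; move: c Vc => c Vc.
under eq_bigr => j _ do rewrite (horner_coef_wide _ sz_p) mulr_sumr.
rewrite exchange_big /= (horner_coef_wide _ sz_p).
apply: eq_bigr => i _; rewrite expr0n -Vc mulr_sumr.
by apply: eq_bigr => j _; rewrite mulrA mulrC.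
Qed.


(** The entries of the power of [t + z t1] are polynomials [p] in [z] of degree at
    most [n]; interpolation at the points [e j] expresses [p.[0]] by the
    [n.+1] powers at these points. *)
Lemma sum_of_simple_pow_of_degeneration (F : fieldType) (K : finType)
    (J : K -> finType) (t t1 : tensor F J) (r n : nat) (e : 'I_n.+1 -> F) 
    (c0 : 'I_n) (k0 : K) :
  injective e ->
  (forall j, sum_of_simple ([ffun x => t x + e j * t1 x] : tensor F J) r) ->
  sum_of_simple (tensor_pow t n) (n.+1 * r ^ n).
Proof.
move=> /interpolation_at_0[c Hc] Hr.
have {Hr} /choice[u Hu] : forall j, exists u : 'I_r -> forall k : K, {ffun J k -> F},
    forall x : {dffun forall k : K, J k},
      t x + e j * t1 x = \sum_(l < r) \prod_k u l k (x k).
  move=> j; have /sum_of_simpleE[u Hu] := Hr j; exists u => x.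
  by rewrite -Hu ffunE.
pose w (l : 'I_n.+1 * {ffun 'I_n -> 'I_r}) (ck : 'I_n * K) : {ffun J ck.2 -> F} :=
  [ffun i => (if ck == (c0, k0) then c l.1 else 1) * u l.1 (l.2 ck.1) ck.2 i].
rewrite -[(n.+1 * r ^ n)%N](_ : #|{: 'I_n.+1 * {ffun 'I_n -> 'I_r}}| = _)%N; last first.
  by rewrite card_prod card_ffun !card_ord.
apply: (@sum_of_simple_fin _ _ _ _ _ w); apply/ffunP => x.
pose y (i : 'I_n) : {dffun forall k : K, J k} := [ffun k => x (i, k)].
pose p : {poly F} := \prod_(i < n) ((t (y i))%:P + t1 (y i) *: 'X).
have sz_p : (size p <= n.+1)%N.
  have -> : n.+1 = (\sum_(i < n) 1).+1 by rewrite sum1_card card_ord.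
  have sz_i i : (size ((t (y i))%:P + t1 (y i) *: 'X)%R <= 2)%N.
    rewrite (leq_trans (size_polyD _ _)) // geq_max (leq_trans (size_polyC_leq1 _)) //.
    by rewrite (leq_trans (size_scale_leq _ _)) // size_polyX.
  rewrite /p; elim/big_ind2: _ => [|p1 m1 p2 m2 H1 H2|i _]; rewrite ?size_poly1 //.
  by rewrite (leq_trans (size_polyMleq _ _)) //; lia.
have p_eval z : p.[z] = \prod_(i < n) (t (y i) + z * t1 (y i)).
  rewrite horner_prod; apply: eq_bigr => i _.
  by rewrite hornerD hornerC hornerZ hornerX mulrC.
have -> : tensor_pow t n x = p.[0].
  by rewrite tensor_powE p_eval; apply: eq_bigr => i _; rewrite mul0r addr0.
rewrite (Hc _ sz_p) sum_ffunE.
rewrite -(pair_bigA _ (fun j phi => simple_tensor (w (j, phi)) x)) /=.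
apply: eq_bigr => j _; rewrite p_eval.
have -> : \prod_(i < n) (t (y i) + e j * t1 (y i)) =
    \prod_(i < n) \sum_(l < r) \prod_k u j l k (y i k).
  by apply: eq_bigr => i _; apply: Hu.
rewrite bigA_distr_bigA mulr_sumr; apply: eq_bigr => phi _.
rewrite simple_tensorE /w /=.
under [RHS]eq_bigr => ck _ do rewrite ffunE.
rewrite big_split /= [X in _ = X * _](bigD1 (c0, k0)) //= eqxx.
rewrite [X in _ = _ * X * _]big1 ?mulr1; last first.
  by move=> ck ne_ck; rewrite (negbTE ne_ck).
rewrite pair_big /=; congr (_ * _); apply: eq_bigr => -[i k] _ /=.
by rewrite ffunE.
Qed.

(** * The entries of the matrix multiplication tensor *)

Definition leg0 : 'I_3 := @Ordinal 3 0 isT.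
Definition leg1 : 'I_3 := @Ordinal 3 1 isT.
Definition leg2 : 'I_3 := @Ordinal 3 2 isT.

Lemma prod_legs (R : comNzRingType) (G : 'I_3 -> R) :
  \prod_k G k = G leg0 * G leg1 * G leg2.
Proof.
rewrite !big_ord_recl big_ord0 mulr1 mulrA.
by congr (G _ * G _ * G _); apply: val_inj.
Qed.

(** Dependent elimination on the leg, as in [mm_factor]. *)
Definition mm_legs (F : fieldType) n1 n2 n3 (f : 'I_n1 * 'I_n2 -> F)
    (g : 'I_n2 * 'I_n3 -> F) (h : 'I_n3 * 'I_n1 -> F) (k : 'I_3) :
    {ffun mm_index n1 n2 n3 k -> F} :=
  match val k as m return
    {ffun (match m return finType with
           | 0 => ('I_n1 * 'I_n2)%type
           | 1 => ('I_n2 * 'I_n3)%type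
           | _ => ('I_n3 * 'I_n1)%type
           end) -> F}
  with
  | 0 => finfun f
  | 1 => finfun g
  | _ => finfun h
  end.

Lemma sum_of_simple_mmP (F : fieldType) n1 n2 n3
    (t : tensor F (mm_index n1 n2 n3)) r :
  sum_of_simple t r <->
  exists (f : 'I_r -> 'I_n1 * 'I_n2 -> F) (g : 'I_r -> 'I_n2 * 'I_n3 -> F)
         (h : 'I_r -> 'I_n3 * 'I_n1 -> F),
    forall x : {dffun forall k, mm_index n1 n2 n3 k},
    t x = \sum_(l < r) f l (x leg0) * g l (x leg1) * h l (x leg2).
Proof.
split=> [/sum_of_simpleE[u Hu]|[f [g [h Hfgh]]]].
  exists (fun l => u l leg0), (fun l => u l leg1), (fun l => u l leg2) => x.
  by rewrite Hu; apply: eq_bigr => l _; rewrite prod_legs.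
apply/sum_of_simpleE; exists (fun l => mm_legs (f l) (g l) (h l)) => x.
rewrite Hfgh; apply: eq_bigr => l _.
by rewrite prod_legs /mm_legs /= !ffunE.
Qed.

Lemma tensor_sumE (F : fieldType) (K I : finType) (J : K -> finType)
    (G : I -> tensor F J) (x : {dffun forall k, J k}) :
  (\sum_i G i : tensor F J) x = \sum_i G i x.
Proof. exact: sum_ffunE. Qed.

Lemma matmul_tensorE (F : fieldType) n1 n2 n3
    (x : {dffun forall k, mm_index n1 n2 n3 k}) :
  matmul_tensor F n1 n2 n3 x =
    ((x leg0).2 == (x leg1).1)%:R * ((x leg1).2 == (x leg2).1)%:R *
    ((x leg2).2 == (x leg0).1)%:R.
Proof.
have E i1 i2 i3 : simple_tensor (@mm_factor F n1 n2 n3 i1 i2 i3) x =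
    [&& i1 == (x leg0).1, i2 == (x leg0).2 & i3 == (x leg1).2]%:R *
    (((x leg0).2 == (x leg1).1)%:R * ((x leg1).2 == (x leg2).1)%:R *
    ((x leg2).2 == (x leg0).1)%:R).
  rewrite simple_tensorE prod_legs /mm_factor /= !ffunE.
  case: (x leg0) => p0 p1; case: (x leg1) => q0 q1; case: (x leg2) => r0 r1 /=.
  rewrite [i1 == _]eq_sym [i2 == _]eq_sym [i3 == _]eq_sym.
  case: eqP => [->|_]; rewrite ?mul0r //=.
  case: eqP => [->|_]; rewrite ?mulr0 ?mul0r //=.
  case: (q1 =P i3) => [->|_]; rewrite ?mulr0 ?mul0r //= !mul1r.
  by rewrite [q0 == _]eq_sym [r0 == _]eq_sym mulr1 mulrA.
have -> : matmul_tensor F n1 n2 n3 x = \sum_(i1 < n1) \sum_(i2 < n2)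
    \sum_(i3 < n3) simple_tensor (@mm_factor F n1 n2 n3 i1 i2 i3) x.
  apply: etrans (tensor_sumE _ _) _; apply: eq_bigr => i1 _.
  apply: etrans (tensor_sumE _ _) _; apply: eq_bigr => i2 _.
  exact: tensor_sumE.
rewrite (bigD1 (x leg0).1) //= [X in _ + X]big1 ?addr0; last first.
  move=> i ne_i; apply: big1 => i2 _; apply: big1 => i3 _.
  by rewrite E (negbTE ne_i) mul0r.
rewrite (bigD1 (x leg0).2) //= [X in _ + X]big1 ?addr0; last first.
  move=> i ne_i; apply: big1 => i3 _.
  by rewrite E (negbTE ne_i) andbF mul0r.
rewrite (bigD1 (x leg1).2) //= [X in _ + X]big1 ?addr0; last first.
  by move=> i ne_i; rewrite E (negbTE ne_i) !andbF mul0r.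
by rewrite E !eqxx mul1r.
Qed.

(** * An algorithm of border rank 13 *)

Section Degeneration.
Variable F : fieldType.
Implicit Types (e : F) (a : 'I_2 -> 'I_2 -> F) (b : 'I_2 -> 'I_4 -> F)
  (c : 'I_4 -> 'I_2 -> F).

Let p1 : 'I_2 := @Ordinal 2 0 isT.
Let p2 : 'I_2 := @Ordinal 2 1 isT.
Let s1 : 'I_4 := @Ordinal 4 0 isT.
Let s2 : 'I_4 := @Ordinal 4 1 isT.
Let s3 : 'I_4 := @Ordinal 4 2 isT.
Let s4 : 'I_4 := @Ordinal 4 3 isT.

(** The lists [degen_a], [degen_b] and [degen_c] give, for the 13 terms of the
    algorithm, the linear forms in the entries of the three matrices.  At [e = 0]
    four of the forms of this list become multiples of [a11], four become
    multiples of [a22], and five vanish; in the sum of the products, the parts of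
    degrees 0 and 1 in [e] cancel. *)
Definition degen_a e a : seq F :=
  let a11 := a p1 p1 in let a12 := a p1 p2 in
  let a21 := a p2 p1 in let a22 := a p2 p2 in
  [:: e * (a11 + a22); e * (a11 - a12); e * (a12 + a22); e * (a11 + a21);
      e * (a22 - a21); a11 - e * (a11 + a22); a11 - e * (a12 + a22); - a11;
      a11 - e * (a11 + a21); a22 + e * (a11 + a22); e * (a12 - a11) - a22;
      - a22; e * (a21 - a22) - a22].

Definition degen_b e b : seq F :=
  let x11 := b p1 s1 in let x12 := b p1 s2 in
  let x13 := b p1 s3 in let x14 := b p1 s4 in
  let x21 := b p2 s1 in let x22 := b p2 s2 in
  let x23 := b p2 s3 in let x24 := b p2 s4 in
  [:: e * (x14 - x23) - x12 - x21; x21 + e * x23; x21 - x22 + e * (x23 + x24);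
      x11 - x12 + e * (x13 + x14); x12 - e * x14; x21 - e ^+ 2 * (x13 + x23);
      x21; x11 + x21; x11; x12 + x22; x22; x12 + e ^+ 2 * (x14 + x24); x12].

Definition degen_c e c : seq F :=
  let y11 := c s1 p1 in let y12 := c s2 p1 in
  let y13 := c s3 p1 in let y14 := c s4 p1 in
  let y21 := c s1 p2 in let y22 := c s2 p2 in
  let y23 := c s3 p2 in let y24 := c s4 p2 in
  [:: y14 - y23 - e * (y12 + y21); y14 - y13 - e * (y11 + y12); y14 - e * y12;
      y23 + e * y21; y24 - y23 - e * (y21 + y22); y23 - y13; y13;
      y23 + e ^+ 2 * (y21 - y11); y23; y14 + e ^+ 2 * (y22 - y12); y14;
      y14 - y24; y24].

(** The part of degree 3 in [e], after which the sum stops. *)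
Definition degen_error a b c : F :=
  let a11 := a p1 p1 in let a12 := a p1 p2 in
  let a21 := a p2 p1 in let a22 := a p2 p2 in
  let x11 := b p1 s1 in let x12 := b p1 s2 in
  let x13 := b p1 s3 in let x14 := b p1 s4 in
  let x21 := b p2 s1 in let x22 := b p2 s2 in
  let x23 := b p2 s3 in let x24 := b p2 s4 in
  let y11 := c s1 p1 in let y12 := c s2 p1 in
  let y13 := c s3 p1 in let y14 := c s4 p1 in
  let y21 := c s1 p2 in let y22 := c s2 p2 in
  let y23 := c s3 p2 in let y24 := c s4 p2 in
  (a11 + a22) * ((x23 - x14) * (y12 + y21) + (x12 + x22) * (y22 - y12) +
                 (x13 + x23) * (y23 - y13)) +
  (a12 - a11) * x23 * (y11 + y12) - (a12 + a22) * (x23 + x24) * y12 +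
  (a11 + a21) * (x13 + x14) * y21 + (a22 - a21) * x14 * (y21 + y22).

Lemma degenerationE e a b c :
  \sum_(l < 13) (degen_a e a)`_l * (degen_b e b)`_l * (degen_c e c)`_l =
  e ^+ 2 * (\sum_(p < 2) \sum_(q < 2) \sum_(s < 4) a p q * b q s * c s p) +
  e ^+ 3 * degen_error a b c.
Proof.
rewrite !big_ord_recl !big_ord0.
have -> : lift ord0 (lift ord0 (lift ord0 ord0)) = s4 by apply: val_inj.
have -> : lift ord0 (lift ord0 ord0) = s3 by apply: val_inj.
have -> : lift ord0 ord0 = s2 by apply: val_inj.
have -> : lift ord0 ord0 = p2 by apply: val_inj.
have -> : ord0 = p1 by apply: val_inj.
have -> : ord0 = s1 by apply: val_inj.
rewrite /degen_a /degen_b /degen_c /degen_error /=.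
ring.
Qed.
End Degeneration.

(** * Evaluation points and the numerical gap *)

Definition unit_entry (F : fieldType) (S1 S2 : eqType) (p : S1 * S2) (i : S1) (j : S2) : F :=
  ((i, j) == p)%:R.

Lemma sum_unit_entry (F : fieldType) n1 n2 n3 (p : 'I_n1 * 'I_n2)
    (q : 'I_n2 * 'I_n3) (s : 'I_n3 * 'I_n1) :
  \sum_i \sum_j \sum_k
     unit_entry F p i j * unit_entry F q j k * unit_entry F s k i =
  (p.2 == q.1)%:R * (q.2 == s.1)%:R * (s.2 == p.1)%:R.
Proof.
case: p q s => p0 p1 [q0 q1] [s0 s1] /=; rewrite /unit_entry.
rewrite (bigD1 p0) //= [X in _ + X]big1 ?addr0; last first.
  move=> i ne_i; apply: big1 => j _; apply: big1 => k _.
  by rewrite !xpair_eqE (negbTE ne_i) !mul0r.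
rewrite (bigD1 p1) //= [X in _ + X]big1 ?addr0; last first.
  move=> j ne_j; apply: big1 => k _.
  by rewrite !xpair_eqE (negbTE ne_j) andbF !mul0r.
rewrite (bigD1 q1) //= [X in _ + X]big1 ?addr0; last first.
  by move=> k ne_k; rewrite !xpair_eqE (negbTE ne_k) andbF mulr0 mul0r.
rewrite !xpair_eqE !eqxx mul1r andbT [p0 == _]eq_sym.
by case: (p1 == q0); case: (q1 == s0); case: (s1 == p0); rewrite ?(mulr0, mul0r, mulr1).
Qed.

Definition mm_error (F : fieldType) : tensor F (mm_index 2 2 4) :=
  [ffun x : {dffun forall k, mm_index 2 2 4 k} =>
   degen_error (unit_entry F (x leg0)) (unit_entry F (x leg1)) (unit_entry F (x leg2))].

(** The entries of a tensor are the values of its trilinear form at matrix units;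
    dividing [degenerationE] by [e^2] leaves the error term [e * mm_error]. *)
Lemma matmul224_degeneration (F : fieldType) (e : F) : e != 0 ->
  sum_of_simple ([ffun x => matmul_tensor F 2 2 4 x + e * mm_error F x]
                 : tensor F (mm_index 2 2 4)) 13.
Proof.
move=> nz_e; apply/sum_of_simple_mmP.
exists (fun l p => e ^- 2 * (degen_a e (unit_entry F p))`_l),
  (fun l p => (degen_b e (unit_entry F p))`_l),
  (fun l p => (degen_c e (unit_entry F p))`_l) => x.
under eq_bigr => l _ do rewrite -!mulrA.
rewrite -mulr_sumr; under eq_bigr => l _ do rewrite mulrA.
rewrite degenerationE sum_unit_entry [LHS]ffunE [mm_error F x]ffunE matmul_tensorE.
move: (_ * _ * _) (degen_error _ _ _) => u v.
by field.
Qed.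

(** One of the [M + 1] points that the hypothesis provides may be zero. *)
Lemma nonzero_points (F : fieldType) (M : nat) :
  (`I_M.+1 #<= [set: F])%card ->
  exists e : 'I_M -> F, injective e /\ forall j, e j != 0.
Proof.
pose Fp : pointedType := HB.pack (GRing.Field.sort F) (isPointed.Build F 0).
move=> /(@pcard_leP _ Fp)/unsquash g.
have [f f_inj] : exists f : nat -> F,
    forall i j, (i <= M)%N -> (j <= M)%N -> f i = f j -> i = j.
  exists g => i j le_i le_j.
  by apply: (@inj _ _ _ g); apply/mem_set => /=; lia.
pose s := [seq x <- [seq f i | i <- iota 0 M.+1] | x != 0].
have uniq_fs : uniq [seq f i | i <- iota 0 M.+1].
  rewrite map_inj_in_uniq ?iota_uniq // => i j; rewrite !mem_iota => i_lt j_lt.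
  by apply: f_inj; lia.
have sz_s : (M <= size s)%N.
  rewrite size_filter -ltnS.
  rewrite -[leqLHS](_ : size [seq f i | i <- iota 0 M.+1] = _); last first.
    by rewrite size_map size_iota.
  rewrite -(count_predC (fun x => x != 0)) -[leqRHS]addn1 leq_add2l.
  rewrite (@eq_count _ _ (pred1 0)) => [|x /=]; last by rewrite negbK.
  by rewrite count_uniq_mem // leq_b1.
exists (fun j : 'I_M => s`_j); split=> [i j /eqP|j].
  by rewrite nth_uniq ?filter_uniq ?(leq_trans (ltn_ord _)) // => /eqP/val_inj.
have : s`_j \in s by rewrite mem_nth // (leq_trans (ltn_ord _)).
by rewrite mem_filter => /andP[].
Qed.

(** The factor 79 is at most [(3/2)^13], and [78 = 6 * 13]. *)
Lemma numeric_gap (a b : nat) :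
  (3 * a ^ 6 < 2 * b ^ 6)%N -> (79 * a ^ 78 < b ^ 78)%N.
Proof.
move=> lt_ab.
have : ((3 * a ^ 6) ^ 13 < (2 * b ^ 6) ^ 13)%N by rewrite ltn_exp2r.
rewrite (expnMn 3) (expnMn 2) -(expnM a) -(expnM b) (_ : (6 * 13)%N = 78%N) //.
have : (79 * 2 ^ 13 <= 3 ^ 13)%N by lia.
move: (a ^ 78)%N (b ^ 78)%N (2 ^ 13)%N (3 ^ 13)%N => A B p q; nia.
Qed.
Lemma gap_13_14 : (3 * 13 ^ 6 < 2 * 14 ^ 6)%N.
Proof. by lia. Qed.

(** * The rank of 2 x 2 by 2 x 4 products and the conclusion *)

Lemma sum_of_simple_pow (F : fieldType) (K : finType) (J : K -> finType)
    (t : tensor F J) r n : sum_of_simple t r -> sum_of_simple (tensor_pow t n) (r ^ n).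
Proof.
move=> /sum_of_simpleE[u Hu]; elim: n => [|n IHn].
  apply/sum_of_simpleE; exists (fun=> fun=> 0) => x.
  rewrite tensor_powE big_ord0 big_ord1 big1 // => -[c k] _; by case: c.
rewrite expnS -(add1n n); apply: sum_of_simple_pow_add IHn.
apply/sum_of_simpleE; exists (fun l ck => u l ck.2) => x.
rewrite tensor_powE big_ord1 Hu; apply: eq_bigr => l _.
rewrite (prod_pairE (fun ck => u l ck.2 (x ck))) big_ord1.
by apply: eq_bigr => k _; rewrite ffunE.
Qed.

Definition mm_point n1 n2 n3 (u : 'I_n1 * 'I_n2) (v : 'I_n2 * 'I_n3) (z : 'I_n3 * 'I_n1)
    (k : 'I_3) : mm_index n1 n2 n3 k :=
  match val k as m return
    (match m return finType with
     | 0 => ('I_n1 * 'I_n2)%type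
     | 1 => ('I_n2 * 'I_n3)%type
     | _ => ('I_n3 * 'I_n1)%type
     end)
  with
  | 0 => u
  | 1 => v
  | _ => z
  end.

Lemma dot_pair (F : fieldType) m n (B C : 'M[F]_(m, n)) :
  dot B C = \sum_(u : 'I_m * 'I_n) B u.1 u.2 * C u.1 u.2.
Proof. by rewrite dotE pair_bigA. Qed.

Lemma mul3_sums (R : comNzRingType) (U V W : finType) (a : U -> R) (b : V -> R) (c : W -> R) :
  (\sum_u a u) * (\sum_v b v) * (\sum_z c z) = \sum_u \sum_v \sum_z a u * b v * c z.
Proof.
rewrite -mulrA mulr_suml; apply: eq_bigr => u _; rewrite big_distrlr /= mulr_sumr.
by apply: eq_bigr => v _; rewrite mulr_sumr; apply: eq_bigr => z _; rewrite mulrA.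
Qed.

(** The entries of a tensor decomposition are the coefficients of the trilinear
    form [dot y (A *m x)]; the third factor is transposed, since its legs are
    listed cyclically. *)
Lemma mm_decomp_of_sum_of_simple (F : fieldType) n r :
  sum_of_simple (matmul_tensor F 2 2 n) r ->
  exists (f : 'I_r -> 'M[F]_2) (g h : 'I_r -> 'M[F]_(2, n)), mm_decomp f g h.
Proof.
move=> /sum_of_simple_mmP[f [g [h fghE]]].
exists (fun l => \matrix_(p, q) f l (p, q)), (fun l => \matrix_(q, s) g l (q, s)),
  (fun l => (\matrix_(s, p) h l (s, p))^T) => A x y.
have coefE u v z : \sum_(l < r) f l u * g l v * h l z =
    (u.2 == v.1)%:R * ((v.2 == z.1)%:R * (z.2 == u.1)%:R).
  have := fghE [ffun k => mm_point u v z k].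
  by rewrite matmul_tensorE !ffunE /= mulrA => ->.
transitivity (\sum_u \sum_v \sum_z
    (u.2 == v.1)%:R * ((v.2 == z.1)%:R * (z.2 == u.1)%:R) *
    (A u.1 u.2 * x v.1 v.2 * y z.2 z.1)).
  under eq_bigr => l _ do rewrite -[dot _^T y]dot_tr trmxK !dot_pair mul3_sums.
  rewrite exchange_big; apply: eq_bigr => u _; rewrite exchange_big; apply: eq_bigr => v _.
  rewrite exchange_big; apply: eq_bigr => z _; rewrite -coefE mulr_suml; apply: eq_bigr => l _.
  by rewrite !mxE -!surjective_pairing; ring.
transitivity (\sum_u \sum_s A u.1 u.2 * x u.2 s * y u.1 s).
  apply: eq_bigr => u _; rewrite -(pair_bigA _ (fun q s => \sum_z
    (u.2 == q)%:R * ((s == z.1)%:R * (z.2 == u.1)%:R) * (A u.1 u.2 * x q s * y z.2 z.1))) /=.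
  rewrite (bigD1 u.2) //= [X in _ + X]big1 ?addr0 => [|q ne_q]; last first.
    apply: big1 => s _; apply: big1 => z _.
    by rewrite eq_sym (negbTE ne_q) !mul0r.
  apply: eq_bigr => s _; rewrite (bigD1 (s, u.1)) //= big1 ?addr0 => [|z ne_z].
    by rewrite !eqxx !mul1r.
  rewrite eqxx mul1r; move: ne_z; case: z => z1 z2; rewrite xpair_eqE /= [s == _]eq_sym.
  by rewrite negb_and => /orP[]/negbTE ->; rewrite ?mulr0 !mul0r.
rewrite -(pair_bigA _ (fun p q => \sum_s A p q * x q s * y p s)) dotE /=.
apply: eq_bigr => p _; rewrite exchange_big; apply: eq_bigr => s _.
by rewrite mxE mulr_sumr; apply: eq_bigr => q _; rewrite mulrC.
Qed.

Lemma matmul224_rank_ge14 (F : fieldType) r :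
  sum_of_simple (matmul_tensor F 2 2 4) r -> (14 <= r)%N.
Proof.
move=> /mm_decomp_of_sum_of_simple[f [g [h dec]]].
have := rank_lower_bound dec isT; rewrite card_ord => r_gt12.
rewrite ltn_neqAle r_gt12 andbT; apply/eqP => r13.
by apply: (no_decomposition_13 dec); rewrite card_ord.
Qed.

Lemma matmul224_pow78_rank (F : fieldType) : (`I_80 #<= [set: F])%card ->
  (tensor_rank (tensor_pow (matmul_tensor F 2 2 4) 78) <= 79 * 13 ^ 78)%N.
Proof.
move=> /nonzero_points[e [e_inj nz_e]].
have [_] := tensor_rankP (@ord0 77, leg0) (tensor_pow (matmul_tensor F 2 2 4) 78); apply.
apply: (sum_of_simple_pow_of_degeneration (t1 := mm_error F) ord0 leg0 e_inj) => j.
exact: matmul224_degeneration.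
Qed.

Local Open Scope nat_scope.
Local Open Scope classical_set_scope.
Local Open Scope card_scope.

Theorem proposition18 :
  exists N : nat, forall (F : fieldType) (n : nat),
    `I_N #<= [set: F] -> 78 <= n ->
    tensor_rank (tensor_pow (matmul_tensor F 2 2 4) n)
      < tensor_rank (matmul_tensor F 2 2 4) ^ n.
Proof.
exists 80 => F n F80 /subnKC <-; move: (n - 78) => m; set t := matmul_tensor F 2 2 4.
have [t_rank _] := tensor_rankP leg0 t.
have R14 := matmul224_rank_ge14 t_rank; set R := tensor_rank t in t_rank R14 *.
have [s_rank _] := tensor_rankP (@ord0 77, leg0) (tensor_pow t 78).
have [_ min_rank] := tensor_rankP (lshift m (@ord0 77), leg0) (tensor_pow t (78 + m)).
apply: leq_ltn_trans (min_rank _ (sum_of_simple_pow_add s_rank (sum_of_simple_pow m t_rank))) _.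
rewrite expnD ltn_pmul2r ?expn_gt0 ?(leq_trans _ R14) //.
apply: leq_ltn_trans (matmul224_pow78_rank F80) _.
by apply: leq_trans (numeric_gap gap_13_14) _; rewrite leq_exp2r.
Qed.
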